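(* Let $h\ge 2$ be a fixed integer, let $c\in\mathbb Z/h\mathbb Z$ be a fixed residue class, and let $a,b$ be fixed real numbers with $0\le a<b\le 1$. Then, as $n\to\infty$ through all positive integers, $$\sum_{\substack{p\ \mathrm{prime},\ n^a<p\le n^b\\ v_p(n!)\equiv c\ (\mathrm{mod}\ h)}} v_p(n!)\,\log p=\left(\frac{b-a}{h}+o(1)\right)\log(n!).$$
   Context: For a prime $p$, $v_p(n!)=\sum_{j\ge1}\lfloor n/p^j\rfloor$ is the exponent of $p$ in the factorization of $n!$. The parameters $h,c,a,b$ are fixed independently of $n$; the $o(1)$ term tends to $0$ as $n\to\infty$ for each fixed choice of them and is not asserted to be uniform in them. *)

(* Defs.v *)
From HB Require Import structures.
From mathcomp Require Export all_boot all_order all_algebra.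
From mathcomp Require Export all_classical all_reals all_analysis.

Set Implicit Arguments.
Unset Strict Implicit.
Unset Printing Implicit Defensive.

Import Order.TTheory GRing.Theory Num.Theory.
Import numFieldNormedType.Exports.

Local Open Scope ring_scope.

(* The index range [0, n] loses nothing when b <= 1 and n >= 1, since then
   p <= n `^ b <= n.  The residue class lives in 'Z_h, which is Z/hZ for
   h >= 2. *)
Definition vp_log_sum (R : realType) (h : nat) (c : 'Z_h) (a b : R) (n : nat)
    : R :=
  \sum_(0 <= p < n.+1 | [&& prime p, n%:R `^ a < p%:R, p%:R <= n%:R `^ b
                          & (logn p n`!)%:R == c])
    (logn p n`!)%:R * ln (p%:R : R).

(* Main.v *)
Require Import Defs.
From mathcomp Require Import all_boot all_order all_algebra.
From mathcomp Require Import all_classical all_reals all_analysis.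
From mathcomp Require Import ring lra zify.
From mathcomp Require Import complex.

Set Implicit Arguments.
Unset Strict Implicit.
Unset Printing Implicit Defensive.

Import Order.TTheory GRing.Theory Num.Theory.
Import numFieldNormedType.Exports.

Local Open Scope classical_set_scope.
Local Open Scope ring_scope.

(** By Legendre's formula the exponent of [p] in [n`!] is [n / p] up to
    [O (1 + n / p ^ 2)], so that its product with [ln p] may be replaced by
    [n * wp p], where [wp p = ln p / p], at a total cost of [O (n)]
    ([logn_weight_error]); and [ln n`!] is [n * ln n + O (n)]. The residue
    class of the exponent is detected by the [h]-th roots of unity [w]
    ([residue_indicator]). For [w = 1] the sum is evaluated by Mertens'
    theorem ([mertens_range]) and gives the main term, the share
    [(b - a) / h]. It remains to show that for [w <> 1] the sum of
    [wp p * w ^ logn p n`!] over [n ^ s < p <= n ^ t] is [o (ln n)]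
    ([small_all]): the exponents are equidistributed modulo [h].

    By Mertens' theorem short ranges of exponents [s, t] cost little
    ([small_inner]), so one may stay away from [0] and from the points
    [1 / j]. Between two such points the exponent of [p] is the sum of the
    integer parts of [n / p ^ j] over a fixed range [1 <= j <= J], and
    [w ^ logn p n`!] is a product of [J] step functions. Each of them is close
    to a trigonometric polynomial without constant term ([step_approx]),
    except near its discontinuities, where a Fejer kernel majorizes the error
    ([near_majorant]). Expanding the product leaves exponential sums over
    primes, with phase a polynomial in [1 / p] without constant term whose
    coefficients are multiples of [n] and whose coefficient of degree one is
    not zero; the terms of the majorants have the same form with a single
    power of [1 / p]. Everything rests on the estimate [wp_phase_small] for
    these sums ([generic_range_small]).

    That estimate is proved with a saving that is an arbitrary power of a
    logarithm. Vaughan's identity ([vaughan]) and the Cauchy-Schwarz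
    inequality reduce a sum over primes to sums over integers of a dilate of
    the phase, or of a difference of two dilates ([prime_sum_bound]); both are
    again polynomials in [1 / m] ([phase_prime_bound]). Their lowest term
    dominates, so all their differences have a known size ([iter_bd_phase]),
    and van der Corput's method, stated with finite differences instead of
    derivatives ([kusmin_landau], [second_difference_test],
    [van_der_corput_test]), shows cancellation as soon as the phase lies
    between a small power and some fixed power of the length of the sum
    ([phase_sum_bound]). For [p <= n ^ t] and a phase of lowest degree [j]
    with [t * j < 1], the phase has at least the size [n ^ (1 - t * j)], a
    positive power of [n], so that the losses by logarithms are harmless
    ([phase_primes_small]). *)

(** * The additive character and elementary inequalities for sums *)

(* [lia] on the hypotheses about natural numbers only: the boolean inequalities
   between reals would otherwise be treated as propositional atoms. *)
Ltac nlia := intros; repeat match goal with H : ?P |- _ =>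
    match type of P with Prop =>
      match P with context [?r] =>
        match type of r with Real.type => clear H end
      end
    end
  end; lia.

Lemma lemul2l (R : realType) (w x y : R) : 0 <= w -> x <= y -> w * x <= w * y.
Proof. by move=> w0 xy; rewrite ler_wpM2l. Qed.

Lemma lemul2r (R : realType) (w x y : R) : 0 <= w -> x <= y -> x * w <= y * w.
Proof. by move=> w0 xy; rewrite ler_wpM2r. Qed.

Section ComplexExponential.
Variable R : realType.
Local Notation C := R[i].

(** The modulus as an element of [R]; the norm of a complex number is itself
    complex. *)
Definition cabs (z : C) : R := Normc.normc z.

Lemma cabsE (z : C) : cabs z = Num.sqrt (complex.Re z ^+ 2 + complex.Im z ^+ 2).
Proof. by case: z. Qed.

Lemma cabsM (x y : C) : cabs (x * y) = cabs x * cabs y.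
Proof. exact: Normc.normcM. Qed.

Lemma cabsD (x y : C) : cabs (x + y) <= cabs x + cabs y.
Proof. exact: le_normcD. Qed.

Lemma cabsN (x : C) : cabs (- x) = cabs x.
Proof. exact: normcN. Qed.

Lemma cabs_ge0 (x : C) : 0 <= cabs x.
Proof. by rewrite cabsE sqrtr_ge0. Qed.

Lemma cabs0 : cabs 0 = 0.
Proof. exact: Normc.normc0. Qed.

Lemma cabs1 : cabs 1 = 1.
Proof. exact: Normc.normc1. Qed.

Lemma cabs_real (x : R) : cabs (x%:C)%C = `|x|.
Proof. by rewrite cabsE /= expr0n addr0 sqrtr_sqr. Qed.

Lemma cabsB (x y : C) : cabs (x - y) <= cabs x + cabs y.
Proof. by rewrite -(cabsN y) cabsD. Qed.

Lemma cabs_sum I (r : seq I) (P : pred I) (F : I -> C) :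
  cabs (\sum_(i <- r | P i) F i) <= \sum_(i <- r | P i) cabs (F i).
Proof.
elim/big_rec2: _ => [|i y x _ h]; first by rewrite cabs0.
by rewrite (le_trans (cabsD _ _)) // lerD2l.
Qed.

Lemma cabs_prod I (r : seq I) (P : pred I) (F : I -> C) :
  cabs (\prod_(i <- r | P i) F i) = \prod_(i <- r | P i) cabs (F i).
Proof. by elim/big_rec2: _ => [|i y x _ <-]; rewrite ?cabs1 ?cabsM. Qed.

Lemma cabsX (z : C) n : cabs (z ^+ n) = cabs z ^+ n.
Proof. by elim: n => [|n IH]; rewrite ?expr0 ?cabs1 // !exprS cabsM IH. Qed.

Lemma cabs_conj (z : C) : cabs (conjc z) = cabs z.
Proof. by rewrite !cabsE; case: z => a b /=; rewrite sqrrN. Qed.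

Lemma conjZ (x : R) (z : C) : conjc (x%:C%C * z) = x%:C%C * conjc z.
Proof.
case: z => a b; apply/eqP; rewrite eq_complex /=.
by apply/andP; split; apply/eqP; ring.
Qed.

Lemma conj_mul_conj (z1 z2 : C) : conjc (z1 * conjc z2) = z2 * conjc z1.
Proof. by rewrite rmorphM /= conjcK mulrC. Qed.

Lemma mul_conj (z : C) : z * conjc z = ((cabs z ^+ 2)%:C)%C.
Proof.
rewrite cabsE sqr_sqrtr ?addr_ge0 ?sqr_ge0 //; case: z => a b /=.
by apply/eqP; rewrite eq_complex /=; apply/andP; split; apply/eqP; ring.
Qed.

Lemma Re_le_cabs (z : C) : complex.Re z <= cabs z.
Proof.
rewrite cabsE (le_trans (ler_norm _)) // -sqrtr_sqr ler_wsqrtr //.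
by rewrite lerDl sqr_ge0.
Qed.

(** The additive character x |-> exp (2 i pi x). *)
Definition e (x : R) : C := Complex (cos (2 * pi * x)) (sin (2 * pi * x)).

Lemma eD x y : e (x + y) = e x * e y.
Proof.
rewrite /e mulrDr cosD sinD.
by apply/eqP; rewrite eq_complex /=; apply/andP; split; apply/eqP; ring.
Qed.

Lemma cabs_e x : cabs (e x) = 1.
Proof. by rewrite cabsE /= cos2Dsin2 sqrtr1. Qed.

Lemma e0 : e 0 = 1.
Proof. by rewrite /e mulr0 cos0 sin0. Qed.

Lemma eN x : e (- x) = conjc (e x).
Proof. by rewrite /e /= mulrN cosN sinN. Qed.

Lemma e1 : e 1 = 1.
Proof. by rewrite /e mulr1 mulr_natl cos2pi sin2pi. Qed.

Lemma eMn x n : e (x *+ n) = e x ^+ n.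
Proof. by elim: n => [|n IH]; rewrite ?mulr0n ?e0 // mulrS eD IH exprS. Qed.

Lemma e_nat n : e n%:R = 1.
Proof. by rewrite eMn e1 expr1n. Qed.

Lemma e_sum I (r : seq I) (P : pred I) (F : I -> R) :
  e (\sum_(i <- r | P i) F i) = \prod_(i <- r | P i) e (F i).
Proof. by elim/big_rec2: _ => [|i y x _ <-]; rewrite ?e0 ?eD. Qed.

Lemma e_int z : e z%:~R = 1.
Proof.
case: z => n; first exact: e_nat.
have -> : (Negz n)%:~R = - n.+1%:R :> R by [].
by rewrite eN e_nat /= oppr0.
Qed.

End ComplexExponential.

Section Sums.
Variable R : realType.
Local Notation C := R[i].

(** Lagrange's identity: the difference of the two sides, doubled, is the sum
    of the squares of x i * y j - x j * y i. *)
Lemma cauchy_schwarz I (r : seq I) (x y : I -> R) :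
  (\sum_(i <- r) x i * y i) ^+ 2 <=
  (\sum_(i <- r) x i ^+ 2) * (\sum_(i <- r) y i ^+ 2).
Proof.
have h : 0 <= \sum_(i <- r) \sum_(j <- r) (x i * y j - x j * y i) ^+ 2.
  by apply: sumr_ge0 => i _; apply: sumr_ge0 => j _; exact: sqr_ge0.
have E : \sum_(i <- r) \sum_(j <- r) (x i * y j - x j * y i) ^+ 2 =
  ((\sum_(i <- r) x i ^+ 2) * (\sum_(i <- r) y i ^+ 2) -
   (\sum_(i <- r) x i * y i) ^+ 2) *+ 2.
  have E1 : (\sum_(i <- r) x i ^+ 2) * (\sum_(i <- r) y i ^+ 2) =
    \sum_(i <- r) \sum_(j <- r) x i ^+ 2 * y j ^+ 2.
    by rewrite big_distrlr.
  have E2 : (\sum_(i <- r) x i ^+ 2) * (\sum_(i <- r) y i ^+ 2) =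
    \sum_(i <- r) \sum_(j <- r) x j ^+ 2 * y i ^+ 2.
    by rewrite E1 exchange_big.
  have E3 : (\sum_(i <- r) x i * y i) ^+ 2 =
    \sum_(i <- r) \sum_(j <- r) (x i * y i) * (x j * y j).
    by rewrite expr2 big_distrlr.
  rewrite mulrnBl mulr2n {1}E1 E2 E3 -sumrMnl -big_split -sumrB /=.
  apply: eq_bigr => i _; rewrite -sumrMnl -big_split -sumrB /=.
  by apply: eq_bigr => j _; ring.
by move: h; rewrite E pmulrn_lge0 // subr_ge0.
Qed.

Lemma cabs_cauchy_schwarz I (r : seq I) (a : I -> R) (z : I -> C) :
  cabs (\sum_(i <- r) (a i)%:C%C * z i) ^+ 2 <=
  (\sum_(i <- r) a i ^+ 2) * (\sum_(i <- r) cabs (z i) ^+ 2).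
Proof.
have -> : \sum_(i <- r) a i ^+ 2 = \sum_(i <- r) `|a i| ^+ 2.
  by apply: eq_bigr => i _; rewrite real_normK ?num_real.
apply: le_trans (cauchy_schwarz _ _ _).
rewrite lerXn2r ?nnegrE ?cabs_ge0 ?sumr_ge0 //.
  by move=> i _; rewrite mulr_ge0 ?cabs_ge0.
apply: (le_trans (cabs_sum _ _ _)); apply: ler_sum => i _.
by rewrite cabsM cabs_real.
Qed.

Lemma sum_by_parts (w : nat -> R) (z : nat -> C) s t : (s <= t)%N ->
  \sum_(s <= i < t) (w i)%:C%C * z i =
  (w t)%:C%C * (\sum_(s <= i < t) z i) +
  \sum_(s <= i < t) (w i - w i.+1)%:C%C * (\sum_(s <= j < i.+1) z j).
Proof.
move=> st; elim: t st => [|t IH].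
  by rewrite leqn0 => /eqP ->; rewrite !big_geq // mulr0 addr0.
rewrite leq_eqVlt => /orP[/eqP ->|].
  by rewrite !big_geq // mulr0 addr0.
rewrite ltnS => st; rewrite big_nat_recr //= IH //.
rewrite [in RHS]big_nat_recr //= [X in _ = _ + X]big_nat_recr //=.
rewrite [X in (_ - _)%:C%C * X]big_nat_recr //= rmorphB /=.
ring.
Qed.

(** Partial summation: the differences of a monotone weight have one sign, so
    they telescope against the common bound [M] of the partial sums. *)
Lemma abel_decr (w : nat -> R) (z : nat -> C) s t M : (s <= t)%N ->
  (forall i, (s <= i <= t)%N -> 0 <= w i) ->
  (forall i, (s <= i < t)%N -> w i.+1 <= w i) ->
  (forall t', (s <= t' <= t)%N -> cabs (\sum_(s <= i < t') z i) <= M) ->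
  cabs (\sum_(s <= i < t) (w i)%:C%C * z i) <= w s * M.
Proof.
move=> st w0 wd hM; rewrite sum_by_parts //.
apply: (le_trans (cabsD _ _)).
apply: (@le_trans _ _ (w t * M + \sum_(s <= i < t) (w i - w i.+1) * M)).
  apply: lerD.
    have wt : 0 <= w t by apply: w0; rewrite st leqnn.
    rewrite cabsM cabs_real ger0_norm //; apply: lemul2l => //.
    by apply: hM; rewrite st leqnn.
  apply: (le_trans (cabs_sum _ _ _)); rewrite !big_seq; apply: ler_sum => i.
  rewrite mem_index_iota => hi; have h : 0 <= w i - w i.+1 by rewrite subr_ge0 wd.
  rewrite cabsM cabs_real ger0_norm //.
  by apply: lemul2l => //; apply: hM; lia.
rewrite -big_distrl /= -mulrDl.
have -> : \sum_(s <= i < t) (w i - w i.+1) = w s - w t.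
  rewrite -opprB -telescope_sumr // -sumrN.
  by apply: eq_bigr => i _; rewrite opprB.
by rewrite addrC subrK.
Qed.

(** The boundary term and the telescoping differences are both at most
    [w t * M], whence the factor [2]. *)
Lemma abel_incr (w : nat -> R) (z : nat -> C) s t M : (s <= t)%N -> 0 <= M ->
  (forall i, (s <= i <= t)%N -> 0 <= w i) ->
  (forall i, (s <= i < t)%N -> w i <= w i.+1) ->
  (forall t', (s <= t' <= t)%N -> cabs (\sum_(s <= i < t') z i) <= M) ->
  cabs (\sum_(s <= i < t) (w i)%:C%C * z i) <= 2 * w t * M.
Proof.
move=> st M0 w0 wd hM; rewrite sum_by_parts //.
apply: (le_trans (cabsD _ _)).
apply: (@le_trans _ _ (w t * M + \sum_(s <= i < t) (w i.+1 - w i) * M)).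
  apply: lerD.
    have wt : 0 <= w t by apply: w0; rewrite st leqnn.
    rewrite cabsM cabs_real ger0_norm //; apply: lemul2l => //.
    by apply: hM; rewrite st leqnn.
  apply: (le_trans (cabs_sum _ _ _)); rewrite !big_seq; apply: ler_sum => i.
  rewrite mem_index_iota => hi; have h : 0 <= w i.+1 - w i by rewrite subr_ge0 wd.
  rewrite cabsM cabs_real distrC ger0_norm //.
  by apply: lemul2l => //; apply: hM; lia.
have := w0 s; rewrite st leqnn => /(_ isT) h.
rewrite -big_distrl /= telescope_sumr // -mulrDl.
by apply: lemul2r => //; lra.
Qed.

Lemma cos_pi4_ge : 1 / 2 <= cos (pi / 4 : R).
Proof.
have h0 : 0 < cos (pi / 4 : R).
  by apply: cos_gt0_pihalf; have := @pi_gt0 R; lra.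
have : cos ((pi / 4 : R) *+ 2) = 0.
  by rewrite -[RHS]cos_pihalf; congr cos; field.
rewrite cos_mulr2n => h.
rewrite leNgt; apply/negP => h1; have : cos (pi / 4 : R) ^+ 2 < 1/4 by nra.
by lra.
Qed.

(** Up to [1 / 4] this is the mean value theorem, the cosine being at least
    [1 / 2] and pi at least [2]; beyond, the sine increases from a value that
    is at least [1 / 2]. *)
Lemma sin_pi_ge (x : R) : 0 <= x <= 1 / 2 -> x <= sin (pi * x).
Proof.
move=> /andP[x0 x2]; have p0 := @pi_gt0 R; have p2 := @pi_ge2 R.
have h4 := cos_pi4_ge.
have main (y : R) : 0 < y <= 1/4 -> y <= sin (pi * y).
  move=> /andP[y0 y4].
  have py : 0 < pi * y by exact: mulr_gt0.
  have [|c hc] := @MVT R sin cos 0 (pi * y) py (fun x _ => is_derive_sin x).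
    by apply: continuous_subspaceT => z; exact: continuous_sin.
  rewrite sin0 !subr0 => ->.
  move: hc; rewrite in_itv /= => /andP[c0 cy].
  have h : 1/2 <= cos c.
    apply: (le_trans h4); rewrite ltW // ltr_cos ?in_itv /=; nra.
  nra.
case: (ltP x (1/4)) => [x4|x4].
  case: (ltP 0 x) => [xp|xn]; first by apply: main; lra.
  have -> : x = 0 by lra.
  by rewrite mulr0 sin0.
have h14 := main (1/4).
have : sin (pi / 4) <= sin (pi * x).
  rewrite le_eqVlt; case: (eqVneq x (1/4)) => [->|nx].
    by rewrite mul1r eqxx.
  apply/orP; right; rewrite ltr_sin ?in_itv /=; last 2 first.
  - by nra.
  - by nra.
  have : 1/4 < x by rewrite lt_neqAle eq_sym nx.
  by nra.
have E : sin (pi / 4 : R) ^+ 2 = cos (pi / 4) ^+ 2.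
  have : cos ((pi / 4 : R) *+ 2) = 0.
    by rewrite -[RHS]cos_pihalf; congr cos; field.
  by rewrite cos_mulr2n sin2cos2; lra.
have s0 : 0 < sin (pi / 4 : R) by apply: sin_gt0_pihalf; lra.
have : 1/2 <= sin (pi / 4 : R).
  by rewrite leNgt; apply/negP => h; nra.
lra.
Qed.

Lemma sin_pi_far (x d : R) : 0 < d -> d <= x <= 1 - d -> d <= sin (pi * x).
Proof.
move=> d0 /andP[dx xd]; case: (leP x (1/2)) => h.
  by apply: (le_trans dx); apply: sin_pi_ge; lra.
have -> : pi * x = pi - pi * (1 - x) by ring.
have -> : sin (pi - pi * (1 - x)) = sin (pi * (1 - x)).
  by rewrite sinB sinpi cospi; ring.
by apply: (@le_trans _ _ (1 - x)); [lra|apply: sin_pi_ge; lra].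
Qed.

End Sums.

(** * The second difference test *)

Section SecondDifference.
Variable R : realType.
Local Notation C := R[i].
Implicit Types (u : nat -> R) (s t : nat).

Definition fd u i := u i.+1 - u i.

Lemma cabs_sum_e_le u s t : cabs (\sum_(s <= i < t) e (u i)) <= (t - s)%:R.
Proof.
apply: (le_trans (cabs_sum _ _ _)).
rewrite (eq_bigr (fun=> 1)) => [|i _]; last exact: cabs_e.
by rewrite sumr_const_nat.
Qed.

Definition cotp (x : R) := cos (pi * x) / sin (pi * x).
(** The inverse of [e x - 1]. Its real part is constant, so its variation is
    that of the cotangent, which is monotone. *)
Definition invE (x : R) : C := Complex (- (1 / 2)) (- (cotp x / 2)).

Lemma invEP (x : R) : sin (pi * x) != 0 -> (e x - 1) * invE x = 1.
Proof.
move=> s0; rewrite /e /invE /cotp.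
have -> : 2 * pi * x = (pi * x) *+ 2 by rewrite mulr2n; ring.
rewrite cos_mulr2n sin_mulr2n cos2sin2.
apply/eqP; rewrite eq_complex /=; apply/andP; split; apply/eqP; last by field.
have : cos (pi * x) ^+ 2 = 1 - sin (pi * x) ^+ 2 by rewrite cos2sin2.
move: (cos (pi * x)) (sin (pi * x)) s0 => c s s0 h.
have -> : (((1 - s ^+ 2) *+ 2 - 1 - 1) * - (1 / 2) -
  ((c * s) *+ 2 - 0) * - (c / s / 2)) = s ^+ 2 + c ^+ 2 by field.
by rewrite h; ring.
Qed.

Lemma cotp_le (x d : R) : 0 < d -> d <= x <= 1 - d -> `|cotp x| <= 1 / d.
Proof.
move=> d0 h; have s0 := sin_pi_far d0 h.
have sp : 0 < sin (pi * x) by exact: lt_le_trans s0.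
rewrite /cotp normrM normfV (gtr0_norm sp).
apply: ler_pM => //; first by rewrite invr_ge0 ltW.
  exact: cos_max.
by rewrite lef_pV2.
Qed.

Lemma cotp_decr (x y : R) : 0 < x -> x <= y -> y < 1 -> cotp y <= cotp x.
Proof.
move=> x0 xy y1; rewrite -subr_ge0 /cotp.
have p0 := @pi_gt0 R.
have sx : 0 < sin (pi * x) by apply: sin_gt0_pi; nra.
have sy : 0 < sin (pi * y) by apply: sin_gt0_pi; nra.
have -> : cos (pi * x) / sin (pi * x) - cos (pi * y) / sin (pi * y) =
  sin (pi * y - pi * x) / (sin (pi * x) * sin (pi * y)).
  by rewrite sinB; field; rewrite !gt_eqF.
apply: divr_ge0; last by rewrite mulr_ge0 ?ltW.
by apply: sin_ge0_pi; nra.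
Qed.

Lemma sum_diff_by_parts (z G : nat -> C) s t : (s <= t)%N ->
  \sum_(s <= i < t) (z i.+1 - z i) * G i =
  z t * G t - z s * G s - \sum_(s <= i < t) z i.+1 * (G i.+1 - G i).
Proof.
elim: t => [|t IH]; first by rewrite leqn0 => /eqP ->; rewrite !big_geq //; ring.
rewrite leq_eqVlt => /orP[/eqP ->|]; first by rewrite !big_geq //; ring.
by rewrite ltnS => st; rewrite !big_nat_recr //= IH //; ring.
Qed.

Lemma cabs_invE_le (x d : R) : 0 < d -> d <= x <= 1 - d -> cabs (invE x) <= 1 / d.
Proof.
move=> d0 hx; have d2 : d <= 1 / 2 by lra.
have id : 2 <= d^-1 by rewrite -[leLHS]invrK lef_pV2 ?posrE ?invr_gt0 //; lra.
have -> : invE x = (- (1 / 2))%:C%C + Complex 0 (- (cotp x / 2)).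
  by apply/eqP; rewrite eq_complex /= add0r addr0 !eqxx.
apply: (le_trans (cabsD _ _)); rewrite cabs_real.
have -> : cabs (Complex 0 (- (cotp x / 2))) = `|cotp x| / 2.
  by rewrite cabsE /= expr0n add0r sqrtr_sqr normrN normrM normfV [`|2|]ger0_norm.
have := cotp_le d0 hx; rewrite normrN [`|1 / 2|]ger0_norm //; lra.
Qed.

(** Kusmin-Landau inequality. When the increments [fd u i] stay at distance
    [d] from the integers, [e (u i)] is the difference [e (u i.+1) - e (u i)]
    multiplied by [invE] of the increment; the increments being monotone, so
    is the cotangent in [invE], and summation by parts telescopes. *)
Lemma kusmin_landau u s t (k : int) d : 0 < d <= 1 / 2 ->
  (forall i, (s <= i < t)%N -> k%:~R + d <= fd u i <= k%:~R + 1 - d) ->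
  (forall i, (s <= i)%N -> (i.+1 < t)%N -> fd u i <= fd u i.+1) ->
  cabs (\sum_(s <= i < t) e (u i)) <= 4 / d.
Proof.
move=> /andP[d0 d2] hd hm.
have id : 2 <= d^-1.
  by rewrite -[leLHS]invrK lef_pV2 ?posrE ?invr_gt0 //; lra.
case: (leqP t s) => [ts|]; first by rewrite big_geq // cabs0 divr_ge0 // ltW.
case: t hd hm => // t hd hm; rewrite ltnS => st.
pose f i := fd u i - k%:~R.
have fE i : (s <= i <= t)%N -> d <= f i <= 1 - d.
  by move=> h; have := hd i h; rewrite /f; lra.
have ee i : e (u i.+1) = e (u i) * e (f i).
  by rewrite -eD /f /fd -[RHS]mulr1 -(e_int R k) -eD; congr e; ring.
have sn i : (s <= i <= t)%N -> sin (pi * f i) != 0.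
  by move=> h; rewrite gt_eqF // (lt_le_trans d0) // sin_pi_far // fE.
pose G i := invE (f i).
have hG i : (s <= i <= t)%N -> cabs (G i) <= 1 / d.
  by move=> h; apply: cabs_invE_le => //; exact: fE.
have dG i : (s <= i < t)%N -> cabs (G i.+1 - G i) = (cotp (f i) - cotp (f i.+1)) / 2.
  move=> h; have -> : G i.+1 - G i = Complex 0 ((cotp (f i) - cotp (f i.+1)) / 2).
    apply/eqP; rewrite eq_complex /=; apply/andP; split; apply/eqP; ring.
  rewrite cabsE /= expr0n add0r sqrtr_sqr ger0_norm // divr_ge0 // subr_ge0.
  have h1 : (s <= i <= t)%N by nlia.
  have h2 : (s <= i.+1 <= t)%N by nlia.
  have h3 : fd u i <= fd u i.+1 by apply: hm; nlia.
  have := fE i h1; have := fE i.+1 h2; move=> h4 h5.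
  by apply: cotp_decr; rewrite /f in h4 h5 *; lra.
rewrite big_nat_recr //=.
have -> : \sum_(s <= i < t) e (u i) = \sum_(s <= i < t) (e (u i.+1) - e (u i)) * G i.
  apply: eq_big_nat => i h; have h1 : (s <= i <= t)%N by nlia.
  have -> : e (u i.+1) - e (u i) = e (u i) * (e (f i) - 1) by rewrite ee; ring.
  by rewrite -mulrA invEP ?mulr1 // sn.
rewrite (@sum_diff_by_parts (fun i => e (u i)) G) //.
have b1 : cabs (e (u t) * G t) <= 1 / d by rewrite cabsM cabs_e mul1r hG ?st ?leqnn.
have b2 : cabs (e (u s) * G s) <= 1 / d by rewrite cabsM cabs_e mul1r hG ?st ?leqnn.
have b3 : cabs (\sum_(s <= i < t) e (u i.+1) * (G i.+1 - G i)) <= 1 / d.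
  apply: (le_trans (cabs_sum _ _ _)).
  rewrite (@eq_big_nat _ _ _ _ _ _ (fun i => - (cotp (f i.+1) / 2 - cotp (f i) / 2))); last first.
    by move=> i h; rewrite cabsM cabs_e mul1r dG //; ring.
  rewrite sumrN (@telescope_sumr _ s t (fun i => cotp (f i) / 2)) //.
  have h1 : (s <= t <= t)%N by nlia.
  have h2 : (s <= s <= t)%N by nlia.
  have := cotp_le d0 (fE _ h1); have := cotp_le d0 (fE _ h2).
  by rewrite !ler_norml; lra.
apply: (le_trans (cabsD _ _)); rewrite cabs_e.
have : cabs (e (u t) * G t - e (u s) * G s - \sum_(s <= i < t) e (u i.+1) * (G i.+1 - G i)) <= 3 / d.
  apply: (le_trans (cabsB _ _)); apply: (@le_trans _ _ (1/d + 1/d + 1/d)); last lra.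
  by apply: lerD => //; apply: (le_trans (cabsB _ _)); apply: lerD.
lra.
Qed.

Lemma mono_split (f : nat -> R) x s t : (s <= t)%N ->
  (forall i, (s <= i)%N -> (i.+1 < t)%N -> f i <= f i.+1) ->
  exists m, [/\ (s <= m <= t)%N, (forall i, (s <= i < m)%N -> f i < x) &
                (forall i, (m <= i < t)%N -> x <= f i)].
Proof.
elim: t => [|t IH].
  by rewrite leqn0 => /eqP -> _; exists 0%N; split=> // i; nlia.
rewrite leq_eqVlt => /orP[/eqP <- _|].
  by exists s; split; [nlia| |] => i; nlia.
rewrite ltnS => st hf.
have [m [hm h1 h2]] : exists m, [/\ (s <= m <= t)%N, (forall i, (s <= i < m)%N -> f i < x) &
                (forall i, (m <= i < t)%N -> x <= f i)].
  by apply: IH => // i si it; apply: hf => //; nlia.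
case: (ltnP m t) => mt.
  exists m; split => [|//|i hi]; first by nlia.
  case: (ltnP i t) => it; first by apply: h2; nlia.
  have -> : i = t by nlia.
  have a1 : x <= f t.-1 by apply: h2; nlia.
  have tE : t = t.-1.+1 by nlia.
  by apply: (le_trans a1); rewrite {2}tE; apply: hf; nlia.
have mt' : m = t by nlia.
subst m; case: (ltP (f t) x) => ft.
  exists t.+1; split=> [|i hi|i]; [by nlia| |by nlia].
  case: (ltnP i t) => it; first by apply: h1; nlia.
  by have -> : i = t by nlia.
exists t; split=> [|//|i hi]; first by nlia.
by have -> : i = t by nlia.
Qed.

Lemma increments_le (f : nat -> R) l s t : (s <= t)%N ->
  (forall i, (s <= i < t)%N -> l <= f i.+1 - f i) ->
  (t - s)%:R * l <= f t - f s.
Proof.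
move=> st h; rewrite -telescope_sumr // mulr_natl -sumr_const_nat.
by rewrite !big_seq; apply: ler_sum => i; rewrite mem_index_iota; exact: h.
Qed.

Lemma card_le_of_increments (f : nat -> R) x w l s t : 0 < l -> 0 <= w ->
  (forall i, (s <= i)%N -> (i.+1 < t)%N -> l <= f i.+1 - f i) ->
  (forall i, (s <= i < t)%N -> x <= f i <= x + w) ->
  (t - s)%:R <= w / l + 1.
Proof.
move=> l0 w0 hl hw; have wl : 0 <= w / l by rewrite divr_ge0 // ltW.
case: (leqP t s) => [ts|].
  have -> : (t - s = 0)%N by nlia.
  lra.
case: t hl hw => // t hl hw; rewrite ltnS => st; rewrite subSn // -natr1 lerD2r.
rewrite ler_pdivlMr //; apply: (le_trans (@increments_le f l s t st _)).
  by move=> i hi; apply: hl; nlia.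
have h1 : x <= f t <= x + w by apply: hw; nlia.
have h2 : x <= f s <= x + w by apply: hw; nlia.
lra.
Qed.

Lemma cabs_sum_split (z : nat -> C) m s t : (s <= m <= t)%N ->
  cabs (\sum_(s <= i < t) z i) <=
  cabs (\sum_(s <= i < m) z i) + cabs (\sum_(m <= i < t) z i).
Proof.
move=> /andP[sm mt]; rewrite (@big_cat_nat _ _ _ m) //=; exact: cabsD.
Qed.

(** The increments grow by at least [l], so few of them lie within [d] of an
    integer; the Kusmin-Landau inequality handles the others. *)
Lemma one_period_bound u s t (k : int) l d : 0 < l -> 0 < d <= 1 / 2 ->
  (forall i, (s <= i)%N -> (i.+1 < t)%N -> l <= fd u i.+1 - fd u i) ->
  (forall i, (s <= i < t)%N -> k%:~R <= fd u i < k%:~R + 1) ->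
  cabs (\sum_(s <= i < t) e (u i)) <= 2 * (d / l + 1) + 4 / d.
Proof.
move=> l0 hd hl hk; have d0 : 0 < d by lra.
have dl : 0 <= d / l by rewrite divr_ge0 ?ltW.
have d4 : 0 <= 4 / d by rewrite divr_ge0 // ltW.
case: (leqP t s) => [ts|ts]; first by rewrite big_geq // cabs0; lra.
have mono i : (s <= i)%N -> (i.+1 < t)%N -> fd u i <= fd u i.+1.
  by move=> h1 h2; have := hl i h1 h2; lra.
have [m [hm m1 m2]] := @mono_split (fd u) (k%:~R + d) s t (ltnW ts) mono.
have mono' i : (m <= i)%N -> (i.+1 < t)%N -> fd u i <= fd u i.+1.
  by move=> h1 h2; apply: mono => //; nlia.
have mt : (m <= t)%N by nlia.
have [p [hp p1 p2]] := @mono_split (fd u) (k%:~R + 1 - d) m t mt mono'.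
apply: (le_trans (cabs_sum_split (fun i => e (u i)) hm)).
have A : cabs (\sum_(s <= i < m) e (u i)) <= d / l + 1.
  apply: (le_trans (cabs_sum_e_le _ _ _)).
  apply: (@card_le_of_increments (fd u) k%:~R) => //; first by lra.
    by move=> i h1 h2; apply: hl => //; nlia.
  move=> i hi; have h1 := m1 i hi; have : (s <= i < t)%N by nlia.
  by move/hk; lra.
have B : cabs (\sum_(p <= i < t) e (u i)) <= d / l + 1.
  apply: (le_trans (cabs_sum_e_le _ _ _)).
  apply: (@card_le_of_increments (fd u) (k%:~R + 1 - d)) => //; first by lra.
    by move=> i h1 h2; apply: hl => //; nlia.
  move=> i hi; have h1 := p2 i hi; have : (s <= i < t)%N by nlia.
  by move/hk; lra.
have D : cabs (\sum_(m <= i < p) e (u i)) <= 4 / d.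
  apply: (@kusmin_landau u m p k) => //.
    move=> i hi; have h1 := p1 i hi; have : (m <= i < t)%N by nlia.
    by move/m2; lra.
  by move=> i h1 h2; apply: mono; nlia.
have := cabs_sum_split (fun i => e (u i)) hp; lra.
Qed.

Lemma many_periods_bound u s t (k : int) q l d : 0 < l -> 0 < d <= 1 / 2 ->
  (forall i, (s <= i)%N -> (i.+1 < t)%N -> l <= fd u i.+1 - fd u i) ->
  (forall i, (s <= i < t)%N -> k%:~R <= fd u i < k%:~R + q%:R) ->
  cabs (\sum_(s <= i < t) e (u i)) <= q%:R * (2 * (d / l + 1) + 4 / d).
Proof.
move=> l0 hd; have d0 : 0 < d by lra.
elim: q t => [|q IH] t hl hk.
  case: (leqP t s) => [ts|ts]; first by rewrite big_geq // cabs0 mul0r.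
  have : (s <= s < t)%N by nlia.
  by move/hk; lra.
have dl : 0 <= d / l by rewrite divr_ge0 ?ltW.
have d4 : 0 <= 4 / d by rewrite divr_ge0 // ltW.
case: (leqP t s) => [ts|ts].
  by rewrite big_geq // cabs0 mulr_ge0 // addr_ge0 // mulr_ge0 //; lra.
have mono i : (s <= i)%N -> (i.+1 < t)%N -> fd u i <= fd u i.+1.
  by move=> h1 h2; have := hl i h1 h2; lra.
have [m [hm m1 m2]] := @mono_split (fd u) (k%:~R + q%:R) s t (ltnW ts) mono.
apply: (le_trans (cabs_sum_split (fun i => e (u i)) hm)).
have A : cabs (\sum_(s <= i < m) e (u i)) <= q%:R * (2 * (d / l + 1) + 4 / d).
  apply: IH => [i h1 h2|i hi]; first by apply: hl => //; nlia.
  have h1 := m1 i hi; have : (s <= i < t)%N by nlia.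
  by move/hk; lra.
have B : cabs (\sum_(m <= i < t) e (u i)) <= 2 * (d / l + 1) + 4 / d.
  apply: (@one_period_bound u m t (k + q%:Z)) => //.
    by move=> i h1 h2; apply: hl => //; nlia.
  move=> i hi; have h1 := m2 i hi; have : (s <= i < t)%N by nlia.
  by move/hk; rewrite intrD -natr1 -pmulrn; lra.
by rewrite -natr1 mulrDl mul1r; apply: lerD.
Qed.

(** Van der Corput's second derivative test, for second differences. The
    increments range over an interval of length [c * l * N], hence over that
    many periods, and [d = sqrt l / 2] balances the two terms of
    [one_period_bound]. *)
Lemma second_difference_test u N (c l : R) : 1 <= c -> 0 < l <= 1 ->
  (forall i, (i.+2 < N)%N -> l <= fd u i.+1 - fd u i <= c * l) ->
  cabs (\sum_(0 <= i < N) e (u i)) <= 1 + (c * l * N%:R + 2) * (12 / Num.sqrt l).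
Proof.
move=> c1 /andP[l0 l1] hl; have : Num.sqrt l <= 1 by rewrite -(@sqrtr1 R) ler_wsqrtr.
have : Num.sqrt l ^+ 2 = l by rewrite sqr_sqrtr // ltW.
have : 0 < Num.sqrt l by rewrite sqrtr_gt0.
move: (Num.sqrt l) => q q0 qq q1.
have cl : 0 <= c * l * N%:R by rewrite !mulr_ge0 //; lra.
case: N hl cl => [|N] hl cl.
  by rewrite big_geq // cabs0 addr_ge0 // mulr_ge0 ?divr_ge0 ?ltW //; lra.
rewrite big_nat_recr //=; apply: (le_trans (cabsD _ _)); rewrite cabs_e addrC lerD2l.
have [k fk] : exists k : int, k%:~R <= fd u 0 < k%:~R + 1.
  by exists (Num.floor (fd u 0)); have := floor_itv (fd u 0); rewrite intrD.
have [Q [Qge Qle]] : exists Q : nat,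
    c * l * N.+1%:R + 1 < Q%:R /\ Q%:R <= c * l * N.+1%:R + 2.
  exists (Num.trunc (c * l * N.+1%:R)).+2.
  have := truncn_itv cl; rewrite -[(_.+2)%:R]natr1 -natr1; lra.
have d2 : 0 < q / 2 <= 1 / 2 by lra.
have hl' i : (0 <= i)%N -> (i.+1 < N)%N -> l <= fd u i.+1 - fd u i.
  by move=> _ iN; case/andP: (hl i ltac:(nlia)).
have hk i : (0 <= i < N)%N -> k%:~R <= fd u i < k%:~R + Q%:R.
  move=> /andP[_ iN].
  have lo : fd u 0 <= fd u i.
    elim: i iN => // i IH iN; apply: (le_trans (IH ltac:(nlia))).
    by have := hl' i isT iN; lra.
  have up : fd u i <= fd u 0 + i%:R * (c * l).
    elim: i iN {lo} => [|i IH] iN; first by rewrite mul0r addr0.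
    have := IH ltac:(nlia); rewrite -natr1 mulrDl mul1r.
    by have := hl i ltac:(nlia); lra.
  have up2 : i%:R * (c * l) <= c * l * N.+1%:R.
    by rewrite mulrC; apply: lemul2l; [rewrite mulr_ge0 ?ltW //; lra|rewrite ler_nat; nlia].
  by apply/andP; split; lra.
apply: (le_trans (many_periods_bound l0 d2 hl' hk)).
have iq : 1 <= q^-1 by rewrite invf_ge1.
have -> : q / 2 / l = q^-1 / 2 by rewrite -qq; field; rewrite gt_eqF.
have -> : 4 / (q / 2) = 8 * q^-1 by field; rewrite gt_eqF.
apply: ler_pM => //; first by clear -iq; lra.
by clear -iq; lra.
Qed.

End SecondDifference.

Arguments fd {R}.

(** * The van der Corput test of arbitrary order *)

Section VanDerCorput.
Variable R : realType.
Local Notation C := R[i].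

Lemma sum_support (g : nat -> C) h H L T :
  (h <= H)%N -> (H + L <= T)%N -> (forall j, ~~ (H <= j < H + L)%N -> g j = 0) ->
  \sum_(h <= j < T) g j = \sum_(0 <= i < L) g (i + H)%N.
Proof.
move=> hH HT g0.
rewrite (@big_cat_nat _ _ _ H) //=; last by nlia.
rewrite big_nat_cond big1 ?add0r => [|j hj]; last by apply: g0; nlia.
rewrite (@big_cat_nat _ _ _ (H + L)) //=; last by nlia.
rewrite [X in _ + X]big_nat_cond [X in _ + X]big1 ?addr0 => [|j hj]; last first.
  by apply: g0; nlia.
by rewrite -[in LHS](add0n H) big_addn add0n addKn.
Qed.

(** Van der Corput's inequality: the sum is averaged over its [H] first
    translates before the Cauchy-Schwarz inequality is applied, and the square
    that results is expanded into correlations. *)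
Lemma van_der_corput_inequality (z : nat -> C) N H M : 0 <= M ->
  (forall i, cabs (z i) <= 1) ->
  (forall h, (0 < h < H)%N ->
     cabs (\sum_(0 <= i < N - h) z (i + h)%N * conjc (z i)) <= M) ->
  (H%:R * cabs (\sum_(0 <= i < N) z i)) ^+ 2 <=
  (N + H)%:R * (H%:R * N%:R + H%:R ^+ 2 * M).
Proof.
move=> M0 z1 hM.
(* [z] extended by zero and moved by [H], so that its translates have
   nonnegative indices. *)
pose w i := if (H <= i < H + N)%N then z (i - H)%N else 0.
have w_out i : ~~ (H <= i < H + N)%N -> w i = 0 by rewrite /w => /negbTE ->.
have w_in i : (i < N)%N -> w (i + H)%N = z i.
  move=> iN; rewrite /w ifT; first by rewrite addnK.
  by nlia.
have shift (g : nat -> C) h : \sum_(0 <= i < N + H) g (i + h)%N =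
    \sum_(h <= j < N + H + h) g j.
  by rewrite -[in RHS](add0n h) big_addn add0n addnK.
have S1 h : (h < H)%N -> \sum_(0 <= i < N + H) w (i + h)%N = \sum_(0 <= i < N) z i.
  move=> hH; rewrite shift (@sum_support w _ H N) //; [|by nlia|by nlia].
  by apply: eq_big_nat => i hi; apply: w_in; nlia.
pose b (h1 h2 : nat) : R := (if h1 == h2 then N%:R else 0) + M.
have corr h1 h2 : (h2 < h1 < H)%N ->
    cabs (\sum_(0 <= i < N + H) w (i + h1)%N * conjc (w (i + h2)%N)) <= M.
  move=> hh; pose d := (h1 - h2)%N.
  have -> : \sum_(0 <= i < N + H) w (i + h1)%N * conjc (w (i + h2)%N) =
      \sum_(0 <= i < N - d) z (i + d)%N * conjc (z i); last first.
    by apply: hM; rewrite /d; nlia.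
  pose g j := w (j + d)%N * conjc (w j).
  rewrite (@eq_big_nat _ _ _ _ _ _ (fun i => g (i + h2)%N)); last first.
    move=> i _; rewrite /g.
    by have -> : (i + h1 = i + h2 + d)%N by rewrite /d; nlia.
  rewrite shift (@sum_support g _ H (N - d)) /d; [|by nlia|by nlia|].
    apply: eq_big_nat => i hi; rewrite /g -/d w_in; last by nlia.
    by rewrite -addnA [(H + d)%N]addnC addnA w_in // /d; nlia.
  move=> j hj; rewrite /g.
  case: (boolP (H <= j < H + N)%N) => h3; last by rewrite [w j]w_out // conjc0 mulr0.
  by rewrite w_out ?mul0r // /d; nlia.
have hb h1 h2 : (h1 < H)%N -> (h2 < H)%N ->
    cabs (\sum_(0 <= i < N + H) w (i + h1)%N * conjc (w (i + h2)%N)) <= b h1 h2.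
  move=> k1 k2; rewrite /b; case: (ltngtP h1 h2) => h12.
  - rewrite add0r -cabs_conj rmorph_sum /=.
    rewrite (eq_bigr (fun i => w (i + h2)%N * conjc (w (i + h1)%N))) => [|i _].
      by apply: corr; nlia.
    by rewrite rmorphM /= conjcK mulrC.
  - by rewrite add0r; apply: corr; nlia.
  rewrite h12; pose g j := w j * conjc (w j).
  rewrite (@shift g) (@sum_support g _ H N); [|by nlia|by nlia|]; last first.
    by move=> j hj; rewrite /g w_out ?mul0r.
  apply: (@le_trans _ _ N%:R); last by rewrite lerDl.
  apply: (le_trans (cabs_sum _ _ _)).
  apply: (@le_trans _ _ (\sum_(0 <= i < N) 1)).
    rewrite !big_seq; apply: ler_sum => i; rewrite mem_index_iota => hi.
    rewrite /g w_in; last by nlia.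
    by rewrite cabsM cabs_conj mulr_ile1 ?cabs_ge0.
  by rewrite sumr_const_nat subn0.
pose v i := \sum_(0 <= h < H) w (i + h)%N.
have Sv : H%:R * cabs (\sum_(0 <= i < N) z i) =
    cabs (\sum_(0 <= i < N + H) (1 : R)%:C%C * v i).
  have -> : \sum_(0 <= i < N + H) (1 : R)%:C%C * v i = (H%:R)%:C%C * \sum_(0 <= i < N) z i.
    rewrite (eq_bigr v) => [|i _]; last by rewrite mul1r.
    rewrite /v exchange_big /= (@eq_big_nat _ _ _ _ _ _ (fun=> \sum_(0 <= i < N) z i)).
      by rewrite sumr_const_nat subn0 rmorph_nat mulr_natl.
    by move=> h hh; apply: S1; nlia.
  by rewrite cabsM cabs_real normr_nat.
rewrite Sv; apply: (le_trans (cabs_cauchy_schwarz _ _ _)).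
rewrite (eq_bigr (fun=> 1)) => [|i _]; last by rewrite expr1n.
rewrite sumr_const_nat subn0; apply: lemul2l => //.
have -> : \sum_(0 <= i < N + H) cabs (v i) ^+ 2 =
   complex.Re (\sum_(0 <= h1 < H) \sum_(0 <= h2 < H)
      \sum_(0 <= i < N + H) w (i + h1)%N * conjc (w (i + h2)%N)).
  have -> : \sum_(0 <= h1 < H) \sum_(0 <= h2 < H)
      \sum_(0 <= i < N + H) w (i + h1)%N * conjc (w (i + h2)%N) =
      \sum_(0 <= i < N + H) v i * conjc (v i).
    rewrite (eq_bigr (fun h1 => \sum_(0 <= i < N + H) \sum_(0 <= h2 < H)
      w (i + h1)%N * conjc (w (i + h2)%N))) => [|h1 _]; last exact: exchange_big.
    rewrite exchange_big /=; apply: eq_bigr => i _.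
    by rewrite /v rmorph_sum big_distrlr.
  rewrite raddf_sum; apply: eq_bigr => i _.
  by rewrite mul_conj.
apply: (le_trans (Re_le_cabs _)).
apply: (le_trans (cabs_sum _ _ _)).
apply: (@le_trans _ _ (\sum_(0 <= h1 < H) \sum_(0 <= h2 < H) b h1 h2)).
  rewrite !big_seq; apply: ler_sum => h1; rewrite mem_index_iota => k1.
  apply: (le_trans (cabs_sum _ _ _)).
  rewrite !big_seq; apply: ler_sum => h2; rewrite mem_index_iota => k2.
  by apply: hb; nlia.
apply: (@le_trans _ _ (\sum_(0 <= h1 < H) (N%:R + H%:R * M))).
  rewrite !big_seq; apply: ler_sum => h1; rewrite mem_index_iota => k1.
  rewrite /b big_split /= sumr_const_nat subn0 mulr_natl lerD2r.
  rewrite -big_mkcond /= (eq_bigl (fun i => i == h1)) => [|i]; last by rewrite eq_sym.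
  by rewrite big_nat1_eq; case: ifP.
by rewrite sumr_const_nat subn0 -[(_ + _) *+ H]mulr_natl mulrDr mulrA expr2.
Qed.

Lemma iter_fd_shift (u : nat -> R) h m i :
  iter m fd (fun j => u (j + h)%N - u j) i =
  iter m fd u (i + h)%N - iter m fd u i.
Proof.
elim: m i => [|m IH] i //=; rewrite /fd !IH addSn; ring.
Qed.

(** The powers of [H] which bound the differences of order [k + 2], from above
    by [H ^ - vdc_a k] and from below by [H ^ vdc_b k / N ^ 2]. They double
    with the order because [H ^ 2] takes the place of [H]; the summand [2]
    accounts for the shifts, which multiply the differences by up to [H ^ 2]. *)
Fixpoint vdc_a k := if k is k'.+1 then ((vdc_a k').*2 + 2)%N else 2%N.
Fixpoint vdc_b k := if k is k'.+1 then (vdc_b k').*2 else 2%N.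

(** The van der Corput test of order [k + 2]. One application of van der
    Corput's inequality with [H ^ 2] shifts trades the order [k + 3] and the
    saving [H] for the order [k + 2] and the saving [H ^ 2]; the ratio [c] of the
    extreme differences is the same for all the shifted sequences. *)
Lemma van_der_corput_test (c : R) : 1 <= c -> exists2 B : R, 0 <= B &
  forall k H (l : R) N N' (u : nat -> R), (0 < H)%N -> (N' <= N)%N -> 0 < l ->
    l * H%:R ^+ vdc_a k <= 1 -> H%:R ^+ vdc_b k <= l * N%:R ^+ 2 ->
    (forall i, (i + k.+2 < N')%N -> l <= iter k.+2 fd u i <= c * l) ->
    cabs (\sum_(0 <= i < N') e (u i)) <= B * N%:R / H%:R.
Proof.
(* The constant bounds the case of order two and satisfies
   [2 * B + 2 <= B ^ 2], which closes the induction. *)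
move=> c1; exists (12 * c + 25); first by lra.
elim=> [|k IH] H l N N' u H0 NN l0 la lb hu.
  move: la lb => /= la lb.
  have H1 : 1 <= H%:R :> R by rewrite ler1n.
  have N0 : 0 <= N%:R :> R by [].
  have l1 : l <= 1.
    apply: le_trans la; rewrite -[leLHS]mulr1; apply: lemul2l; first exact: ltW.
    exact: exprn_ege1.
  have NN' : N'%:R <= N%:R :> R by rewrite ler_nat.
  have hu' i : (i.+2 < N')%N -> l <= fd u i.+1 - fd u i <= c * l.
    by move=> h; apply: hu; nlia.
  have l01 : 0 < l <= 1 by rewrite l0 l1.
  apply: (le_trans (second_difference_test c1 l01 hu')).
  have : Num.sqrt l ^+ 2 = l by rewrite sqr_sqrtr // ltW.
  have : 0 < Num.sqrt l by rewrite sqrtr_gt0.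
  move: (Num.sqrt l) => q q0 qq.
  have qH : q * H%:R <= 1 by rewrite leNgt; apply/negP => h; nra.
  have HqN : H%:R <= q * N%:R.
    by rewrite -(@ler_pXn2r _ 2) ?nnegrE ?exprMn ?qq // mulr_ge0 // ltW.
  have Hn : 0 < H%:R :> R by lra.
  rewrite ler_pdivlMr // -subr_ge0.
  have -> : (12 * c + 25) * N%:R - (1 + (c * l * N'%:R + 2) * (12 / q)) * H%:R =
     (12 * c) * (N%:R - N'%:R * (q * H%:R)) + 24 * (N%:R - H%:R / q) + (N%:R - H%:R).
    by rewrite -qq; field; rewrite gt_eqF.
  have a1 : 0 <= 12 * c * (N%:R - N'%:R * (q * H%:R)).
    apply: mulr_ge0; first by lra.
    have : N'%:R * (q * H%:R) <= N'%:R * 1 :> R by apply: lemul2l.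
    lra.
  have a2 : 0 <= 24 * (N%:R - H%:R / q).
    by apply: mulr_ge0 => //; rewrite subr_ge0 ler_pdivrMr // mulrC.
  have a3 : 0 <= N%:R - H%:R :> R by nra.
  lra.
set B : R := 12 * c + 25 in IH *.
have B3 : 3 <= B by rewrite /B; lra.
move: la lb => /=; rewrite -!addnn => la lb.
have H1 : 1 <= H%:R :> R by rewrite ler1n.
have Hp m : 0 < H%:R ^+ m :> R by rewrite exprn_gt0 //; lra.
pose H2 := (H ^ 2)%N.
have H2E : H2%:R = H%:R ^+ 2 :> R by rewrite /H2 natrX.
have N0 : 0 <= N%:R :> R by [].
have NN' : N'%:R <= N%:R :> R by rewrite ler_nat.
have HN : H%:R ^+ 2 <= N%:R :> R.
  have h4 : H%:R ^+ 4 <= N%:R ^+ 2 :> R.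
    have a2 : (2 <= vdc_b k + vdc_b k)%N.
      by elim: (k) => //= m; rewrite -!addnn; nlia.
    have h1 : H%:R ^+ 2 <= H%:R ^+ (vdc_b k + vdc_b k) :> R by rewrite ler_weXn2l.
    have h2 : H%:R ^+ 2 <= H%:R ^+ (vdc_a k + vdc_a k + 2) :> R.
      by rewrite ler_weXn2l //; nlia.
    have h3 : l * H%:R ^+ 2 <= 1.
      by apply: le_trans la; apply: lemul2l => //; exact: ltW.
    have h5 : H%:R ^+ 2 <= l * N%:R ^+ 2 by exact: le_trans lb.
    have -> : H%:R ^+ 4 = H%:R ^+ 2 * H%:R ^+ 2 :> R by rewrite -exprD.
    have := Hp 2%N; nra.
  by rewrite leNgt; apply/negP => h; have := Hp 2%N; nra.
have := @van_der_corput_inequality (fun i => e (u i)) N' H2 (B * N%:R / H2%:R) _ _ _.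
have M0 : 0 <= B * N%:R / H2%:R by rewrite divr_ge0 ?mulr_ge0 //; lra.
move=> /(_ M0 (fun i => (ltac:(by rewrite cabs_e)))).
have hh h : (0 < h < H2)%N ->
    cabs (\sum_(0 <= i < N' - h) e (u (i + h)%N) * conjc (e (u i))) <= B * N%:R / H2%:R.
  move=> hh; have h1 : 1 <= h%:R :> R by rewrite ler1n; nlia.
  have h2 : h%:R <= H%:R ^+ 2 :> R by rewrite -H2E ler_nat; nlia.
  rewrite (eq_bigr (fun i => e (u (i + h)%N - u i))) => [|i _]; last by rewrite eD eN.
  apply: (@IH H2 (h%:R * l) N (N' - h)%N (fun j => u (j + h)%N - u j)).
  - by rewrite expn_gt0 H0.
  - by nlia.
  - by apply: mulr_gt0 => //; lra.
  - apply: le_trans la; rewrite H2E -exprM exprD mulnC mulrA mulrAC muln2 -addnn.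
    have := Hp (vdc_a k + vdc_a k)%N; set x := _ ^+ (_ + _) => x0.
    have : 0 < l * x by exact: mulr_gt0.
    nra.
  - apply: (@le_trans _ _ (l * N%:R ^+ 2)).
      by rewrite H2E -exprM mulnC muln2 -addnn.
    have : 0 <= l * N%:R ^+ 2 by apply: mulr_ge0; [exact: ltW|exact: exprn_ge0].
    nra.
  move=> i hi; rewrite iter_fd_shift.
  have -> : iter k.+2 fd u (i + h)%N - iter k.+2 fd u i =
      \sum_(0 <= j < h) iter k.+3 fd u (i + j)%N.
    rewrite -[i in X in _ - X]addn0 -(@telescope_sumr _ 0 h (fun j => iter k.+2 fd u (i + j)%N)) //.
    by apply: eq_bigr => j _; rewrite [iter k.+3 _ _]iterS /fd addnS.
  have hj j : (0 <= j < h)%N -> l <= iter k.+3 fd u (i + j)%N <= c * l.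
    by move=> hj; apply: hu; nlia.
  apply/andP; split.
    rewrite mulr_natl -[h in leLHS]subn0 -sumr_const_nat !big_seq.
    by apply: ler_sum => j; rewrite mem_index_iota => /hj /andP[].
  rewrite mulrCA mulr_natl -[h in leRHS]subn0 -sumr_const_nat !big_seq.
  by apply: ler_sum => j; rewrite mem_index_iota => /hj /andP[].
move=> /(_ hh); set S := cabs _; rewrite H2E natrD H2E.
have S0 : 0 <= S by exact: cabs_ge0.
have Hn : 0 < H%:R :> R by lra.
move=> hS; rewrite ler_pdivlMr //.
suff : (S * H%:R) ^+ 2 <= (B * N%:R) ^+ 2.
  by rewrite ler_pXn2r // nnegrE mulr_ge0 //; lra.
have -> : (S * H%:R) ^+ 2 = (H%:R ^+ 2 * S) ^+ 2 / H%:R ^+ 2 by field; rewrite gt_eqF.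
rewrite ler_pdivrMr //; apply: (le_trans hS).
have -> : (H%:R ^+ 2) ^+ 2 * (B * N%:R / H%:R ^+ 2) = H%:R ^+ 2 * (B * N%:R).
  by field; rewrite gt_eqF.
have := Hp 2%N; move: (H%:R ^+ 2) HN => x xN x0.
have : (N'%:R + x) * (x * N'%:R + x * (B * N%:R)) <= (N%:R + N%:R) * (x * N%:R + x * (B * N%:R)).
  have N'0 : 0 <= N'%:R :> R by [].
  have BN : 0 <= B * N%:R by apply: mulr_ge0 => //; lra.
  apply: ler_pM; [lra| |lra|].
    by rewrite -mulrDr; apply: mulr_ge0; [exact: ltW|lra].
  by rewrite lerD2r; apply: lemul2l => //; exact: ltW.
move=> h; apply: (le_trans h); rewrite -subr_ge0.
have -> : (B * N%:R) ^+ 2 * x - (N%:R + N%:R) * (x * N%:R + x * (B * N%:R)) =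
  (x * N%:R ^+ 2) * (B ^+ 2 - 2 * B - 2) by ring.
apply: mulr_ge0; last by nra.
by apply: mulr_ge0; [exact: ltW|exact: exprn_ge0].
Qed.

End VanDerCorput.

(** * Exponential sums over polynomials in 1/m *)

Section NegativePowers.
Variable R : realType.

(** Backward-signed difference: its iterates are nonnegative on the sequences
    [pinv j], which are completely monotone. *)
Definition bd (f : nat -> R) m := f m - f m.+1.

(** Indexed from [m.+1], so that no value is singular. *)
Definition pinv j m : R := (m.+1%:R ^+ j)^-1.

Lemma iter_bdS (f : nat -> R) r m :
  iter r.+1 bd f m = iter r bd f m - iter r bd f m.+1.
Proof. by []. Qed.

Lemma iter_fdS (f : nat -> R) r m :
  iter r.+1 fd f m = iter r fd f m.+1 - iter r fd f m.
Proof. by []. Qed.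

(** Leibniz' rule for a factor of degree one: only its first difference,
    [- 1], survives. *)
Lemma iter_bd_mulS (f : nat -> R) r m :
  iter r bd (fun i => i.+1%:R * f i) m =
  m.+1%:R * iter r bd f m - r%:R * iter r.-1 bd f m.+1.
Proof.
elim: r m => [|r IH] m; first by rewrite mul0r subr0.
rewrite iter_bdS !IH -[m.+2%:R]natr1 -[r.+1%:R]natr1.
case: r {IH} => [|r]; first by rewrite /= /bd; ring.
by rewrite -!pred_Sn !iter_bdS; ring.
Qed.

Lemma pinvS j : pinv j = (fun i => i.+1%:R * pinv j.+1 i).
Proof.
apply/funext => i; by rewrite /pinv exprS invfM mulrA divff ?mul1r.
Qed.

(** Leibniz' rule applied to [pinv j m = m.+1 * pinv j.+1 m]: a recursion with
    positive coefficients, from which the sign and the size of all the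
    differences can be read. *)
Lemma iter_bd_pinv j r m : iter r.+1 bd (pinv j.+1) m =
  (iter r.+1 bd (pinv j) m + r.+1%:R * iter r bd (pinv j.+1) m.+1) / m.+1%:R.
Proof.
by rewrite [pinv j]pinvS iter_bd_mulS -pred_Sn subrK mulrC mulrA mulVf ?mul1r.
Qed.

Lemma iter_bd_pinv_ge0 j r m : 0 <= iter r bd (pinv j) m.
Proof.
elim: j r m => [|j IHj] r m.
  have -> : pinv 0 = fun=> 1 by apply/funext => i; rewrite /pinv invr1.
  have bd1 : bd (fun=> 1) = fun=> 0 by apply/funext => i; rewrite /bd subrr.
  have bd0 : bd (fun=> 0) = fun=> 0 by apply/funext => i; rewrite /bd subrr.
  by case: r => [|r] //=; rewrite -iterS iterSr bd1; elim: r => //= r IH; rewrite -iterS iterSr bd0.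
elim: r m => [|r IHr] m; first by rewrite /= /pinv invr_ge0 exprn_ge0.
by rewrite iter_bd_pinv divr_ge0 // addr_ge0 // mulr_ge0.
Qed.

Lemma iter_bd_pinv_le j r : exists2 K : R, 0 <= K &
  forall m, iter r bd (pinv j) m <= K * pinv (r + j) m.
Proof.
have mono i m : pinv i m.+1 <= pinv i m.
  by rewrite /pinv lef_pV2 ?posrE ?exprn_gt0 // lerXn2r ?nnegrE // ler_nat.
elim: j r => [|j IHj] r.
  have -> : pinv 0 = fun=> 1 by apply/funext => i; rewrite /pinv invr1.
  have bd1 : bd (fun=> 1) = fun=> 0 by apply/funext => i; rewrite /bd subrr.
  have bd0 : bd (fun=> 0) = fun=> 0 by apply/funext => i; rewrite /bd subrr.
  exists 1 => // m; rewrite mul1r /pinv; case: r => [|r].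
    by rewrite /= invr1.
  suff -> : iter r.+1 bd (fun=> 1) m = 0 by rewrite invr_ge0 exprn_ge0.
  by rewrite iterSr bd1; elim: r => //= r IH; rewrite -iterS iterSr bd0.
elim: r => [|r [K2 K20 h2]].
  by exists 1 => // m; rewrite mul1r add0n.
have [K1 K10 h1] := IHj r.+1.
exists (K1 + r.+1%:R * K2) => [|m]; first by rewrite addr_ge0 ?mulr_ge0.
rewrite iter_bd_pinv addnS.
have -> : pinv (r.+1 + j).+1 m = pinv (r.+1 + j) m / m.+1%:R.
  by rewrite /pinv exprS invfM mulrC.
rewrite mulrA; apply: lemul2r; first by rewrite invr_ge0.
rewrite mulrDl; apply: lerD; first exact: h1.
rewrite -mulrA; apply: lemul2l => //; apply: (le_trans (h2 _)).
by rewrite addnS addSn; apply: lemul2l.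
Qed.

Lemma iter_bd_pinv_ge j r m : pinv (r + j.+1) (m + r) <= iter r bd (pinv j.+1) m.
Proof.
elim: r m => [|r IH] m; first by rewrite addn0.
rewrite iter_bd_pinv.
have -> : pinv (r.+1 + j.+1) (m + r.+1) = pinv (r + j.+1) (m.+1 + r) / (m + r.+1).+1%:R.
  by rewrite /pinv addSn exprS invfM mulrC addSn addnS.
apply: ler_pM; rewrite ?invr_ge0 //.
- apply: (le_trans (IH _)); rewrite -[leLHS]add0r; apply: lerD.
    exact: iter_bd_pinv_ge0.
  by rewrite -[leLHS]mul1r; apply: lemul2r; rewrite ?iter_bd_pinv_ge0 // ler1n.
- by rewrite lef_pV2 ?posrE // ler_nat; nlia.
Qed.

Lemma iter_bd_sum I (s : seq I) (b : I -> R) (f : I -> nat -> R) r m :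
  iter r bd (fun i => \sum_(j <- s) b j * f j i) m =
  \sum_(j <- s) b j * iter r bd (f j) m.
Proof.
elim: r m => [|r IH] m //; rewrite iter_bdS !IH -sumrB.
by apply: eq_bigr => j _; rewrite iter_bdS mulrBr.
Qed.

(** The term of lowest degree governs the differences of a polynomial in
    [1 / m]: the term of degree [j] is smaller by a factor
    [(D * W) ^ (j - j0)], and [K0] makes the sum of these terms at most half
    of the main one. *)
Lemma iter_bd_phase j0 J (A : R) r : (0 < j0 <= J)%N -> 0 <= A ->
  exists c0 C0 K0 : R, [/\ 0 < c0 <= 1, c0 <= C0 &
  forall (W D : R) (b : nat -> R) m, 0 < W -> 0 < D -> K0 <= D * W -> r%:R <= W ->
    0 < b j0 -> W <= m.+1%:R <= 4 * W ->
    (forall j, (j0 < j <= J)%N -> `|b j| <= A * b j0 / D ^+ (j - j0)) ->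
    c0 * (b j0 / W ^+ (r + j0)) <=
      iter r bd (fun i => \sum_(j0 <= j < J.+1) b j * pinv j i) m
      <= C0 * (b j0 / W ^+ (r + j0))].
Proof.
move=> /andP[j00 jJ] A0.
have hc j : exists k : R, 0 <= k /\
    forall m, iter r bd (pinv j) m <= k * pinv (r + j) m.
  by have [k k0 kP] := iter_bd_pinv_le j r; exists k.
have [K hK] := boolp.choice hc.
pose SK := \sum_(j0.+1 <= j < J.+1) K j.
have SK0 : 0 <= SK by apply: sumr_ge0 => j _; case: (hK j).
have p5 : 1 <= 5 ^+ (r + j0) :> R by rewrite exprn_ege1 // ler1n.
(* [5], because [iter_bd_pinv_ge] evaluates at [m + r], where
   [m.+1 + r <= 4 * W + W]. *)
set c0 : R := (5 ^+ (r + j0))^-1 / 2.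
have c00 : 0 < c0 by rewrite divr_gt0 // invr_gt0; lra.
have c01 : c0 <= 1 / 2 by rewrite ler_pM2r ?invr_gt0 // invf_le1 //; lra.
exists c0, (K j0 + 1), (1 + A * SK / c0).
have ASK : 0 <= A * SK / c0 by apply: divr_ge0; [exact: mulr_ge0|exact: ltW].
split.
- by apply/andP; split=> //; lra.
- by have [k0 _] := hK j0; lra.
move=> W D b m W0 D0 DW rW b0 /andP[mW mW4] hb.
have DW1 : 1 <= D * W by lra.
have Wp k : 0 < W ^+ k by exact: exprn_gt0.
have Dp k : 0 < D ^+ k by exact: exprn_gt0.
set X := b j0 / W ^+ (r + j0).
have X0 : 0 < X by exact: divr_gt0.
have pinvW k : pinv k m <= (W ^+ k)^-1.
  by rewrite /pinv lef_pV2 ?posrE ?exprn_gt0 // lerXn2r ?nnegrE // ltW.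
rewrite (iter_bd_sum (index_iota j0 J.+1) b pinv) big_ltn //.
set T := \sum_(_ <= _ < _) _.
have hT : `|T| <= c0 * X.
  apply: (le_trans (ler_norm_sum _ _ _)).
  apply: (@le_trans _ _ (\sum_(j0.+1 <= j < J.+1) A * X / (D * W) * K j)).
    rewrite !big_seq; apply: ler_sum => j; rewrite mem_index_iota => hj.
    have [K0 hKj] := hK j.
    rewrite normrM [`|iter _ _ _ _|]ger0_norm ?iter_bd_pinv_ge0 //.
    have hj' : (j0 < j <= J)%N by nlia.
    apply: (@le_trans _ _ ((A * b j0 / D ^+ (j - j0)) * (K j * (W ^+ (r + j))^-1))).
      apply: ler_pM => //; [exact: iter_bd_pinv_ge0|exact: hb|].
      by apply: (le_trans (hKj _)); apply: lemul2l.
    have -> : A * b j0 / D ^+ (j - j0) * (K j * (W ^+ (r + j))^-1) =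
        A * X * K j * ((D * W) ^+ (j - j0))^-1.
      have -> : (r + j = (r + j0) + (j - j0))%N by nlia.
      rewrite /X exprD exprMn; field; rewrite !gt_eqF //.
    have -> : A * X / (D * W) * K j = A * X * K j * (D * W)^-1 by ring.
    apply: lemul2l; first by apply: mulr_ge0 => //; apply: mulr_ge0 => //; exact: ltW.
    rewrite lef_pV2 ?posrE ?exprn_gt0 ?mulr_gt0 //.
    by rewrite -[leLHS]expr1 ler_weXn2l //; nlia.
  rewrite -big_distrr /= -/SK.
  have -> : A * X / (D * W) * SK = (A * SK / (D * W)) * X by ring.
  apply: lemul2r; first exact: ltW.
  rewrite ler_pdivrMr ?mulr_gt0 // -ler_pdivrMl // mulrC; lra.
have up : b j0 * iter r bd (pinv j0) m <= K j0 * X.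
  have [K0 hKj] := hK j0.
  have -> : K j0 * X = b j0 * (K j0 * (W ^+ (r + j0))^-1) by rewrite /X; ring.
  apply: lemul2l; first exact: ltW.
  by apply: (le_trans (hKj _)); apply: lemul2l.
have lo : 2 * c0 * X <= b j0 * iter r bd (pinv j0) m.
  have -> : 2 * c0 * X = b j0 * ((5 * W) ^+ (r + j0))^-1.
    by rewrite /c0 /X exprMn; field; rewrite !gt_eqF //; lra.
  apply: lemul2l; first exact: ltW.
  case: j0 j00 => // j _ in jJ SK SK0 p5 c0 c00 c01 ASK DW b0 hb X X0 T hT up *.
  apply: le_trans (iter_bd_pinv_ge j r m); rewrite /pinv.
  have w5 : 0 < 5 * W by exact: mulr_gt0.
  rewrite lef_pV2 ?posrE ?exprn_gt0 // lerXn2r ?nnegrE //; first exact: ltW.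
  by rewrite -addSn natrD; lra.
move: hT; rewrite ler_norml => /andP[T1 T2].
have hX : c0 * X <= 1 * X by apply: lemul2r; lra.
by apply/andP; split; lra.
Qed.

Definition phase j0 J (b : nat -> R) (m : nat) : R :=
  \sum_(j0 <= j < J.+1) b j / m%:R ^+ j.

Lemma phaseN j0 J b m : phase j0 J (fun j => - b j) m = - phase j0 J b m.
Proof. by rewrite /phase -sumrN; apply: eq_bigr => j _; rewrite mulNr. Qed.

Lemma cabs_sum_eN s t (g : nat -> R) :
  cabs (\sum_(s <= m < t) e (- g m)) = cabs (\sum_(s <= m < t) e (g m)).
Proof.
by rewrite -[RHS]cabs_conj rmorph_sum; under eq_bigr => m _ do rewrite eN.
Qed.

(** The estimate of one order [k + 2] for the sums of [e (phase j0 J b m)]; the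
    last two conditions say that the size [Y] of the phase satisfies
    [H ^ B * W ^ k <= Y] and [Y * H ^ B <= W ^ (k + 2)]. *)
Definition order_bound j0 J (A : R) k (K : R) B :=
  forall H (W D : R) (b : nat -> R) s t, K <= H%:R -> K <= D * W -> K <= W ->
    0 < D -> (forall m, (s <= m < t)%N -> W <= m%:R <= 4 * W) ->
    (forall j, (j0 < j <= J)%N -> `|b j| <= A * `|b j0| / D ^+ (j - j0)) ->
    H%:R ^+ B * W ^+ (k + j0) <= `|b j0| ->
    `|b j0| * H%:R ^+ B <= W ^+ (k.+2 + j0) ->
    cabs (\sum_(s <= m < t) e (phase j0 J b m)) <= K * W / H%:R.

Lemma order_bound_weaken j0 J A k K B K' B' : 1 <= K -> K <= K' -> (B <= B')%N ->
  order_bound j0 J A k K B -> order_bound j0 J A k K' B'.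
Proof.
move=> K1 KK BB h H W D b s t h1 h2 h3 h4 h5 h6 h7 h8.
have H1 : 1 <= H%:R :> R by lra.
have HB : H%:R ^+ B <= H%:R ^+ B' :> R by rewrite ler_weXn2l.
apply: (@le_trans _ _ (K * W / H%:R)).
  apply: (h H W D b s t) => //; [lra|lra|lra| |].
    by apply: le_trans h7; apply: lemul2r => //; apply: exprn_ge0; lra.
  by apply: le_trans h8; apply: lemul2l.
apply: lemul2r; first by rewrite invr_ge0.
by apply: lemul2r => //; lra.
Qed.

(** By [iter_bd_phase] the van der Corput test of order [k + 2] applies, with
    [l] a multiple of [b j0 / W ^ (k + 2 + j0)]. *)
Lemma order_bound_exists j0 J A k : (0 < j0 <= J)%N -> 0 <= A ->
  exists K B, 1 <= K /\ order_bound j0 J A k K B.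
Proof.
move=> hj A0; have [c0 [C0 [K0 [/andP[c00 c01] cC hph]]]] := @iter_bd_phase j0 J A k.+2 hj A0.
have CC : 1 <= C0 / c0 by rewrite ler_pdivlMr // mul1r.
have [B1 B10 hV] := van_der_corput_test CC.
pose K := 1 + `|K0| + k.+2%:R + 5 * B1 + c0^-1.
have ic : 0 < c0^-1 by rewrite invr_gt0.
have nK0 := normr_ge0 K0; have K0n := ler_norm K0.
have k2 : 0 <= k.+2%:R :> R by [].
have K1 : 1 <= K by rewrite /K; lra.
exists K, (vdc_a k + (vdc_b k).+1)%N; split => //.
have K0' : 0 < K := lt_le_trans ltr01 K1.
have KK0 : K0 <= K by rewrite /K; lra.
have Kk : k.+2%:R <= K by rewrite /K; lra.
have KB : 5 * B1 <= K by rewrite /K; lra.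
have Kc : c0^-1 <= K by rewrite /K; lra.
clearbody K.
(* Conjugating the sum changes the sign of the phase. *)
suff main H (W D : R) (b : nat -> R) s t : K <= H%:R -> K <= D * W -> K <= W ->
    0 < D -> (forall m, (s <= m < t)%N -> W <= m%:R <= 4 * W) ->
    (forall j, (j0 < j <= J)%N -> `|b j| <= A * `|b j0| / D ^+ (j - j0)) ->
    H%:R ^+ (vdc_a k + (vdc_b k).+1) * W ^+ (k + j0) <= `|b j0| ->
    `|b j0| * H%:R ^+ (vdc_a k + (vdc_b k).+1) <= W ^+ (k.+2 + j0) ->
    0 < b j0 ->
    cabs (\sum_(s <= m < t) e (phase j0 J b m)) <= K * W / H%:R.
  move=> H W D b s t h1 h2 h3 h4 h5 h6 h7 h8.
  have [b0|b0|b0] := ltgtP (b j0) 0; last 2 first.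
  - exact: (main H W D).
  - exfalso; move: h7; rewrite b0 normr0 leNgt => /negP; apply.
    by apply: mulr_gt0; apply: exprn_gt0; [exact: lt_le_trans K0' h1|exact: lt_le_trans K0' h3].
  rewrite -cabs_sum_eN; under eq_bigr => m _ do rewrite -phaseN.
  apply: (main H W D) => //; try by rewrite normrN.
    by move=> j hj'; rewrite !normrN; apply: h6.
  by rewrite oppr_gt0.
move=> h1 h2 h3 h4 h5 h6 h7 h8 b0.
have H1 : 1 <= H%:R :> R := le_trans K1 h1.
have H0 : 0 < H%:R :> R := lt_le_trans ltr01 H1.
have W1 : 1 <= W := le_trans K1 h3.
have W0 : 0 < W := lt_le_trans ltr01 W1.
have K0W := mulr_ge0 (ltW K0') (ltW W0).
case: (leqP t s) => ts.
  by rewrite big_geq // cabs0 divr_ge0.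
have s0 : (0 < s)%N.
  have /h5 : (s <= s < t)%N by nlia.
  by rewrite -(@ltr0n R) => /andP[/(lt_le_trans W0)].
move: h7 h8; rewrite gtr0_norm // => h7 h8.
have [N [N1 N2 N3]] : exists N, [/\ W <= N%:R, N%:R <= 5 * W & (t - s <= N)%N].
  have w4 : 0 <= 4 * W by lra.
  have := truncn_itv w4; set q := Num.trunc _ => /andP[q1 q2].
  exists q.+1; rewrite -natr1; rewrite -natr1 in q2; split; [lra|lra|].
  have /h5 : (s <= t.-1 < t)%N by nlia.
  case: t ts h5 => // t ts h5 /= /andP[_ h9].
  have : (t <= q)%N by rewrite truncn_ge_nat.
  by clear; nlia.
(* The sign makes the differences of order [k + 2] positive: [fd] is the
   opposite of [bd]. *)
pose u i := (-1) ^+ k * phase j0 J b (i + s)%N.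
have -> : cabs (\sum_(s <= m < t) e (phase j0 J b m)) =
    cabs (\sum_(0 <= i < t - s) e (u i)).
  rewrite -[in LHS](add0n s) big_addn /u -signr_odd; case: (odd k).
    rewrite -cabs_sum_eN; congr cabs; apply: eq_bigr => i _.
    by rewrite /= expr1 mulN1r opprK.
  by congr cabs; apply: eq_bigr => i _; rewrite /= expr0 mul1r.
have uE i : iter k.+2 fd u i =
    iter k.+2 bd (fun i => \sum_(j0 <= j < J.+1) b j * pinv j i) (i + s.-1)%N.
  have uS r : iter r fd u i =
    (-1) ^+ (k + r) * iter r bd (fun i => \sum_(j0 <= j < J.+1) b j * pinv j i) (i + s.-1)%N.
    elim: r i => [|r IH] i.
      rewrite addn0 /= /u /phase; congr (_ * _); apply: eq_bigr => j _.
      by rewrite /pinv -addnS prednK.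
    rewrite iter_fdS !IH iter_bdS addnS exprS -addSn; ring.
  rewrite uS; have -> : (k + k.+2 = 2 * k.+1)%N by nlia.
  by rewrite exprM sqrrN !expr1n mul1r.
have Hp m : 0 < H%:R ^+ m :> R by exact: exprn_gt0.
have Wp m : 0 < W ^+ m by exact: exprn_gt0.
set l : R := c0 * (b j0 / W ^+ (k.+2 + j0)).
have l0 : 0 < l by apply: mulr_gt0 => //; exact: divr_gt0.
have bound : cabs (\sum_(0 <= i < t - s) e (u i)) <= B1 * N%:R / H%:R.
  apply: (hV k H l) => //.
  - by rewrite -(@ltr0n R).
  - have l1 : l <= b j0 / W ^+ (k.+2 + j0).
      by rewrite /l -[leRHS]mul1r; apply: lemul2r => //; apply/ltW/divr_gt0.
    apply: (@le_trans _ _ (b j0 / W ^+ (k.+2 + j0) * H%:R ^+ (vdc_a k + (vdc_b k).+1))).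
      apply: ler_pM => //; [exact: ltW|].
      by rewrite ler_weXn2l //; nlia.
    by rewrite mulrAC ler_pdivrMr // mul1r.
  - apply: (@le_trans _ _ (l * W ^+ 2)); last first.
      apply: lemul2l; first exact: ltW.
      by apply: lerXn2r; rewrite ?nnegrE // (le_trans (ltW W0)).
    have -> : l * W ^+ 2 = c0 * (b j0 / W ^+ (k + j0)).
      rewrite /l; have -> : (k.+2 + j0 = (k + j0) + 2)%N by nlia.
      by rewrite exprD; field; rewrite !gt_eqF.
    have h9 : H%:R ^+ (vdc_a k + (vdc_b k).+1) <= b j0 / W ^+ (k + j0).
      by rewrite ler_pdivlMr.
    apply: (@le_trans _ _ (c0 * H%:R ^+ (vdc_a k + (vdc_b k).+1))); last first.
      by apply: lemul2l => //; exact: ltW.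
    rewrite -ler_pdivrMl // mulrC.
    apply: (@le_trans _ _ (H%:R ^+ (vdc_b k) * H%:R)).
      by apply: lemul2l; [exact/ltW/Hp|exact: le_trans h1].
    by rewrite -exprSr ler_weXn2l //; nlia.
  move=> i hi; rewrite uE.
  have hm : (s <= (i + s.-1).+1 < t)%N by nlia.
  have -> : C0 / c0 * l = C0 * (b j0 / W ^+ (k.+2 + j0)).
    by rewrite /l; field; rewrite !gt_eqF.
  have a1 : K0 <= D * W by exact: le_trans h2.
  have a2 : k.+2%:R <= W by exact: le_trans h3.
  have a3 := h5 _ hm.
  apply: (hph W D) => // j hj'; have := h6 j hj'.
  by rewrite [`|b j0|]gtr0_norm.
apply: (le_trans bound); apply: lemul2r; first by rewrite invr_ge0.
apply: (@le_trans _ _ (B1 * (5 * W))); first exact: lemul2l.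
rewrite mulrA [B1 * 5]mulrC; apply: lemul2r KB; exact: ltW.
Qed.

(** A phase whose size lies between a small power of [H] and a power of [W]
    falls under one of the finitely many orders, because consecutive orders
    overlap. *)
Lemma phase_sum_bound j0 J A E : (0 < j0 <= J)%N -> 0 <= A ->
  exists K B, 1 <= K /\
  forall H (W D : R) (b : nat -> R) s t, K <= H%:R -> H%:R ^+ B <= W ->
    K <= D * W -> 0 < D -> (forall m, (s <= m < t)%N -> W <= m%:R <= 4 * W) ->
    (forall j, (j0 < j <= J)%N -> `|b j| <= A * `|b j0| / D ^+ (j - j0)) ->
    H%:R ^+ B * W ^+ j0 <= `|b j0| -> `|b j0| <= W ^+ E ->
    cabs (\sum_(s <= m < t) e (phase j0 J b m)) <= K * W / H%:R.
Proof.
move=> hj A0.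
have [K [B [K1 hKB]]] : exists K B, 1 <= K /\
    forall k, (k <= E)%N -> order_bound j0 J A k K B.
  elim: E => [|E [K [B [K1 IH]]]].
    have [K [B [K1 h]]] := order_bound_exists 0 hj A0.
    by exists K, B; split => // k; rewrite leqn0 => /eqP ->.
  have [K' [B' [K'1 h]]] := order_bound_exists E.+1 hj A0.
  exists (K + K'), (B + B')%N; split; first by lra.
  move=> k; rewrite leq_eqVlt => /orP[/eqP ->|kE].
    by apply: (order_bound_weaken _ _ _ h); [lra|lra|nlia].
  by apply: (order_bound_weaken _ _ _ (IH k _)) => //; [lra|nlia].
(* Two factors [H ^ B] make consecutive orders overlap; one more factor [H]
   gives [K <= W]. *)
exists K, (B + B).+1; split => // H W D b s t h1 h2 h3 h4 h5 h6 h7 h8.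
have H1 : 1 <= H%:R :> R by lra.
have Hp m : 1 <= H%:R ^+ m :> R by exact: exprn_ege1.
have HBB : H%:R ^+ B * H%:R ^+ B * H%:R <= W by move: h2; rewrite exprSr exprD.
have W0 : 0 < W.
  apply: lt_le_trans HBB; rewrite !mulr_gt0 //; try lra.
    by have := Hp B; lra.
  by have := Hp B; lra.
have HW : H%:R <= W.
  apply: le_trans h2; rewrite -[leLHS]expr1; exact: ler_weXn2l.
have W1 : 1 <= W by lra.
have Wp m : 1 <= W ^+ m by exact: exprn_ege1.
have HBW : H%:R ^+ B * H%:R ^+ B <= W.
  by apply: le_trans HBB; rewrite -[leLHS]mulr1; apply: lemul2l => //; rewrite mulr_ge0 // exprn_ge0.
have HB1 : H%:R ^+ B <= W.
  by apply: le_trans HBW; rewrite -[leLHS]mulr1; apply: lemul2l => //; rewrite exprn_ge0.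
suff main k : (k <= E)%N -> `|b j0| * H%:R ^+ B <= W ^+ (k.+2 + j0) ->
    cabs (\sum_(s <= m < t) e (phase j0 J b m)) <= K * W / H%:R.
  apply: (main E) => //.
  apply: (@le_trans _ _ (W ^+ E * W)).
    by apply: ler_pM => //; rewrite exprn_ge0.
  by rewrite -exprSr ler_weXn2l //; nlia.
elim: k => [|k IH] kE hk.
  apply: (hKB 0%N _ H W D) => //; first by lra.
  rewrite add0n; apply: le_trans h7; apply: lemul2r; first by rewrite exprn_ge0 //; lra.
  by rewrite ler_weXn2l //; nlia.
have [h|h] := leP (`|b j0| * H%:R ^+ B) (W ^+ (k.+2 + j0)).
  by apply: IH => //; nlia.
apply: (hKB k.+1 _ H W D) => //; first by lra.
have HB0 : 0 < H%:R ^+ B :> R by have := Hp B; lra.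
have : H%:R ^+ B * W ^+ (k.+1 + j0) * H%:R ^+ B <= `|b j0| * H%:R ^+ B.
  apply: le_trans (ltW h).
  have -> : W ^+ (k.+2 + j0) = W * W ^+ (k.+1 + j0) by rewrite -exprS.
  have -> : H%:R ^+ B * W ^+ (k.+1 + j0) * H%:R ^+ B =
    (H%:R ^+ B * H%:R ^+ B) * W ^+ (k.+1 + j0) by ring.
  by apply: lemul2r HBW; apply: exprn_ge0; exact: ltW.
move=> hh; apply: le_trans (_ : `|b j0| * H%:R ^+ B / H%:R ^+ B <= _); last by rewrite mulfK ?gt_eqF.
by rewrite ler_pdivlMr //.
Qed.

End NegativePowers.

Arguments bd {R}.

(** * The von Mangoldt and Moebius functions *)

Section Arithmetic.
Variable R : realType.

Lemma sum_eq_ind (V : pzSemiRingType) (f : nat -> V) x N :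
  \sum_(0 <= n < N.+1) (x == n)%:R * f n = (x <= N)%:R * f x.
Proof.
rewrite (eq_bigr (fun n => if n == x then f n else 0)) => [|n _]; last first.
  by rewrite eq_sym; case: eqP; rewrite ?mul1r ?mul0r.
by rewrite -big_mkcond big_nat1_eq /= ltnS; case: leqP; rewrite ?mul1r ?mul0r.
Qed.

Lemma lnX (x : R) n : 0 < x -> ln (x ^+ n) = n%:R * ln x.
Proof. by move=> x0; rewrite lnXn // mulr_natl. Qed.

Lemma ln_nat_ge0 n : 0 <= ln (n%:R : R).
Proof.
case: n => [|n]; first by rewrite ln0.
by apply: ln_ge0; rewrite ler1n.
Qed.

Lemma ln_nat_le m n : (m <= n)%N -> (0 < m)%N -> ln (m%:R : R) <= ln n%:R.
Proof.
by move=> mn m0; rewrite ler_ln ?posrE ?ltr0n ?ler_nat //; apply: leq_trans mn.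
Qed.

Lemma ln_prime_factors n N : (0 < n <= N)%N ->
  ln (n%:R : R) = \sum_(0 <= p < N.+1) (prime p)%:R * ((logn p n)%:R * ln p%:R).
Proof.
move=> /andP[n0 nN]; rewrite (@big_cat_nat _ _ _ n.+1) //=.
rewrite [X in _ + X]big_nat_cond [X in _ + X]big1 ?addr0 => [|p hp]; last first.
  by rewrite ltn_log0 ?mul0r ?mulr0 //; nlia.
rewrite -{1}(partnT n0) /partn natr_prod.
have -> : \prod_(0 <= p < n.+1 | p \in predT) (p ^ logn p n)%N%:R =
   \prod_(0 <= p < n.+1) (p ^ logn p n)%N%:R :> R by [].
have pos p : 0 < (p ^ logn p n)%N%:R :> R.
  rewrite ltr0n expn_gt0; case: p => // ; by rewrite lognE.
elim: n.+1 => [|m IH]; first by rewrite !big_geq // ln1.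
rewrite !big_nat_recr //= lnM ?posrE //; last by apply: prodr_gt0 => p _.
rewrite IH; congr (_ + _); case: (boolP (prime m)) => pm.
  by rewrite mul1r natrX lnX // ltr0n prime_gt0.
by rewrite mul0r lognE (negbTE pm) /= ln1.
Qed.

(** The von Mangoldt function. *)
Definition vonM m : R := \sum_(0 <= p < m.+1) \sum_(1 <= k < m.+1)
  (prime p && (p ^ k == m)%N)%:R * ln p%:R.

Lemma vonM_ge0 m : 0 <= vonM m.
Proof.
by apply: sumr_ge0 => p _; apply: sumr_ge0 => k _; rewrite mulr_ge0 ?ln_nat_ge0.
Qed.

Lemma vonM_widen m N : (m <= N)%N -> vonM m =
  \sum_(0 <= p < N.+1) \sum_(1 <= k < N.+1)
    (prime p && (p ^ k == m)%N)%:R * ln p%:R.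
Proof.
move=> mN; rewrite [RHS](@big_cat_nat _ _ _ m.+1) //=.
rewrite [X in _ + X]big_nat_cond [X in _ + X]big1 ?addr0 => [|p hp]; last first.
  rewrite big_nat_cond big1 // => k hk; case: eqP => [E|_]; last by rewrite andbF mul0r.
  have : (p ^ 1 <= p ^ k)%N by rewrite leq_pexp2l; nlia.
  by rewrite expn1 E; nlia.
apply: eq_bigr => p _; rewrite [RHS](@big_cat_nat _ _ _ m.+1) //=.
rewrite [X in _ + X]big_nat_cond [X in _ + X]big1 ?addr0 // => k hk.
case: (boolP (prime p)) => [pp|_]; last by rewrite mul0r.
case: eqP => [E|_]; last by rewrite mul0r.
by have := ltn_expl k (prime_gt1 pp); rewrite E; nlia.
Qed.

(** Both sides count [ln p] once for each power of the prime [p] that divides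
    [n]. *)
Lemma sum_vonM_divisors n N : (0 < n <= N)%N ->
  \sum_(0 <= d < N.+1) (d %| n)%N%:R * vonM d = ln n%:R.
Proof.
move=> /andP[n0 nN]; rewrite (@ln_prime_factors n N) ?n0 //.
rewrite (@eq_big_nat _ _ _ _ _ _ (fun d => \sum_(0 <= p < N.+1)
   \sum_(1 <= k < N.+1) (p ^ k == d)%N%:R * ((d %| n)%N%:R * ((prime p)%:R * ln p%:R)))); last first.
  move=> d hd; rewrite (@vonM_widen d N) ?big_distrr /=; last by nlia.
  apply: eq_bigr => p _; rewrite big_distrr; apply: eq_bigr => k _ /=.
  by case: (prime p); case: (p ^ k == d)%N; rewrite /= !(mul0r, mul1r, mulr0).
rewrite exchange_big /=; apply: eq_bigr => p _; rewrite exchange_big /=.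
under eq_bigr => k _ do rewrite (@sum_eq_ind R (fun d => (d %| n)%N%:R * ((prime p)%:R * ln p%:R))).
case: (boolP (prime p)) => pp; last first.
  by rewrite big1 => [|k _]; rewrite mul0r ?mulr0.
rewrite (eq_bigr (fun k => (k <= logn p n)%N%:R * ln p%:R)) => [|k _]; last first.
  rewrite pfactor_dvdn // !mul1r; case: (leqP k (logn p n)) => kl; last by rewrite !mul0r mulr0.
  have h : (p ^ k %| n)%N by rewrite pfactor_dvdn.
  by rewrite (leq_trans (dvdn_leq n0 h) nN) !mul1r.
rewrite -big_distrl /= mul1r; congr (_ * _).
have lN : (logn p n < N.+1)%N by have := ltn_logl p n0; nlia.
rewrite (@big_cat_nat _ _ _ (logn p n).+1) //=.
rewrite (@eq_big_nat _ _ _ _ _ _ (fun=> 1)) => [|k hk]; last first.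
  by rewrite (_ : (k <= logn p n)%N = true) //; nlia.
rewrite sumr_const_nat subn1 /= [X in _ + X]big_nat_cond big1 ?addr0 // => k hk.
by rewrite leqNgt (_ : (logn p n < k)%N) //; nlia.
Qed.

Definition mu_local k : R := if k == 0%N then 1 else if k == 1%N then -1 else 0.

(** The Moebius function, as a product over all primes so that its value at a
    prime multiple can be read off one factor. *)
Definition mu n : R := \prod_(0 <= p < n.+1 | prime p) mu_local (logn p n).

Lemma mu_widen n N : (n <= N)%N -> mu n =
  \prod_(0 <= p < N.+1 | prime p) mu_local (logn p n).
Proof.
move=> nN; rewrite [RHS](@big_cat_nat _ _ _ n.+1) //=.
rewrite [X in _ * X]big_nat_cond [X in _ * X]big1 ?mulr1 // => p hp.
by rewrite ltn_log0 //; nlia.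
Qed.

Lemma mu_le1 n : `|mu n| <= 1.
Proof.
rewrite normr_prod.
have /andP[] : 0 <= \prod_(0 <= p < n.+1 | prime p) `|mu_local (logn p n)| <= 1 => //.
elim/big_ind: _ => [|x y /andP[x0 x1] /andP[y0 y1]|p _]; first by rewrite ler01 lexx.
  by rewrite mulr_ge0 // mulr_ile1.
rewrite normr_ge0 /mu_local /=.
by case: (logn p n) => [|[|k]] /=; rewrite ?normrN ?normr1 ?normr0 ?ler01.
Qed.

Lemma mu_split p n N : prime p -> (n <= N)%N -> (p <= N)%N ->
  mu n = mu_local (logn p n) *
    \prod_(0 <= q < N.+1 | prime q && (q != p)) mu_local (logn q n).
Proof.
move=> pp nN pN; rewrite (@mu_widen n N) // (bigID (pred1 p)) /=; congr (_ * _).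
rewrite (eq_bigl (pred1 p)) => [|q /=]; last by case: eqP => [->|]; rewrite ?pp ?andbF.
by rewrite big_nat1_eq ifT //; nlia.
Qed.

Lemma mu_mul_prime p d : prime p -> (0 < d)%N -> ~~ (p %| d)%N -> mu (p * d)%N = - mu d.
Proof.
move=> pp d0 pd; have p0 := prime_gt0 pp.
have ld : logn p d = 0%N by rewrite lognE (negbTE pd) !andbF.
rewrite (@mu_split p (p * d)%N (p * d)%N pp) ?leq_pmulr // (@mu_split p d (p * d)%N pp) ?leq_pmulr ?leq_pmull //.
rewrite lognM // logn_prime // eqxx ld addn0 /= mulN1r mul1r; congr (- _).
apply: eq_bigr => q /andP[pq qp]; rewrite lognM // logn_prime // (negbTE qp) //.
Qed.

Lemma mu_square p d : prime p -> (0 < d)%N -> (p ^ 2 %| d)%N -> mu d = 0.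
Proof.
move=> pp d0; rewrite pfactor_dvdn // => h.
have pd : (p <= d)%N.
  by apply: dvdn_leq => //; rewrite -[p]expn1 pfactor_dvdn // ltnW.
rewrite (@mu_split p d d pp) // /mu_local.
by case: (logn p d) h => [|[|k]] //= _; rewrite mul0r.
Qed.

(** With [p] a prime factor of [n], a divisor [d] prime to [p] cancels against
    [p * d], and [mu] vanishes at the divisors that are multiples of [p ^ 2]. *)
Lemma sum_mu_divisors n N : (0 < n <= N)%N ->
  \sum_(0 <= d < N.+1) (d %| n)%N%:R * mu d = (n == 1)%N%:R.
Proof.
move=> /andP[n0 nN]; have [n1|n1] := eqVneq n 1%N.
  rewrite n1 in n0 nN *.
  rewrite (eq_bigr (fun d => (1 == d)%N%:R * mu d)) => [|d _]; last first.
    by rewrite dvdn1 eq_sym.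
  rewrite sum_eq_ind (leq_trans n0 nN) mul1r /mu big1 // => p _.
  by rewrite logn1.
have pp : prime (pdiv n) by apply: pdiv_prime; nlia.
move: (pdiv n) (pdiv_dvd n) pp => p pn pp.
have E1 : \sum_(0 <= d < N.+1) (d %| n)%N%:R * mu d =
    \sum_(0 <= d < N.+1) (~~ (p %| d)%N)%:R * ((d %| n)%N%:R * mu d) +
    \sum_(0 <= d < N.+1) (p %| d)%N%:R * ((d %| n)%N%:R * mu d).
  rewrite -big_split /=; apply: eq_bigr => d _.
  by case: (p %| d)%N; rewrite /= ?mul0r ?mul1r ?add0r ?addr0.
have E2 : \sum_(0 <= d < N.+1) (p %| d)%N%:R * ((d %| n)%N%:R * mu d) =
   \sum_(0 <= c < N.+1) (p * c <= N)%N%:R * ((p * c %| n)%N%:R * mu (p * c)%N).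
  under [in RHS]eq_bigr => c _.
    rewrite -(@sum_eq_ind R (fun d => (d %| n)%N%:R * mu d) (p * c)%N N). over.
  rewrite exchange_big /=; apply: eq_big_nat => d hd.
  case: (boolP (p %| d)%N) => [/dvdnP[c dE]|h].
    subst d.
    rewrite -big_distrl /=; congr (_ * _).
    rewrite (@eq_big_nat _ _ _ _ _ _ (fun i => (c == i)%:R * 1)) => [|i _]; last first.
      by rewrite mulnC eqn_pmul2r ?prime_gt0 // eq_sym mulr1.
    rewrite sum_eq_ind mulr1 (_ : (c <= N)%N = true) //.
    have : (c * 1 <= c * p)%N by rewrite leq_mul2l prime_gt0 // orbT.
    by nlia.
  rewrite big1 ?mul0r // => i _; case: eqP => [E|]; rewrite ?mul0r //.
  by move: h; rewrite -E dvdn_mulr.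
rewrite E1 E2 -big_split /= big1 // => d _.
case: (posnP d) => [->|d0].
  by rewrite dvd0n (gtn_eqF n0) muln0 dvd0n (gtn_eqF n0) !(mul0r, mulr0) addr0.
case: (boolP (p %| d)%N) => pd; rewrite /= !(mul0r, mul1r, add0r).
  have pd2 : (p ^ 2 %| p * d)%N by rewrite expnS expn1 dvdn_pmul2l ?prime_gt0.
  by rewrite (mu_square pp _ pd2) ?muln_gt0 ?d0 ?prime_gt0 // !mulr0.
rewrite mu_mul_prime // Gauss_dvd ?prime_coprime // pn /=.
case: (boolP (d %| n)%N) => dn; last by rewrite !(mul0r, mulr0) addr0.
rewrite (_ : (p * d <= N)%N = true); first by rewrite !mul1r subrr.
apply: (leq_trans _ nN); apply: dvdn_leq => //.
by rewrite Gauss_dvd ?prime_coprime // pn.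
Qed.

End Arithmetic.

(** * Chebyshev and Mertens estimates *)

Section Primes.
Variable R : realType.

Lemma ln_succ_le n : (0 < n)%N -> ln (n.+1%:R : R) - ln n%:R <= n%:R^-1.
Proof.
move=> n0; rewrite -ln_div ?posrE ?ltr0n //.
have -> : n.+1%:R / n%:R = 1 + n%:R^-1 :> R.
  by rewrite -natr1 mulrDl divff ?mul1r // pnatr_eq0 -lt0n.
by apply: le_ln1Dx; apply: (lt_le_trans (ltrN10 R)); rewrite invr_ge0.
Qed.

Lemma ln_succ_ge n : (0 < n)%N -> n.+1%:R^-1 <= ln (n.+1%:R : R) - ln n%:R.
Proof.
move=> n0; rewrite -lerN2 opprB -ln_div ?posrE ?ltr0n //.
have np : 0 < n%:R :> R by rewrite ltr0n.
have -> : n%:R / n.+1%:R = 1 + - n.+1%:R^-1 :> R.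
  by rewrite -natr1; field; rewrite natr1 pnatr_eq0.
apply: le_ln1Dx; rewrite ltrN2 invf_lt1 ?ltr0n // ltr1n //.
Qed.

Lemma harmonic_le N : (0 < N)%N ->
  \sum_(1 <= d < N.+1) d%:R^-1 <= 1 + ln (N%:R : R).
Proof.
elim: N => // -[|N] IH _; first by rewrite big_nat1 invr1 ln1 addr0.
have h1 := IH isT; have h2 := @ln_succ_ge N.+1 isT.
rewrite big_nat_recr //=; apply: (le_trans (lerD h1 h2)).
by rewrite -addrA lerD2l addrCA subrr addr0.
Qed.

Lemma ln_fact_le n : ln ((n`!)%:R : R) <= n%:R * ln n%:R.
Proof.
elim: n => [|n IH]; first by rewrite fact0 ln1 mul0r.
rewrite factS natrM lnM ?posrE ?ltr0n ?fact_gt0 // -[X in X * _]natr1 mulrDl mul1r addrC.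
rewrite lerD2r; apply: (le_trans IH).
case: n {IH} => [|n]; first by rewrite !mul0r.
by apply: lemul2l => //; apply: ln_nat_le.
Qed.

Lemma ln_fact_ge n : (0 < n)%N -> n%:R * ln n%:R - n%:R <= ln ((n`!)%:R : R).
Proof.
elim: n => // -[|n] IH _.
  by rewrite factS fact0 muln1 ln1; lra.
rewrite factS natrM lnM ?posrE ?ltr0n ?fact_gt0 //.
have h := @ln_succ_le n.+1 isT; have {}IH := IH isT.
have np : 0 < n.+1%:R :> R by rewrite ltr0n.
have h2 : n.+1%:R * (ln n.+2%:R - ln n.+1%:R) <= 1 :> R.
  by rewrite mulrC -ler_pdivlMr // div1r.
have e2 : n.+1%:R + 1 = n.+2%:R :> R by rewrite natr1.
have e3 : n.+2%:R * ln n.+2%:R = n.+1%:R * ln n.+2%:R + ln n.+2%:R :> R.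
  by rewrite -[X in X * _ = _]natr1 mulrDl mul1r.
lra.
Qed.

Definition theta n : R := \sum_(0 <= p < n.+1) (prime p)%:R * ln p%:R.

Lemma bin_le_exp2 n m : ('C(n, m) <= 2 ^ n)%N.
Proof.
case: (leqP m n) => h; last by rewrite bin_small.
have -> : (2 ^ n)%N = \sum_(i < n.+1) 'C(n, i).
  by rewrite -[2%N]/(1 + 1)%N Pascal; apply: eq_bigr => i _; rewrite !exp1n !muln1.
by rewrite (bigD1 (inord m)) //= inordK // leq_addr.
Qed.

Lemma ln2_le1 : ln 2 <= 1 :> R.
Proof. by have := @le_ln1Dx R 1; rewrite (_ : 1 + 1 = 2) //; apply; lra. Qed.

(** The primes between [N] and [2 * N] divide the central binomial
    coefficient, which is at most [2 ^ (2 * N)]. *)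
Lemma theta_double N : theta (2 * N) <= theta N + 2 * N%:R.
Proof.
case: (posnP N) => [->|N0]; first by rewrite muln0 mulr0 addr0.
pose B := 'C(2 * N, N).
have B0 : (0 < B)%N by rewrite bin_gt0; nlia.
have lB : ln (B%:R : R) <= 2 * N%:R.
  apply: (@le_trans _ _ (ln (2 ^ (2 * N))%N%:R)).
    by apply: ln_nat_le => //; exact: bin_le_exp2.
  rewrite natrX lnX // natrM -[leRHS]mulr1; apply: lemul2l => //.
  exact: ln2_le1.
rewrite /theta (@big_cat_nat _ _ _ N.+1) //=; last by nlia.
rewrite lerD2l; apply: le_trans lB.
rewrite (@ln_prime_factors R B (B + 2 * N)); last by rewrite B0 leq_addr.
rewrite [leRHS](@big_cat_nat _ _ _ N.+1) //=; last by nlia.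
rewrite -[leLHS]add0r; apply: lerD.
  by apply: sumr_ge0 => p _; rewrite !mulr_ge0 ?ln_nat_ge0.
rewrite [leRHS](@big_cat_nat _ _ _ (2 * N).+1) //=; [|by nlia|by nlia].
rewrite -[leLHS]addr0; apply: lerD; last first.
  by apply: sumr_ge0 => p _; rewrite !mulr_ge0 ?ln_nat_ge0.
rewrite !big_seq; apply: ler_sum => p; rewrite mem_index_iota => hp.
case: (boolP (prime p)) => [pp|_]; last by rewrite !mul0r.
rewrite !mul1r -[leLHS]mul1r; apply: lemul2r; first exact: ln_nat_ge0.
rewrite ler1n logn_gt0 mem_primes pp B0 /=.
have h1 : (p %| (2 * N)`!)%N by apply: dvdn_fact; nlia.
have h2 : ~~ (p %| N`!)%N.
  rewrite -[p]expn1 pfactor_dvdn ?fact_gt0 // -ltnNge logn_fact //.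
  rewrite big_nat_cond big1 // => k hk; apply: divn_small.
  have : (p ^ 1 <= p ^ k)%N by apply: leq_pexp2l; [exact: prime_gt0|nlia].
  by rewrite expn1; nlia.
move: h1; rewrite -(@bin_fact (2 * N) N); last by nlia.
have -> : (2 * N - N = N)%N by nlia.
by rewrite !Euclid_dvdM // => /orP[//|/orP[h|h]]; move: h2; rewrite h.
Qed.

(** Chebyshev's upper bound, by doubling; the induction is on the stronger
    bound by [6 * (n - 1)], which absorbs the rounding of [n / 2]. *)
Lemma theta_le n : theta n <= 6 * n%:R.
Proof.
suff h : (0 < n)%N -> theta n <= 6 * (n%:R - 1).
  case: n h => [|n] h; last by have := h isT; lra.
  by rewrite /theta big_nat1 /= mul0r mulr0.
elim/ltn_ind: n => n IH n0; case: (ltnP 1 n) => n1; last first.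
  have -> : n = 1%N by nlia.
  by rewrite /theta !big_nat_recr ?big_geq //= !mul0r !add0r subrr mulr0.
have hN : (n <= 2 * uphalf n)%N by have := odd_double_half n; rewrite uphalf_half; nlia.
have hN2 : (2 * uphalf n <= n + 1)%N by have := odd_double_half n; rewrite uphalf_half; nlia.
move: (uphalf n) hN hN2 => N hN hN2.
have t1 : theta n <= theta (2 * N).
  rewrite /theta [leRHS](@big_cat_nat _ _ _ n.+1) //=.
  by rewrite lerDl sumr_ge0 // => p _; rewrite mulr_ge0 ?ln_nat_ge0.
have t2 := theta_double N; have t3 := IH N ltac:(nlia) ltac:(nlia).
have a1 : 2 * N%:R <= n%:R + 1 :> R by rewrite -natrM natr1 ler_nat; nlia.
have a2 : 2 <= n%:R :> R by rewrite ler_nat.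
lra.
Qed.

(** The term of index [p] is at most the decrease of [(ln p + 2) / p] between
    [p - 1] and [p]. *)
Lemma sum_ln_over_square n :
  \sum_(0 <= p < n.+1) (prime p)%:R * (ln p%:R / (p%:R * (p%:R - 1))) <= 2 :> R.
Proof.
case: n => [|n]; first by rewrite big_nat1 /= mul0r.
suff h : \sum_(0 <= p < n.+2) (prime p)%:R * (ln p%:R / (p%:R * (p%:R - 1))) <=
    2 - (ln n.+1%:R + 2) / n.+1%:R :> R.
  apply: (le_trans h); rewrite gerBl divr_ge0 // addr_ge0 //; exact: ln_nat_ge0.
elim: n => [|n IH].
  by rewrite !big_nat_recr ?big_geq //= !mul0r ln1; lra.
rewrite big_nat_recr //=; set S := \sum_(_ <= _ < _) _ in IH *.
have n1 : 0 < n.+1%:R :> R by rewrite ltr0n.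
have l2 := ln_nat_ge0 R n.+2.
have h : (prime n.+2)%:R * (ln n.+2%:R / (n.+2%:R * (n.+2%:R - 1))) <=
    ln n.+2%:R / ((n.+1%:R + 1) * n.+1%:R) :> R.
  have -> : n.+2%:R - 1 = n.+1%:R :> R by rewrite -[n.+2%:R]natr1; ring.
  rewrite natr1; case: prime; rewrite ?mul1r ?mul0r //.
  by apply: divr_ge0 => //; apply: mulr_ge0.
have d := @ln_succ_le n.+1 isT.
have d' : n.+1%:R * (ln n.+2%:R - ln n.+1%:R) <= 1 :> R.
  by rewrite mulrC -ler_pdivlMr // div1r.
have d2 : ln n.+2%:R - ln n.+1%:R <= 1 :> R.
  apply: (le_trans d); rewrite invf_le1 //; rewrite ler1n //.
have -> : (ln n.+2%:R + 2) / n.+2%:R = (ln n.+2%:R + 2) / (n.+1%:R + 1) :> R.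
  by rewrite natr1.
apply: (le_trans (lerD IH h)).
rewrite -subr_ge0.
move: (n.+1%:R : R) (ln (n.+2%:R : R)) (ln (n.+1%:R : R)) d' d2 n1 {d l2 IH h S} => m x y d' d2 m0.
have -> : 2 - (x + 2) / (m + 1) - (2 - (y + 2) / m + x / ((m + 1) * m)) =
   (2 - (x - y) - m * (x - y)) / ((m + 1) * m) by field; rewrite !gt_eqF //; lra.
by apply: divr_ge0; [lra|apply: mulr_ge0; lra].
Qed.

Lemma logn_fact_ge p n : prime p -> (n%:R / p%:R - 1 <= (logn p n`!)%:R :> R).
Proof.
move=> pp; have p0 : 0 < p%:R :> R by rewrite ltr0n prime_gt0.
have h1 : (n %/ p <= logn p n`!)%N.
  rewrite logn_fact //; case: n => [|n]; first by rewrite div0n.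
  by rewrite big_ltn // expn1 leq_addr.
have h2 : n%:R < ((n %/ p).+1 * p)%N%:R :> R by rewrite ltr_nat ltn_ceil ?prime_gt0.
apply: (@le_trans _ _ (n %/ p)%N%:R); last by rewrite ler_nat.
rewrite lerBlDr ler_pdivrMr // natr1 -natrM ltW //.
Qed.

(** Legendre's formula without the integer parts; the second term is the sum
    of the geometric series beyond its first term. *)
Lemma logn_fact_le p n : prime p ->
  (logn p n`!)%:R <= n%:R / p%:R + n%:R / (p%:R * (p%:R - 1)) :> R.
Proof.
move=> pp; have p2 : 2 <= p%:R :> R by rewrite ler_nat prime_gt1.
have geo K : n%:R * \sum_(1 <= k < K.+1) (p%:R ^+ k)^-1 + n%:R / (p%:R ^+ K * (p%:R - 1))
   = n%:R / p%:R + n%:R / (p%:R * (p%:R - 1)) :> R.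
  elim: K => [|K IH]; first by rewrite big_geq // mulr0 add0r expr0; field; lra.
  rewrite -IH big_nat_recr //= exprS; field.
  have pn : p%:R != 0 :> R by rewrite gt_eqF //; lra.
  by rewrite expf_neq0 // pn !andbT gt_eqF //; lra.
rewrite logn_fact // natr_sum -(geo n).
apply: (@le_trans _ _ (n%:R * \sum_(1 <= k < n.+1) (p%:R ^+ k)^-1)); last first.
  rewrite lerDl divr_ge0 // mulr_ge0 // ?exprn_ge0 //; lra.
rewrite big_distrr /=; apply: ler_sum => k _.
by rewrite ler_pdivlMr ?exprn_gt0 -?natrX -?natrM ?ler_nat ?leq_trunc_div //; lra.
Qed.

(** The weight of a prime in Mertens' sum. *)
Definition wp (p : nat) : R := (prime p)%:R * (ln p%:R / p%:R).

Lemma wp_ge0 p : 0 <= wp p.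
Proof. by rewrite mulr_ge0 // divr_ge0 // ln_nat_ge0. Qed.

(** Mertens' first theorem, from the prime factorization of the factorial:
    [ln n`!] is [n] times the sum, up to the rounding of [n / p], which
    Chebyshev's bound controls, and the higher powers of [p]. *)
Lemma mertens n : (0 < n)%N ->
  `|\sum_(0 <= p < n.+1) wp p - ln n%:R| <= 6.
Proof.
move=> n0; have np : 0 < n%:R :> R by rewrite ltr0n.
set S := \sum_(_ <= _ < _) _.
have E : ln ((n`!)%:R : R) =
    \sum_(0 <= p < n.+1) (prime p)%:R * ((logn p n`!)%:R * ln p%:R).
  rewrite (@ln_prime_factors R n`! (n`! + n)) ?fact_gt0 ?leq_addr //.
  rewrite (@big_cat_nat _ _ _ n.+1) //=; last by nlia.
  rewrite [X in _ + X]big_nat_cond [X in _ + X]big1 ?addr0 // => p hp.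
  case: (boolP (prime p)) => pp; last by rewrite mul0r.
  rewrite logn_fact // big_nat_cond big1 ?mul0r ?mulr0 // => k hk.
  apply: divn_small.
  have : (p ^ 1 <= p ^ k)%N by apply: leq_pexp2l; [exact: prime_gt0|nlia].
  by rewrite expn1; nlia.
have hi : n%:R * S - theta n <= n%:R * ln n%:R.
  apply: le_trans (ln_fact_le n); rewrite E /S /theta big_distrr -sumrB /=.
  apply: ler_sum => p _; rewrite /wp; case: (boolP (prime p)) => pp; last by rewrite !mul0r mulr0 subr0.
  have := logn_fact_ge n pp => h; rewrite !mul1r.
  have -> : n%:R * (ln p%:R / p%:R) - ln p%:R = (n%:R / p%:R - 1) * ln p%:R :> R by ring.
  by apply: lemul2r => //; exact: ln_nat_ge0.
have lo : n%:R * ln n%:R - n%:R <= n%:R * S + n%:R * 2.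
  apply: (le_trans (ln_fact_ge n0)); rewrite E.
  apply: (@le_trans _ _ (n%:R * S + n%:R *
     \sum_(0 <= p < n.+1) (prime p)%:R * (ln p%:R / (p%:R * (p%:R - 1))))); last first.
    by rewrite lerD2l; apply: lemul2l => //; exact: sum_ln_over_square.
  rewrite /S !big_distrr -big_split /=; apply: ler_sum => p _.
  rewrite /wp; case: (boolP (prime p)) => pp; last by rewrite !mul0r !mulr0 addr0.
  rewrite !mul1r.
  have -> : n%:R * (ln p%:R / p%:R) + n%:R * (ln p%:R / (p%:R * (p%:R - 1))) =
    (n%:R / p%:R + n%:R / (p%:R * (p%:R - 1))) * ln p%:R :> R by ring.
  by apply: lemul2r; [exact: ln_nat_ge0|exact: logn_fact_le].
have th := theta_le n.
rewrite ler_norml; apply/andP; split.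
  by rewrite -(ler_pM2l np) mulrBr; lra.
by rewrite -(ler_pM2l np) mulrBr; lra.
Qed.

End Primes.

(** * Vaughan's identity *)

Section VaughanIdentity.
Variable R : realType.
Local Notation C := R[i].
Variables (N : nat) (F : nat -> C).
Hypothesis F0 : F 0%N = 0.
Hypothesis FN : forall n, (N < n)%N -> F n = 0.

(** Sums of [F] against a convolution, written over the factors: a triple
    convolution can then be regrouped and permuted at will. *)
Definition S2 (a b : nat -> R) : C :=
  \sum_(0 <= i < N.+1) \sum_(0 <= j < N.+1) (a i * b j)%:C%C * F (i * j)%N.

Definition S3 (a b c : nat -> R) : C :=
  \sum_(0 <= i < N.+1) \sum_(0 <= j < N.+1) \sum_(0 <= k < N.+1)
    (a i * b j * c k)%:C%C * F (i * j * k)%N.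

(** Dirichlet convolution, with the factors running up to [N]. *)
Definition dconv (a b : nat -> R) n : R :=
  \sum_(0 <= i < N.+1) \sum_(0 <= j < N.+1) (i * j == n)%N%:R * (a i * b j).

Lemma S3_S2 a b c : S3 a b c = S2 (dconv a b) c.
Proof.
have -> : S2 (dconv a b) c = \sum_(0 <= n < N.+1) \sum_(0 <= k < N.+1)
   \sum_(0 <= i < N.+1) \sum_(0 <= j < N.+1)
     (i * j == n)%N%:R * ((a i * b j * c k)%:C%C * F (n * k)%N).
  apply: eq_bigr => n _; apply: eq_bigr => k _.
  rewrite /dconv big_distrl rmorph_sum big_distrl /=; apply: eq_bigr => i _.
  rewrite big_distrl rmorph_sum big_distrl /=; apply: eq_bigr => j _.
  by case: eqP => _; rewrite ?mul1r // !mul0r.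
rewrite exchange_big /S3 /=.
rewrite [RHS](eq_bigr (fun k => \sum_(0 <= i < N.+1) \sum_(0 <= j < N.+1)
   (a i * b j * c k)%:C%C * F (i * j * k)%N)) => [|k _]; last first.
  rewrite exchange_big /=; apply: eq_bigr => i _.
  rewrite exchange_big /=; apply: eq_bigr => j _.
  rewrite (@sum_eq_ind C (fun n => (a i * b j * c k)%:C%C * F (n * k)%N)).
  case: leqP => h; rewrite ?mul1r // mul0r.
  case: k => [|k]; first by rewrite muln0 F0 mulr0.
  by rewrite FN ?mulr0 // (leq_trans h) // leq_pmulr.
rewrite [RHS]exchange_big /=; apply: eq_bigr => i _.
by rewrite exchange_big.
Qed.

Lemma S3_swap a b c : S3 a b c = S3 a c b.
Proof.
apply: eq_bigr => i _; rewrite exchange_big; apply: eq_bigr => k _.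
by apply: eq_bigr => j _; rewrite -mulnA [(j * k)%N]mulnC mulnA mulrAC.
Qed.

Lemma S3_rot a b c : S3 a b c = S3 c a b.
Proof.
rewrite [RHS]exchange_big; apply: eq_bigr => i _.
rewrite [RHS]exchange_big; apply: eq_bigr => j _; apply: eq_bigr => k _.
have -> : (k * i * j = i * j * k)%N by rewrite -mulnA mulnC.
by have -> : c k * a i * b j = a i * b j * c k by ring.
Qed.

Lemma dconv_one_r (a : nat -> R) n : (0 < n <= N)%N ->
  dconv a (fun=> 1) n = \sum_(0 <= i < N.+1) (i %| n)%N%:R * a i.
Proof.
move=> /andP[n0 nN]; apply: eq_bigr => i _; case: (boolP (i %| n)%N) => [/dvdnP[c nE]|h].
  have i0 : (0 < i)%N by case: (posnP i) nE n0 => // ->; rewrite muln0 => ->.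
  rewrite (eq_bigr (fun j => (c == j)%:R * a i)) => [|j _]; last first.
    by rewrite mulr1 nE mulnC eqn_pmul2r // eq_sym.
  rewrite (@sum_eq_ind R (fun=> a i)) (_ : (c <= N)%N = true) //.
  by apply: leq_trans nN; rewrite nE leq_pmulr.
rewrite mul0r big1 // => j _; case: eqP => [E|]; rewrite ?mul0r //.
by move: h; rewrite -E dvdn_mulr.
Qed.

Lemma dconv_one_l (a : nat -> R) n : (0 < n <= N)%N ->
  dconv (fun=> 1) a n = \sum_(0 <= i < N.+1) (i %| n)%N%:R * a i.
Proof.
move=> hn; rewrite -dconv_one_r // /dconv exchange_big; apply: eq_bigr => i _.
by apply: eq_bigr => j _; rewrite mulnC [1 * _]mulrC.
Qed.

Lemma S2_dconv_ext (a a' b : nat -> R) :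
  (forall n, (0 < n <= N)%N -> a n = a' n) -> S2 a b = S2 a' b.
Proof.
move=> h; apply: eq_big_nat => n hn; apply: eq_bigr => k _.
case: (posnP n) => [->|n0]; first by rewrite mul0n F0 !mulr0.
by rewrite h // n0; nlia.
Qed.

Lemma S3B a a' b c : S3 (fun n => a n - a' n) b c = S3 a b c - S3 a' b c.
Proof.
rewrite /S3 -sumrB; apply: eq_bigr => i _; rewrite -sumrB; apply: eq_bigr => j _.
by rewrite -sumrB; apply: eq_bigr => k _; rewrite !mulrBl rmorphB mulrBl.
Qed.

Lemma S3Br a b c c' : S3 a b (fun n => c n - c' n) = S3 a b c - S3 a b c'.
Proof. by rewrite (S3_rot a b) S3B -(S3_rot a b c) -(S3_rot a b c'). Qed.

Definition upto U (a : nat -> R) n := if (n <= U)%N then a n else 0.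
Definition above U (a : nat -> R) n := if (U < n)%N then a n else 0.

Lemma above_upto U a : above U a = (fun n => a n - upto U a n).
Proof.
by apply/funext => n; rewrite /above /upto; case: leqP; rewrite ?subrr ?subr0.
Qed.

Lemma upto_above U a : upto U a = (fun n => a n - above U a n).
Proof.
by apply/funext => n; rewrite /above /upto; case: leqP; rewrite ?subrr ?subr0.
Qed.

(** Vaughan's identity. The part of [vonM] above [U] is the triple convolution
    of itself with the constant [1] and [mu]; both cut-offs are then expanded. *)
Lemma vaughan U : (forall n, (n <= U)%N -> F n = 0) ->
  \sum_(0 <= n < N.+1) (vonM R n)%:C%C * F n =
    S2 (fun n => ln n%:R) (upto U (mu R))
    - S2 (dconv (upto U (vonM R)) (upto U (mu R))) (fun=> 1)
    + S2 (dconv (above U (vonM R)) (fun=> 1)) (above U (mu R)).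
Proof.
move=> FU; set L := vonM R; set M := mu R.
have -> : \sum_(0 <= n < N.+1) (L n)%:C%C * F n = S3 (fun=> 1) M (above U L).
  rewrite S3_S2 (@S2_dconv_ext _ (fun n => (1 == n)%:R)); last first.
    by move=> n hn; rewrite dconv_one_l // sum_mu_divisors // eq_sym.
  rewrite /S2 [RHS](eq_bigr (fun i => (1%N == i)%:R *
      \sum_(0 <= j < N.+1) (above U L j)%:C%C * F (i * j)%N)) => [|i _]; last first.
    rewrite big_distrr /=; apply: eq_bigr => j _.
    by case: eqP => _; rewrite ?mul1r // !mul0r.
  rewrite (@sum_eq_ind C (fun i => \sum_(0 <= j < N.+1) (above U L j)%:C%C * F (i * j)%N)).
  have term n : (above U L n)%:C%C * F (1 * n)%N = (L n)%:C%C * F n.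
    rewrite mul1n /above; case: leqP => h //; by rewrite FU // !mulr0.
  rewrite (eq_bigr _ (fun n _ => term n)).
  case: (leqP 1 N) => h; first by rewrite mul1r.
  by rewrite mul0r (_ : N = 0%N) ?big_nat1 ?F0 ?mulr0 //; nlia.
have split : S3 (above U L) (fun=> 1) M =
    S3 (above U L) (fun=> 1) (above U M) + S3 (above U L) (fun=> 1) (upto U M).
  by rewrite upto_above S3Br addrCA subrr addr0.
rewrite (S3_rot (fun=> 1) M) split [X in _ + X](_ : _ = S3 L (fun=> 1) (upto U M) -
   S3 (upto U L) (fun=> 1) (upto U M)); last by rewrite above_upto S3B.
rewrite [S3 (upto U L) _ _]S3_swap !S3_S2.
rewrite (@S2_dconv_ext (dconv L (fun=> 1)) (fun n => ln n%:R)); first by ring.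
by move=> n hn; rewrite dconv_one_r // sum_vonM_divisors.
Qed.

End VaughanIdentity.

(** * Type I and type II sums *)

Section Bilinear.
Variable R : realType.
Local Notation C := R[i].

Lemma sum_restrict (V : nmodType) (g : nat -> V) s t T : (t <= T)%N ->
  (forall n, ~~ (s <= n < t)%N -> g n = 0) ->
  \sum_(0 <= n < T) g n = \sum_(s <= n < t) g n.
Proof.
move=> tT g0; case: (leqP s t) => st; last first.
  by rewrite [RHS]big_geq ?(ltnW st) // big_nat_cond big1 // => n hn; apply: g0; nlia.
rewrite (@big_cat_nat _ _ _ t) //= (@big_cat_nat _ _ _ s) //=.
rewrite [X in X + _ + _]big_nat_cond [X in X + _ + _]big1 ?add0r => [|n hn]; last first.
  by apply: g0; nlia.
rewrite [X in _ + X]big_nat_cond [X in _ + X]big1 ?addr0 // => n hn.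
by apply: g0; nlia.
Qed.

Variables (X X' U : nat) (F : nat -> C).
Hypothesis X0 : (0 < X)%N.
Hypothesis X'X : (X' <= 2 * X)%N.
Hypothesis XX' : (X <= X')%N.
Hypothesis U0 : (0 < U)%N.
Hypothesis UX : (U * U <= X)%N.
Hypothesis F1 : forall n, cabs (F n) <= 1.

Lemma U_le_X : (U <= X)%N.
Proof. by rewrite (leq_trans _ UX) // leq_pmulr. Qed.

(** Cutting [F] off turns Vaughan's identity into one for the sum over
    [X < n <= X']; for a fixed [k], the [n] with [k * n] in the window form an
    interval. *)
Definition window n := if (X < n <= X')%N then F n else 0.
(** Dominates every logarithm that occurs below. *)
Definition logsize : R := 1 + ln (2 * X)%N%:R.

Lemma logsize_ge1 : 1 <= logsize.
Proof. by rewrite lerDl ln_nat_ge0. Qed.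

Lemma ln_le_logsize n : (n <= 2 * X + 1)%N -> ln (n%:R : R) <= logsize.
Proof.
move=> h; case: (posnP n) => [->|n0]; first by rewrite ln0 // (le_trans _ logsize_ge1).
apply: (@le_trans _ _ (ln (2 * X).+1%:R)); first by apply: ln_nat_le; nlia.
have X2 : (0 < 2 * X)%N by nlia.
have := ln_succ_le R X2; rewrite /logsize.
have : (2 * X)%N%:R^-1 <= 1 :> R by rewrite invf_le1 ?ltr0n // ler1n.
lra.
Qed.

Lemma window0 : window 0 = 0. Proof. by []. Qed.

Lemma window_out n : ~~ (X < n <= X')%N -> window n = 0.
Proof. by rewrite /window => /negbTE ->. Qed.

Lemma window_le1 n : cabs (window n) <= 1.
Proof. by rewrite /window; case: ifP; rewrite ?F1 // cabs0. Qed.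

Lemma window_interval k n : (0 < k)%N ->
  (X < k * n <= X')%N = ((X %/ k).+1 <= n < (X' %/ k).+1)%N.
Proof. by move=> k0; rewrite !ltnS ltn_divLR // leq_divRL // mulnC. Qed.

Lemma sum_window (w : nat -> R) k : (0 < k)%N ->
  \sum_(0 <= n < X'.+1) (w n)%:C%C * window (k * n) =
  \sum_((X %/ k).+1 <= n < (X' %/ k).+1) (w n)%:C%C * F (k * n)%N.
Proof.
move=> k0; rewrite (@sum_restrict C _ (X %/ k).+1 (X' %/ k).+1).
- by apply: eq_big_nat => n hn; rewrite /window window_interval // hn.
- by rewrite ltnS leq_div.
by move=> n hn; rewrite window_out ?mulr0 // window_interval.
Qed.

Lemma sum_inv_upto T (c : R) : (0 < T <= X')%N -> 0 <= c ->
  \sum_(0 <= j < X'.+1) (if (0 < j <= T)%N then c / j%:R else 0) <=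
  c * (1 + ln T%:R).
Proof.
move=> /andP[T0 TX] c0; rewrite (@sum_restrict R _ 1 T.+1); [|by nlia|]; last first.
  by move=> n; rewrite ltnS => /negbTE ->.
rewrite (@eq_big_nat _ _ _ _ _ _ (fun j => c * j%:R^-1)) => [|j hj]; last first.
  by rewrite ifT.
by rewrite -big_distrr /=; apply: lemul2l => //; exact: harmonic_le.
Qed.

Variable M : R.
Hypothesis M0 : 0 <= M.
Hypothesis typeI : forall q s t, (0 < q <= U * U)%N ->
  (forall l, (s <= l < t)%N -> (X < q * l <= 2 * X)%N) ->
  cabs (\sum_(s <= l < t) F (q * l)%N) <= M / q%:R.

Lemma typeI_window q t : (0 < q <= U * U)%N -> (t <= (X' %/ q).+1)%N ->
  cabs (\sum_((X %/ q).+1 <= n < t) F (q * n)%N) <= M / q%:R.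
Proof.
move=> hq ht; apply: typeI => // l hl.
case/andP: hl => h1 h2; have /andP[q0 _] := hq.
have : (X < q * l <= X')%N by rewrite window_interval // h1 (leq_trans h2 ht).
move: (q * l)%N => m; nlia.
Qed.

(** Partial summation removes the logarithm, and the harmonic sum of the
    bounds [M / j] costs a second one. *)
Lemma typeI_log_bound :
  cabs (S2 X' window (fun n => ln n%:R) (upto U (mu R))) <= 2 * logsize ^+ 2 * M.
Proof.
rewrite /S2 exchange_big /=; apply: (le_trans (cabs_sum _ _ _)).
have l1 := logsize_ge1; have c0 : 0 <= 2 * logsize * M by rewrite !mulr_ge0 //; lra.
apply: (@le_trans _ _ (\sum_(0 <= j < X'.+1)
    (if (0 < j <= U)%N then (2 * logsize * M) / j%:R else 0))); last first.
  apply: (le_trans (sum_inv_upto _ c0)); first by have := U_le_X; nlia.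
  have -> : 2 * logsize ^+ 2 * M = (2 * logsize * M) * logsize by ring.
  apply: lemul2l => //; rewrite /logsize lerD2l; apply: ln_nat_le => //.
  by have := U_le_X; nlia.
apply: ler_sum_nat => j hj; case: (posnP j) => [->|j0].
  rewrite (eq_bigr (fun=> 0)) => [|i _]; last by rewrite muln0 window0 mulr0.
  by rewrite sumr_const_nat mul0rn cabs0.
rewrite /= /upto; case: (leqP j U) => jU; last first.
  rewrite (eq_bigr (fun=> 0)) => [|i _]; last by rewrite mulr0 mul0r.
  by rewrite sumr_const_nat mul0rn cabs0.
rewrite (eq_bigr (fun i => (mu R j)%:C%C * ((ln i%:R)%:C%C * window (j * i)))) => [|i _]; last first.
  by rewrite mulrC mulnC; rewrite rmorphM; ring.
rewrite -big_distrr /= cabsM cabs_real sum_window //.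
rewrite -[leRHS]mul1r; apply: ler_pM => //; [exact: cabs_ge0|exact: mu_le1|].
have jq : (0 < j <= U * U)%N by rewrite j0 (leq_trans jU) // leq_pmulr.
apply: (le_trans (@abel_incr R (fun i => ln i%:R) _ _ _ (M / j%:R) _ _ _ _ _)).
- by rewrite ltnS leq_div2r.
- by rewrite divr_ge0.
- by move=> i _; exact: ln_nat_ge0.
- by move=> i /andP[hi _]; apply: ln_nat_le => //; exact: leq_ltn_trans hi.
- by move=> t /andP[_ ht]; exact: typeI_window.
rewrite mulrA; apply: lemul2r; first by rewrite invr_ge0.
apply: lemul2r => //; apply: lemul2l => //; apply: ln_le_logsize.
by have := leq_div X' j; move: (X' %/ j)%N => m; nlia.
Qed.

(** Without the cut-offs and with [1] in place of [mu], this convolution is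
    the logarithm. *)
Lemma dconv_upto_le q : (0 < q <= X')%N ->
  `|dconv X' (upto U (vonM R)) (upto U (mu R)) q| <= (q <= U * U)%N%:R * logsize.
Proof.
move=> hq; case: leqP => qU; last first.
  rewrite mul0r /dconv big1 ?normr0 // => i _; rewrite big1 // => j _.
  rewrite /upto; case: eqP => [E|]; last by rewrite mul0r.
  case: leqP => iU; last by rewrite mul0r mulr0.
  case: leqP => jU; last by rewrite !mulr0.
  have : (i * j <= U * U)%N by apply: leq_mul.
  by nlia.
rewrite mul1r; apply: (@le_trans _ _ (ln q%:R)); last by apply: ln_le_logsize; nlia.
rewrite -(sum_vonM_divisors R hq) -dconv_one_r //.
apply: (le_trans (ler_norm_sum _ _ _)); apply: ler_sum => i _.
apply: (le_trans (ler_norm_sum _ _ _)); apply: ler_sum => j _.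
rewrite normrM normr_nat; apply: lemul2l => //.
rewrite normrM; apply: ler_pM => //; rewrite /upto; case: leqP => _; rewrite ?normr0 ?vonM_ge0 //.
  by rewrite ger0_norm ?vonM_ge0.
exact: mu_le1.
Qed.

Lemma typeI_plain_bound :
  cabs (S2 X' window (dconv X' (upto U (vonM R)) (upto U (mu R))) (fun=> 1)) <=
  2 * logsize ^+ 2 * M.
Proof.
rewrite /S2; apply: (le_trans (cabs_sum _ _ _)).
have l1 := logsize_ge1; have c0 : 0 <= logsize * M by rewrite !mulr_ge0 //; lra.
apply: (@le_trans _ _ (\sum_(0 <= q < X'.+1)
    (if (0 < q <= U * U)%N then (logsize * M) / q%:R else 0))); last first.
  apply: (le_trans (sum_inv_upto _ c0)); first by nlia.
  have -> : 2 * logsize ^+ 2 * M = (logsize * M) * (2 * logsize) by ring.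
  apply: lemul2l => //; rewrite natrM lnM ?posrE ?ltr0n //.
  have : ln (U%:R : R) <= logsize - 1 by rewrite /logsize addrC addKr; apply: ln_nat_le => //; have := U_le_X; nlia.
  by lra.
apply: ler_sum_nat => q hq; case: (posnP q) => [->|q0].
  rewrite (eq_bigr (fun=> 0)) => [|i _]; last by rewrite mul0n window0 mulr0.
  by rewrite sumr_const_nat mul0rn cabs0.
rewrite (eq_bigr (fun l => (dconv X' (upto U (vonM R)) (upto U (mu R)) q)%:C%C *
   ((1 : R)%:C%C * window (q * l)))) => [|l _]; last by rewrite rmorphM mulrA.
rewrite -big_distrr /= cabsM cabs_real (@sum_window (fun=> 1)) //.
have hq' : (0 < q <= X')%N by nlia.
have := dconv_upto_le hq'; case: leqP => qU /=; last first.
  by rewrite mul0r normr_le0 => /eqP ->; rewrite normr0 mul0r.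
rewrite mul1r => h; rewrite -mulrA; apply: ler_pM => //; first exact: cabs_ge0.
rewrite (eq_bigr (fun l => F (q * l)%N)) => [|l _]; last by rewrite mul1r.
by apply: typeI_window; [nlia|exact: leqnn].
Qed.

Lemma count_interval s t a c :
  \sum_(s <= k < t) (a <= k < c)%N%:R <= (c - a)%N%:R :> R.
Proof.
apply: (@le_trans _ _ (\sum_(0 <= k < maxn t c) (a <= k < c)%N%:R)).
  case: (leqP s t) => st; last by rewrite big_geq ?(ltnW st) // sumr_ge0.
  rewrite [leRHS](@big_cat_nat _ _ _ t) //= ?leq_maxl // [X in _ <= X + _](@big_cat_nat _ _ _ s) //=.
  by rewrite -addrA addrCA lerDl addr_ge0 // sumr_ge0.
rewrite (@sum_restrict R _ a c); [|by rewrite leq_maxr|by move=> n /negbTE ->].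
rewrite (@eq_big_nat _ _ _ _ _ _ (fun=> 1)) => [|k hk]; last by rewrite hk.
by rewrite sumr_const_nat.
Qed.

Variables (H : nat) (Q : R).
Hypothesis H0 : (0 < H)%N.
Hypothesis HU : (H <= U)%N.
Hypothesis XM : X%:R / H%:R <= M.
Hypothesis typeII : forall D d1 d2 s t, (U <= D)%N -> (D * U <= 2 * X)%N ->
  (D < d1 <= 2 * D)%N -> (D < d2 <= 2 * D)%N ->
  (D <= ((d1 - d2) + (d2 - d1)) * H)%N ->
  (forall w, (s <= w < t)%N -> (X < d1 * w <= 2 * X)%N && (X < d2 * w <= 2 * X)%N) ->
  cabs (\sum_(s <= w < t) F (d1 * w)%N * conjc (F (d2 * w)%N)) <= M / D%:R.
Hypothesis Q0 : 0 <= Q.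
Hypothesis QM : 14 * logsize ^+ 2 * X%:R * M <= Q ^+ 2.

Let c2 := dconv X' (above U (vonM R)) (fun=> 1).

Lemma c2_bound n : (0 < n <= X')%N -> `|c2 n| <= logsize.
Proof.
move=> hn; rewrite /c2 dconv_one_r //.
apply: (@le_trans _ _ (ln n%:R)); last by apply: ln_le_logsize; nlia.
rewrite -(sum_vonM_divisors R hn); apply: (le_trans (ler_norm_sum _ _ _)).
apply: ler_sum => i _; rewrite normrM normr_nat; apply: lemul2l => //.
by rewrite /above; case: ifP; rewrite ?normr0 ?vonM_ge0 // ger0_norm ?vonM_ge0.
Qed.

Lemma c2_small n : (0 < n <= X')%N -> (n <= U)%N -> c2 n = 0.
Proof.
move=> hn nU; rewrite /c2 dconv_one_r // big1 // => i _.
rewrite /above; case: ltnP => h; last by rewrite mulr0.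
case: (boolP (i %| n)%N) => [d|]; last by rewrite mul0r.
by have := dvdn_leq _ d; nlia.
Qed.

Lemma near_count D k1 s t : (U <= D)%N ->
  \sum_(s <= k < t) (((k1 - k) + (k - k1)) * H < D)%N%:R <= 3 * D%:R / H%:R :> R.
Proof.
move=> UD; set q := (D %/ H)%N.
have h1 : 1 <= D%:R / H%:R :> R by rewrite ler_pdivlMr ?ltr0n // mul1r ler_nat; nlia.
have h2 : q%:R <= D%:R / H%:R :> R.
  by rewrite ler_pdivlMr ?ltr0n // -natrM ler_nat leq_trunc_div.
apply: (@le_trans _ _ (\sum_(s <= k < t) (k1 - q <= k < (k1 + q).+1)%N%:R)).
  apply: ler_sum => k _; case: ltnP => // h; rewrite ler_nat.
  have : (((k1 - k) + (k - k1)) <= q)%N by rewrite leq_divRL // ltnW.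
  by move=> h3; rewrite (_ : (_ <= k < _)%N = true) //; nlia.
apply: (le_trans (count_interval _ _ _ _)).
apply: (@le_trans _ _ (2 * q + 1)%N%:R); first by rewrite ler_nat; nlia.
by rewrite natrD natrM; lra.
Qed.

Definition block_term k : C :=
  \sum_(0 <= n < X'.+1) (c2 n * mu R k)%:C%C * window (n * k).

(** The Cauchy-Schwarz inequality over [n] removes the coefficients [c2]. In
    the resulting square the pairs [k1, k2] at distance less than [D / H] are
    few and are bounded trivially; the others are correlations of two dilates
    of [F]. *)
Lemma block_bound D b : (U <= D)%N -> (b <= 2 * D)%N -> (b <= X')%N ->
  cabs (\sum_(D.+1 <= k < b.+1) block_term k) <= Q.
Proof.
move=> UD bD bX; have D0 : (0 < D)%N by nlia.
(* When [2 * X < D * U], no product [n * k] with [U < n] and [D < k] lies in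
   the window. *)
case: (leqP (D * U) (2 * X)) => DU; last first.
  rewrite big_nat_cond big1 ?cabs0 // => k hk; rewrite /block_term.
  rewrite big_nat_cond big1 // => n hn; case: (posnP n) => [->|n0].
    by rewrite mul0n window0 mulr0.
  case: (leqP n U) => nU; first by rewrite c2_small ?mul0r //; nlia.
  rewrite window_out ?mulr0 //.
  have : (D * U <= n * k)%N by rewrite mulnC leq_mul; nlia.
  by move: (n * k)%N => m; nlia.
set Y := (2 * X %/ D)%N; set T := (minn Y X').+1.
have YD : (Y * D <= 2 * X)%N by exact: leq_trunc_div.
have YR : Y%:R <= 2 * X%:R / D%:R :> R.
  by rewrite ler_pdivlMr ?ltr0n // -!natrM ler_nat.
have TY : (T <= Y.+1)%N by rewrite ltnS geq_minl.
have TX : (T <= X'.+1)%N by rewrite ltnS geq_minr.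
pose z n := \sum_(D.+1 <= k < b.+1) (mu R k)%:C%C * window (n * k).
have Yout n k : (Y < n)%N -> (D < k)%N -> window (n * k) = 0.
  move=> Yn Dk; apply: window_out.
  have : (2 * X < n * k)%N.
    apply: (@leq_trans (n * D)); last by rewrite leq_mul2l ltnW ?orbT.
    by rewrite -ltn_divLR.
  by move: (n * k)%N => m; nlia.
have -> : \sum_(D.+1 <= k < b.+1) block_term k =
    \sum_(1 <= n < T) (c2 n)%:C%C * z n.
  rewrite /block_term exchange_big /= -(@sum_restrict C (fun n => (c2 n)%:C%C * z n) 1 T X'.+1) //.
    apply: eq_bigr => n _; rewrite /z big_distrr; apply: eq_bigr => k _ /=.
    by rewrite rmorphM mulrA.
  move=> n hn; rewrite /z big_nat_cond big1 ?mulr0 // => k hk.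
  case: (posnP n) => [->|n0]; first by rewrite mul0n window0 mulr0.
  case: (leqP n Y) => nY; last by rewrite Yout ?mulr0 //; nlia.
  rewrite window_out ?mulr0 //; have : (n * 1 <= n * k)%N by rewrite leq_mul2l; nlia.
  by move: hn; rewrite /T; move: (n * k)%N => m; nlia.
rewrite -(@ler_pXn2r _ 2) ?nnegrE ?cabs_ge0 //; apply: le_trans QM.
apply: (le_trans (cabs_cauchy_schwarz _ _ _)).
have X0' : 0 < D%:R :> R by rewrite ltr0n.
have XD0 : 0 <= 2 * X%:R / D%:R :> R by rewrite divr_ge0.
have l1 := logsize_ge1.
have first : \sum_(1 <= n < T) c2 n ^+ 2 <= (2 * X%:R / D%:R) * logsize ^+ 2.
  apply: (@le_trans _ _ (\sum_(1 <= n < T) logsize ^+ 2)).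
    apply: ler_sum_nat => n hn; rewrite -[leLHS]real_normK ?num_real //.
    have l0 : 0 <= logsize by lra.
    by rewrite lerXn2r ?nnegrE //; apply: c2_bound; nlia.
  rewrite sumr_const_nat -[leLHS]mulr_natl; apply: lemul2r; first exact: sqr_ge0.
  by apply: le_trans YR; rewrite ler_nat; nlia.
(* [7] is [6] for the close pairs and [1] for the others; [14] is twice [7]. *)
suff second : \sum_(1 <= n < T) cabs (z n) ^+ 2 <= 7 * D%:R * M.
  apply: (@le_trans _ _ ((2 * X%:R / D%:R * logsize ^+ 2) * (7 * D%:R * M))).
    by apply: ler_pM => //; apply: sumr_ge0 => n _; exact: sqr_ge0.
  by rewrite le_eqVlt; apply/orP; left; apply/eqP; field; rewrite gt_eqF.
pose I k1 k2 := \sum_(1 <= n < T) window (n * k1) * conjc (window (n * k2)).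
have -> : \sum_(1 <= n < T) cabs (z n) ^+ 2 =
   complex.Re (\sum_(D.+1 <= k1 < b.+1) \sum_(D.+1 <= k2 < b.+1)
     (mu R k1 * mu R k2)%:C%C * I k1 k2).
  have -> : \sum_(D.+1 <= k1 < b.+1) \sum_(D.+1 <= k2 < b.+1)
     (mu R k1 * mu R k2)%:C%C * I k1 k2 = \sum_(1 <= n < T) z n * conjc (z n).
    rewrite (eq_bigr (fun k1 => \sum_(1 <= n < T) \sum_(D.+1 <= k2 < b.+1)
       ((mu R k1)%:C%C * window (n * k1)) * conjc ((mu R k2)%:C%C * window (n * k2)))) => [|k1 _].
      rewrite exchange_big /=; apply: eq_bigr => n _.
      by rewrite /z rmorph_sum big_distrlr.
    rewrite exchange_big /=; apply: eq_bigr => k2 _.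
    rewrite /I big_distrr; apply: eq_bigr => n _ /=.
    by rewrite conjZ rmorphM; ring.
  rewrite raddf_sum; apply: eq_bigr => n _.
  by rewrite mul_conj.
apply: (le_trans (Re_le_cabs _)); apply: (le_trans (cabs_sum _ _ _)).
have far k1 k2 : (D < k1 <= 2 * D)%N -> (D < k2 <= 2 * D)%N ->
    (D <= ((k1 - k2) + (k2 - k1)) * H)%N -> cabs (I k1 k2) <= M / D%:R.
  move=> h1 h2 h12.
  have k10 : (0 < k1)%N by nlia.
  have k20 : (0 < k2)%N by nlia.
  have le_T k : (D < k)%N -> ((X' %/ k).+1 <= T)%N.
    move=> Dk; rewrite ltnS leq_min leq_div andbT.
    apply: (@leq_trans (2 * X %/ k)); first exact: leq_div2r.
    by apply: leq_div2l => //; exact: ltnW.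
  have -> : I k1 k2 = \sum_(maxn (X %/ k1).+1 (X %/ k2).+1 <= n <
      minn (X' %/ k1).+1 (X' %/ k2).+1) F (k1 * n)%N * conjc (F (k2 * n)%N).
    have -> : I k1 k2 = \sum_(0 <= n < T) window (n * k1) * conjc (window (n * k2)).
      by rewrite [RHS]big_ltn // mul0n window0 mul0r add0r.
    rewrite (@sum_restrict C _ (maxn (X %/ k1).+1 (X %/ k2).+1)
       (minn (X' %/ k1).+1 (X' %/ k2).+1)).
    - apply: eq_big_nat => n; rewrite geq_max leq_min => hn.
      by rewrite /window ![(n * _)%N]mulnC !window_interval // !ifT //; nlia.
    - by rewrite geq_min le_T //; nlia.
    move=> n; rewrite geq_max leq_min => hn.
    have [w1|w1] := boolP (X < k1 * n <= X')%N; last by rewrite mulnC window_out ?mul0r.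
    have [w2|w2] := boolP (X < k2 * n <= X')%N; last first.
      by rewrite [(n * k2)%N]mulnC [window (k2 * n)]window_out // conjc0 mulr0.
    by move: hn w1 w2; rewrite !window_interval //; nlia.
  apply: typeII => // w; rewrite geq_max leq_min => hw.
  have w1 : (X < k1 * w <= X')%N by rewrite window_interval //; nlia.
  have w2 : (X < k2 * w <= X')%N by rewrite window_interval //; nlia.
  by move: (k1 * w)%N (k2 * w)%N w1 w2 => m1 m2; nlia.
have triv k1 k2 : cabs (I k1 k2) <= 2 * X%:R / D%:R.
  apply: le_trans YR; apply: (le_trans (cabs_sum _ _ _)).
  apply: (@le_trans _ _ (\sum_(1 <= n < T) 1)).
    apply: ler_sum => n _; rewrite cabsM cabs_conj.
    by rewrite mulr_ile1 ?cabs_ge0 ?window_le1.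
  by rewrite sumr_const_nat ler_nat; nlia.
have MD : 0 <= M / D%:R by rewrite divr_ge0.
have bD' : (b.+1 - D.+1)%N%:R <= D%:R :> R by rewrite ler_nat; nlia.
apply: (@le_trans _ _ (\sum_(D.+1 <= k1 < b.+1) 7 * M)); last first.
  rewrite sumr_const_nat -[leLHS]mulr_natl mulrCA mulrA; apply: lemul2r => //.
  exact: lemul2l.
apply: ler_sum_nat => k1 hk1; apply: (le_trans (cabs_sum _ _ _)).
apply: (@le_trans _ _ (\sum_(D.+1 <= k2 < b.+1)
   ((((k1 - k2) + (k2 - k1)) * H < D)%N%:R * (2 * X%:R / D%:R) + M / D%:R))).
  apply: ler_sum_nat => k2 hk2; rewrite cabsM cabs_real normrM.
  apply: (@le_trans _ _ (cabs (I k1 k2))).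
    rewrite -[leRHS]mul1r; apply: lemul2r; first exact: cabs_ge0.
    by rewrite mulr_ile1 ?mu_le1.
  case: ltnP => h12; first by rewrite mul1r; have := triv k1 k2; lra.
  by rewrite mul0r add0r; apply: far => //; nlia.
rewrite big_split /= -big_distrl /= sumr_const_nat.
have n1 := near_count k1 D.+1 b.+1 UD.
have n2 : M / D%:R *+ (b.+1 - D.+1) <= M.
  rewrite -[leLHS]mulr_natl mulrCA -[leRHS]mulr1; apply: lemul2l => //.
  by rewrite ler_pdivrMr // mul1r.
have n3 : \sum_(D.+1 <= k < b.+1) ((k1 - k + (k - k1)) * H < D)%N%:R *
    (2 * X%:R / D%:R) <= 6 * (X%:R / H%:R) :> R.
  rewrite -big_distrl /=.
  apply: (@le_trans _ _ ((3 * D%:R / H%:R) * (2 * X%:R / D%:R))).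
    by apply: lemul2r.
  by rewrite le_eqVlt; apply/orP; left; apply/eqP; field; rewrite !gt_eqF // ltr0n.
rewrite -big_distrl /= in n3; apply: (le_trans (lerD n3 n2)).
have : 6 * (X%:R / H%:R) <= 6 * M by apply: lemul2l.
lra.
Qed.

End Bilinear.

(** * Sums over primes by the bilinear method *)

Section PrimeSum.
Variable R : realType.
Local Notation C := R[i].

Lemma dyadic_bound (f : nat -> C) U N (Q : R) : 0 <= Q ->
  (forall D b, (U <= D)%N -> (b <= 2 * D)%N -> (b <= N)%N ->
    cabs (\sum_(D.+1 <= k < b.+1) f k) <= Q) ->
  forall i a b, (U <= a)%N -> (b <= N)%N -> (b <= 2 ^ i * a)%N ->
    cabs (\sum_(a.+1 <= k < b.+1) f k) <= i%:R * Q.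
Proof.
move=> Q0 h; elim=> [|i IH] a b Ua bN.
  by rewrite expn0 mul1n => ba; rewrite big_geq ?ltnS // cabs0 mul0r.
rewrite expnS -mulnA mulnCA => bi; rewrite -natr1 mulrDl mul1r addrC.
have iQ : 0 <= i%:R * Q by apply: mulr_ge0.
case: (leqP b (2 * a)) => ba.
  by apply: (le_trans (h a b Ua ba bN)); rewrite lerDl.
rewrite (@big_cat_nat _ _ _ (2 * a).+1) //=; [|by nlia|by nlia].
apply: (le_trans (cabsD _ _)); apply: lerD.
  by apply: h => //; nlia.
by apply: IH => //; nlia.
Qed.

Lemma ln2_ge : 1 / 2 <= ln 2 :> R.
Proof. by have := @ln_succ_ge R 1 isT; rewrite ln1; lra. Qed.

Lemma trunc_log_le n : (0 < n)%N -> (trunc_log 2 n)%:R <= 2 * ln (n%:R : R).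
Proof.
move=> n0; have := @trunc_logP 2 n isT n0 => h.
have : ln ((2 ^ trunc_log 2 n)%N%:R : R) <= ln n%:R.
  by apply: ln_nat_le => //; rewrite expn_gt0.
rewrite natrX lnX // => h2; have := ln2_ge => h3.
have h4 : 0 <= (trunc_log 2 n)%:R :> R by [].
nra.
Qed.

(** The bilinear method: in Vaughan's identity the first two terms are sums
    over multiples (type I), and the third, cut into dyadic blocks, is
    controlled by the correlations of two dilates (type II). *)
Theorem prime_sum_bound (X X' U H : nat) (F : nat -> C) (M Q : R) :
  (0 < X)%N -> (X <= X' <= 2 * X)%N -> (0 < U)%N -> (U * U <= X)%N ->
  (0 < H <= U)%N -> (forall n, cabs (F n) <= 1) ->
  (forall q s t, (0 < q <= U * U)%N ->
    (forall l, (s <= l < t)%N -> (X < q * l <= 2 * X)%N) ->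
    cabs (\sum_(s <= l < t) F (q * l)%N) <= M / q%:R) ->
  (forall D d1 d2 s t, (U <= D)%N -> (D * U <= 2 * X)%N ->
    (D < d1 <= 2 * D)%N -> (D < d2 <= 2 * D)%N ->
    (D <= ((d1 - d2) + (d2 - d1)) * H)%N ->
    (forall w, (s <= w < t)%N -> (X < d1 * w <= 2 * X)%N && (X < d2 * w <= 2 * X)%N) ->
    cabs (\sum_(s <= w < t) F (d1 * w)%N * conjc (F (d2 * w)%N)) <= M / D%:R) ->
  X%:R / H%:R <= M -> 0 <= Q -> 14 * logsize R X ^+ 2 * X%:R * M <= Q ^+ 2 ->
  cabs (\sum_(X.+1 <= m < X'.+1) (vonM R m)%:C%C * F m) <=
    4 * logsize R X ^+ 2 * M + 2 * logsize R X * Q.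
Proof.
move=> X0 /andP[XX' X'X] U0 UX /andP[H0 HU] F1 tI tII XM Q0 QM.
have M0 : 0 <= M by apply: le_trans XM; rewrite divr_ge0.
have -> : \sum_(X.+1 <= m < X'.+1) (vonM R m)%:C%C * F m =
   \sum_(0 <= n < X'.+1) (vonM R n)%:C%C * window X X' F n.
  rewrite (@sum_restrict C _ X.+1 X'.+1) //.
    by apply: eq_big_nat => n hn; rewrite /window ifT.
  by move=> n hn; rewrite window_out ?mulr0.
have UX1 := U_le_X U0 UX.
rewrite (@vaughan R X' (window X X' F) _ _ U); last 3 first.
- by [].
- by move=> n hn; rewrite window_out //; nlia.
- by move=> n hn; rewrite window_out //; nlia.
have b1 := typeI_log_bound X0 X'X XX' U0 UX M0 tI.
have b2 := typeI_plain_bound X0 X'X XX' U0 UX M0 tI.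
have bb := block_bound X0 X'X XX' U0 UX F1 M0 H0 HU XM tII Q0 QM.
set A := S2 _ _ _ _ in b1 *; set B := S2 _ _ _ _ in b2 *; set D := S2 _ _ _ _.
suff b3 : cabs D <= 2 * logsize R X * Q.
  apply: (le_trans (cabsD _ _)); have := cabsB A B; lra.
have -> : D = \sum_(U.+1 <= k < X'.+1) block_term X X' U F k.
  rewrite /D /S2 exchange_big /= (@sum_restrict C _ U.+1 X'.+1) //.
    apply: eq_big_nat => k hk; apply: eq_bigr => n _.
    by rewrite /above ifT //; nlia.
  move=> k hk; rewrite big_nat_cond big1 // => n hn; rewrite /above.
  case: ifP => Uk; last by rewrite mulr0 mul0r.
  case: (posnP n) => [->|n0]; first by rewrite mul0n window0 mulr0.
  rewrite window_out ?mulr0 //; have : (1 * k <= n * k)%N by rewrite leq_mul2r n0 orbT.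
  by move: (n * k)%N => m; nlia.
apply: (@le_trans _ _ ((trunc_log 2 X').+1%:R * Q)).
  apply: (dyadic_bound Q0 bb) => //.
  have := @trunc_log_ltn 2 X' isT => h; apply: (leq_trans (ltnW h)).
  by rewrite leq_pmulr.
apply: lemul2r => //; rewrite -natr1.
have X'0 : (0 < X')%N by nlia.
have := trunc_log_le X'0; have : ln (X'%:R : R) <= logsize R X - 1.
  by rewrite /logsize addrC addKr; apply: ln_nat_le.
have := logsize_ge1 R X; lra.
Qed.

End PrimeSum.

(** * Sums over primes with a phase polynomial in 1/m *)

Section PhasePrimes.
Variable R : realType.
Local Notation C := R[i].

Lemma powerB_bounds (x y : R) j : 0 < y -> y < x ->
  (x - y) * x ^+ j <= x ^+ j.+1 - y ^+ j.+1 <= j.+1%:R * ((x - y) * x ^+ j).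
Proof.
move=> y0 yx; have x0 : 0 < x by lra.
elim: j => [|j /andP[IH1 IH2]]; first by rewrite !expr1 expr0 mulr1 mul1r lexx.
have E : x ^+ j.+2 - y ^+ j.+2 = (x - y) * x ^+ j.+1 + y * (x ^+ j.+1 - y ^+ j.+1).
  by rewrite [x ^+ j.+2]exprS [y ^+ j.+2]exprS; ring.
have p : 0 <= (x - y) * x ^+ j by apply: mulr_ge0; [lra|apply: exprn_ge0; lra].
have q : 0 <= x ^+ j.+1 - y ^+ j.+1 by exact: le_trans IH1.
rewrite E; apply/andP; split; first by rewrite lerDl mulr_ge0 //; lra.
have -> : j.+2%:R * ((x - y) * x ^+ j.+1) =
  (x - y) * x ^+ j.+1 + x * (j.+1%:R * ((x - y) * x ^+ j)).
  by rewrite -[j.+2%:R]natr1 [x ^+ j.+1]exprS; ring.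
by rewrite lerD2l; apply: ler_pM => //; lra.
Qed.

Lemma phase_dilate j0 J (b : nat -> R) d w :
  phase j0 J b (d * w) = phase j0 J (fun j => b j / d%:R ^+ j) w.
Proof.
by apply: eq_bigr => j _; rewrite natrM exprMn invfM mulrA.
Qed.

Lemma phaseB j0 J (b c : nat -> R) w :
  phase j0 J b w - phase j0 J c w = phase j0 J (fun j => b j - c j) w.
Proof. by rewrite /phase -sumrB; apply: eq_bigr => j _; rewrite mulrBl. Qed.

(** The sums of type I and II for a polynomial in [1 / m] are sums over such
    polynomials: dilating by [q] replaces [b j] by [b j / q ^ j], and
    correlating the dilates by [d1] and [d2] multiplies [b j] by
    [d1 ^ - j - d2 ^ - j], which is not too small when [d1] and [d2] are at
    distance at least [D / H]. To both [phase_sum_bound] applies with the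
    saving [H = G ^ 2], of which the Cauchy-Schwarz inequality leaves [G]. *)
Lemma phase_prime_bound j0 J (A1 : R) E : (0 < j0 <= J)%N -> 0 <= A1 ->
  exists K B, 1 <= K /\
  forall (X X' U G : nat) (b : nat -> R),
  (0 < X)%N -> (X <= X' <= 2 * X)%N -> K <= G%:R ->
  (4 * (G ^ 2) ^ B <= U)%N -> (G ^ 2 <= U)%N -> (U ^ 2 <= X)%N -> (U ^ 3 <= 4 * X)%N ->
  (forall j, (j0 < j <= J)%N -> `|b j| <= A1 * `|b j0|) ->
  2 * (G%:R ^+ 2) ^+ B.+1 * X%:R ^+ j0 <= `|b j0| ->
  `|b j0| <= (U%:R / 4) ^+ E ->
  cabs (\sum_(X.+1 <= m < X'.+1) (vonM R m)%:C%C * e (phase j0 J b m)) <=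
    12 * K * logsize R X ^+ 2 * X%:R / G%:R.
Proof.
(* The factor [J + 1] comes from [powerB_bounds], which compares
   [d1 ^ - j - d2 ^ - j] with the same difference for [j0]. *)
move=> hj A10; pose A : R := J.+1%:R * A1.
have A0 : 0 <= A by apply: mulr_ge0.
have AA : A1 <= A by rewrite -[leLHS]mul1r; apply: lemul2r => //; rewrite ler1n.
have [K [B [K1 hK]]] := phase_sum_bound E hj A0.
exists K, B; split => // X X' U G b X0 XX KG BU GU UX UX3 hb lo up.
have G1 : 1 <= G%:R :> R := le_trans K1 KG.
have K0 : 0 < K := lt_le_trans ltr01 K1.
have Gp : 0 < G%:R :> R := lt_le_trans ltr01 G1.
set H := (G ^ 2)%N.
have HE : H%:R = G%:R ^+ 2 :> R by rewrite natrX.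
have HG : G%:R <= H%:R :> R by rewrite HE expr2 ler_peMr.
have Hp : 0 < H%:R :> R := lt_le_trans Gp HG.
have H1 : 1 <= H%:R :> R := le_trans G1 HG.
have H0 : (0 < H)%N by rewrite -(@ltr0n R).
have HBp m : 1 <= H%:R ^+ m :> R by exact: exprn_ege1.
have BUr : 4 * H%:R ^+ B <= U%:R :> R by rewrite -natrX -natrM ler_nat.
have U4 : 4 <= U%:R :> R by have := HBp B; lra.
have Up : 0 < U%:R :> R by exact: lt_le_trans U4.
have U0 : (0 < U)%N by rewrite -(@ltr0n R).
have XR : 0 < X%:R :> R by rewrite ltr0n.
have UXr : U%:R * U%:R <= X%:R :> R by rewrite -natrM ler_nat mulnn.
have UX3r : U%:R * U%:R * U%:R <= 4 * X%:R :> R.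
  by rewrite -!natrM ler_nat mulnn -expnSr.
have KH : K <= H%:R := le_trans KG HG.
have HU : H%:R <= U%:R :> R by rewrite ler_nat.
have KX : K <= X%:R / 2.
  by have := le_trans KH HU; clear -U4 UXr => KU; nra.
have bp : 0 < `|b j0|.
  apply: lt_le_trans lo; by rewrite !mulr_gt0 ?exprn_gt0.
have Wbound (W : R) : U%:R / 4 <= W -> H%:R ^+ B <= W /\ forall y, y <= `|b j0| -> y <= W ^+ E.
  move=> UW; split=> [|y yb]; first by clear -UW BUr; lra.
  by apply: (le_trans yb); apply: (le_trans up); rewrite lerXn2r ?nnegrE ?divr_ge0 // (le_trans _ UW) // divr_ge0.
have lo' : 2 * H%:R * H%:R ^+ B * X%:R ^+ j0 <= `|b j0|.
  by apply: le_trans lo; rewrite -HE exprS mulrA.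
have lo1 : H%:R ^+ B * X%:R ^+ j0 <= `|b j0|.
  apply: le_trans lo'; apply: lemul2r; first by rewrite exprn_ge0.
  by rewrite -[leLHS]mul1r; apply: lemul2r; [exact: exprn_ge0|clear -H1; lra].
have l1 := logsize_ge1 R X.
have l0 : 0 <= logsize R X := le_trans ler01 l1.
apply: (le_trans (@prime_sum_bound R X X' U H _ (K * X%:R / H%:R)
  (4 * K * logsize R X * X%:R / G%:R) X0 XX U0 _ _ _ _ _ _ _ _)).
- by rewrite mulnn.
- by rewrite H0.
- by move=> m; rewrite cabs_e.
- move=> q s t hq hl; have q0 : 0 < q%:R :> R by rewrite ltr0n; case/andP: hq.
  have qn k : 0 < q%:R ^+ k :> R by exact: exprn_gt0.
  rewrite (eq_bigr (fun l => e (phase j0 J (fun j => b j / q%:R ^+ j) l))) => [|l _]; last first.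
    by rewrite phase_dilate.
  have hq1 : 1 <= q%:R :> R by rewrite ler1n; case/andP: hq.
  have qU : q%:R <= U%:R * U%:R :> R by rewrite -natrM ler_nat; case/andP: hq.
  have UW : U%:R / 4 <= X%:R / q%:R :> R.
    by rewrite ler_pdivlMr //; clear -UX3r qU Up; nra.
  have [HW yW] := Wbound _ UW.
  have -> : K * X%:R / H%:R / q%:R = K * (X%:R / q%:R) / H%:R by ring.
  apply: (hK H (X%:R / q%:R) q%:R) => //.
  + by rewrite mulrC divfK ?gt_eqF //; clear -KX XR; lra.
  + move=> l /hl /andP[h1 h2].
    have h1' : X%:R <= q%:R * l%:R :> R by rewrite -natrM ler_nat ltnW.
    have h2' : q%:R * l%:R <= 2 * X%:R :> R by rewrite -!natrM ler_nat.
    rewrite ler_pdivrMr // mulrC h1' mulrA ler_pdivlMr // mulrC.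
    by clear -h2' XR; lra.
  + move=> j hjj; rewrite !normrM !normfV !(ger0_norm (ltW (qn _))).
    have -> : A * (`|b j0| / q%:R ^+ j0) / q%:R ^+ (j - j0) = A * `|b j0| / q%:R ^+ j.
      have {2}-> : j = (j0 + (j - j0))%N by nlia.
      by rewrite exprD; field; rewrite !gt_eqF.
    apply: lemul2r; first by rewrite invr_ge0 ltW.
    by apply: (le_trans (hb j hjj)); apply: lemul2r.
  + rewrite normrM normfV (ger0_norm (ltW (qn _))) ler_pdivlMr // expr_div_n mulrA divfK ?gt_eqF //.
  rewrite normrM normfV (ger0_norm (ltW (qn _))); apply: yW.
  by rewrite ler_pdivrMr // -[leLHS]mulr1; apply: lemul2l => //; exact: exprn_ege1.
- move=> D d1 d2 s t UD DU h1 h2 h12 hw.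
  (* Conjugation exchanges [d1] and [d2]. *)
  wlog d12 : d1 d2 h1 h2 h12 hw / (d1 < d2)%N.
    move=> wl; case: (ltngtP d1 d2) => d12.
    + exact: wl.
    + rewrite -cabs_conj rmorph_sum.
      rewrite (eq_bigr (fun w => e (phase j0 J b (d2 * w)) * conjc (e (phase j0 J b (d1 * w))))) => [|w _].
        apply: wl => //; first by rewrite addnC.
        by move=> w /hw; rewrite andbC.
      exact: conj_mul_conj.
    by move: h12; rewrite d12 !subnn; nlia.
  pose b' j := b j * ((d1%:R ^+ j)^-1 - (d2%:R ^+ j)^-1).
  rewrite (eq_bigr (fun w => e (phase j0 J b' w))) => [|w _]; last first.
    rewrite -eN -eD !phase_dilate phaseB; congr e; apply: eq_bigr => j _.
    by rewrite /b' mulrBr.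
  have D0 : 0 < D%:R :> R by rewrite ltr0n; nlia.
  have d1D : D%:R < d1%:R :> R by rewrite ltr_nat; case/andP: h1.
  have d2D : d2%:R <= 2 * D%:R :> R by rewrite -natrM ler_nat; case/andP: h2.
  have d12r : d1%:R < d2%:R :> R by rewrite ltr_nat.
  have dist : D%:R <= (d2%:R - d1%:R) * H%:R :> R.
    by rewrite -natrB ?(ltnW d12) // -natrM ler_nat; apply: (leq_trans h12); rewrite leq_mul2r; nlia.
  have d10 : 0 < d1%:R :> R := lt_trans D0 d1D.
  have d20 : 0 < d2%:R :> R := lt_trans d10 d12r.
  set x := d1%:R^-1 : R; set y := d2%:R^-1 : R.
  have y0 : 0 < y by rewrite invr_gt0.
  have yx : y < x by rewrite ltf_pV2.
  have xD : x <= D%:R^-1 by rewrite lef_pV2 ?posrE // ltW.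
  have b'E j : b' j = b j * (x ^+ j - y ^+ j) by rewrite /b' /x /y !exprVn.
  have x0 : 0 < x by exact: lt_trans yx.
  have xy0 : 0 <= x - y by rewrite subr_ge0 ltW.
  have xk k : 0 <= x ^+ k by rewrite exprn_ge0 // ltW.
  have xyk k : 0 <= (x - y) * x ^+ k by exact: mulr_ge0.
  have D2 : 0 < 2 * D%:R :> R by exact: mulr_gt0.
  have jS j : (0 < j)%N -> (x - y) * x ^+ j.-1 <= x ^+ j - y ^+ j <= j%:R * ((x - y) * x ^+ j.-1).
    by case: j => // j _; exact: powerB_bounds.
  have j00 : (0 < j0)%N by case/andP: hj.
  have [lo0 up0] := andP (jS j0 j00).
  have delta0 : 0 <= x ^+ j0 - y ^+ j0.
    by apply: le_trans lo0; exact: xyk.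
  have nb' : `|b' j0| = `|b j0| * (x ^+ j0 - y ^+ j0).
    by rewrite b'E normrM [`|_ - _|]ger0_norm.
  have DUr : D%:R * U%:R <= 2 * X%:R :> R by rewrite -!natrM ler_nat.
  have UW : U%:R / 4 <= X%:R / (2 * D%:R) :> R.
    rewrite ler_pdivlMr //; clear -DUr; lra.
  have [HW yW] := Wbound _ UW.
  apply: (@le_trans _ _ (K * (X%:R / (2 * D%:R)) / H%:R)); last first.
    have -> : K * (X%:R / (2 * D%:R)) / H%:R = (K * X%:R / H%:R / D%:R) / 2.
      by field; rewrite !gt_eqF // ltr0n.
    have h0 : 0 <= K * X%:R / H%:R / D%:R by rewrite !divr_ge0 // mulr_ge0 // (le_trans _ K1).
    by rewrite ler_pdivrMr // ler_peMr // ler1n.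
  apply: (hK H (X%:R / (2 * D%:R)) D%:R) => //.
  + have -> : D%:R * (X%:R / (2 * D%:R)) = X%:R / 2 :> R by field; rewrite gt_eqF.
    by [].
  + move=> w /hw /andP[/andP[w1 w2] _].
    have w1' : X%:R <= d1%:R * w%:R :> R by rewrite -natrM ler_nat ltnW.
    have w2' : d1%:R * w%:R <= 2 * X%:R :> R by rewrite -!natrM ler_nat.
    have w0 : 0 <= w%:R :> R by [].
    have d1D2 : d1%:R <= 2 * D%:R :> R by exact: ltW (lt_le_trans d12r d2D).
    rewrite ler_pdivrMr ?mulr_gt0 //.
    have -> : 4 * (X%:R / (2 * D%:R)) = 2 * X%:R / D%:R :> R by field; rewrite gt_eqF.
    rewrite ler_pdivlMr //; apply/andP; split.
      by apply: (le_trans w1'); rewrite mulrC; apply: lemul2l.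
    by apply: le_trans w2'; rewrite mulrC; apply: lemul2r => //; exact: ltW.
  + move=> j hjj; rewrite nb' b'E normrM.
    have j0' : (0 < j)%N by nlia.
    have [lo2 up2] := andP (jS j j0').
    have dj : 0 <= x ^+ j - y ^+ j.
      by apply: le_trans lo2; exact: xyk.
    rewrite [`|_ - _|]ger0_norm //.
    have -> : A * (`|b j0| * (x ^+ j0 - y ^+ j0)) / D%:R ^+ (j - j0) =
        (A1 * `|b j0|) * (J.+1%:R * ((x ^+ j0 - y ^+ j0) * D%:R^-1 ^+ (j - j0))).
      by rewrite exprVn /A; ring.
    apply: ler_pM => //; first exact: hb.
    apply: (le_trans up2); apply: ler_pM => //; first by rewrite ler_nat; nlia.
    have -> : j.-1 = (j0.-1 + (j - j0))%N by nlia.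
    rewrite exprD mulrA; apply: ler_pM => //.
    by rewrite lerXn2r ?nnegrE //; exact: ltW.
  + rewrite nb'.
    have dd : (2 * H%:R * (2 * D%:R) ^+ j0)^-1 <= x ^+ j0 - y ^+ j0.
      apply: le_trans lo0.
      have -> : x - y = (d2%:R - d1%:R) * x * y.
        by rewrite /x /y; field; rewrite !gt_eqF.
      have -> : (d2%:R - d1%:R) * x * y * x ^+ j0.-1 = (d2%:R - d1%:R) * (y * x ^+ j0).
        by rewrite -{2}(prednK j00) exprS; ring.
      have hx : ((2 * D%:R) ^+ j0)^-1 <= x ^+ j0.
        have i2 : 0 <= (2 * D%:R)^-1 :> R by rewrite invr_ge0 ltW.
        have ix : (2 * D%:R)^-1 <= x.
          by rewrite lef_pV2 ?posrE // ltW // (lt_le_trans d12r).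
        by rewrite -exprVn lerXn2r ?nnegrE //; exact: ltW.
      have hy : (2 * D%:R)^-1 <= y by rewrite lef_pV2 ?posrE.
      have hd : D%:R / H%:R <= d2%:R - d1%:R :> R by rewrite ler_pdivrMr // ltr0n.
      have -> : (2 * H%:R * (2 * D%:R) ^+ j0)^-1 =
          D%:R / H%:R * ((2 * D%:R)^-1 * ((2 * D%:R) ^+ j0)^-1) :> R.
        by field; rewrite !gt_eqF ?exprn_gt0.
      have i1 : 0 <= (2 * D%:R)^-1 :> R by rewrite invr_ge0 ltW.
      have i2 : 0 <= ((2 * D%:R) ^+ j0)^-1 :> R by rewrite invr_ge0 exprn_ge0 // ltW.
      have i3 : 0 <= D%:R / H%:R :> R by rewrite divr_ge0.
      have i4 := mulr_ge0 i1 i2.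
      by apply: (ler_pM i3 i4 hd); exact: ler_pM.
    apply: (@le_trans _ _ (`|b j0| * (2 * H%:R * (2 * D%:R) ^+ j0)^-1)); last exact: lemul2l.
    rewrite ler_pdivlMr; last by rewrite !mulr_gt0 ?exprn_gt0.
    rewrite expr_div_n.
    have -> : H%:R ^+ B * (X%:R ^+ j0 / (2 * D%:R) ^+ j0) * (2 * H%:R * (2 * D%:R) ^+ j0) =
      2 * H%:R * H%:R ^+ B * X%:R ^+ j0 :> R by field; rewrite gt_eqF // exprn_gt0 // mulr_gt0.
    by [].
  apply: yW; rewrite nb' -[leRHS]mulr1; apply: lemul2l => //.
  apply: (@le_trans _ _ (x ^+ j0)); first by rewrite gerBl exprn_ge0 // ltW.
  apply: exprn_ile1; first exact: ltW.
  rewrite invf_le1 // ler1n; nlia.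
- apply: lemul2r; first by rewrite invr_ge0.
  rewrite -[leLHS]mul1r; exact: lemul2r.
- by rewrite divr_ge0 // !mulr_ge0 // ltW.
- have -> : 14 * logsize R X ^+ 2 * X%:R * (K * X%:R / H%:R) =
      14 * K * (logsize R X * X%:R / G%:R) ^+ 2.
    by rewrite HE; field; rewrite gt_eqF.
  have -> : (4 * K * logsize R X * X%:R / G%:R) ^+ 2 = 16 * K ^+ 2 * (logsize R X * X%:R / G%:R) ^+ 2.
    by field; rewrite gt_eqF.
  by apply: lemul2r; [exact: sqr_ge0|clear -K1; nra].
have -> : 4 * logsize R X ^+ 2 * (K * X%:R / H%:R) + 2 * logsize R X * (4 * K * logsize R X * X%:R / G%:R) =
  K * logsize R X ^+ 2 * X%:R * (4 / H%:R + 8 / G%:R) by ring.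
have -> : 12 * K * logsize R X ^+ 2 * X%:R / G%:R = K * logsize R X ^+ 2 * X%:R * (12 / G%:R) by ring.
apply: lemul2l; first by rewrite !mulr_ge0 ?exprn_ge0 // ltW.
have : H%:R^-1 <= G%:R^-1 :> R by rewrite lef_pV2 ?posrE.
by move=> HGV; clear -HGV; lra.
Qed.

End PhasePrimes.

(** * The asymptotic form of the estimate *)

Section Asymptotics.
Variable R : realType.
Local Notation C := R[i].

Lemma ln_le_powR (x k : R) : 0 < k -> 1 <= x -> ln x <= x `^ k / k.
Proof.
move=> k0 x1; rewrite ler_pdivlMr // mulrC -ln_powR ltW // ln_sublinear //.
by rewrite powR_gt0; lra.
Qed.

Lemma powR_natM (x k : R) p : 0 <= x -> (x `^ k) ^+ p = x `^ (k * p%:R).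
Proof. by move=> x0; rewrite powRrM powR_mulrn ?powR_ge0. Qed.

Lemma powR_le_exp (x k k' : R) : 1 <= x -> k <= k' -> x `^ k <= x `^ k'.
Proof. by move=> x1 kk; apply: ler_powR. Qed.

Lemma powR_le_base (x y k : R) : 0 <= k -> 0 <= x -> x <= y -> x `^ k <= y `^ k.
Proof. by move=> k0 x0 xy; apply: ge0_ler_powR; rewrite ?nnegrE // (le_trans x0). Qed.

Lemma powR_add (x a b : R) : 0 < x -> x `^ (a + b) = x `^ a * x `^ b.
Proof. by move=> x0; rewrite powRD //; apply/implyP => _; rewrite gt_eqF. Qed.

Lemma nat_powR_large (c k : R) : 0 < k -> exists n0, forall n, (n0 <= n)%N -> c <= n%:R `^ k.
Proof.
move=> k0; exists (Num.trunc (`|c| `^ k^-1)).+1 => n hn.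
have h : `|c| `^ k^-1 <= n%:R.
  have := truncnS_gt (`|c| `^ k^-1) => /ltW h; apply: (le_trans h).
  by rewrite ler_nat.
apply: (le_trans (ler_norm c)).
have -> : `|c| = (`|c| `^ k^-1) `^ k by rewrite -powRrM mulVf ?gt_eqF // powRr1.
by apply: powR_le_base => //; exact: ltW.
Qed.

Lemma log_power_le (c k : R) p : 0 < k ->
  exists n0, forall n, (n0 <= n)%N -> c * (1 + ln (n%:R : R)) ^+ p <= n%:R `^ k.
Proof.
move=> k0; pose k1 := k / (2 * p.+1%:R).
have p0 : 0 < p.+1%:R :> R by rewrite ltr0n.
have k10 : 0 < k1 by apply: divr_gt0 => //; apply: mulr_gt0.
have [n0 h0] := nat_powR_large (`|c| * (1 + k1^-1) ^+ p) (divr_gt0 k0 (ltr0Sn R 1)).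
exists n0.+1 => n hn; have n1 : (0 < n)%N by nlia.
have nr : 1 <= n%:R :> R by rewrite ler1n.
have l0 := ln_nat_ge0 R n.
apply: (@le_trans _ _ (`|c| * ((1 + k1^-1) * n%:R `^ k1) ^+ p)).
  apply: (@le_trans _ _ (`|c| * (1 + ln n%:R) ^+ p)).
    by apply: lemul2r; [rewrite exprn_ge0 //; lra|exact: ler_norm].
  apply: lemul2l => //; have i0 : 0 < k1^-1 by rewrite invr_gt0.
  have q1 : 1 <= n%:R `^ k1 by have := powR_le_exp nr (ltW k10); rewrite powRr0.
  have q2 := ln_le_powR k10 nr.
  rewrite lerXn2r ?nnegrE //; [lra|by rewrite mulr_ge0 //; lra|].
  by rewrite mulrDl mul1r mulrC; apply: lerD; rewrite // mulrC.
rewrite exprMn powR_natM; last by lra.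
have h2 : n%:R `^ (k1 * p%:R) <= n%:R `^ (k / 2).
  apply: powR_le_exp => //; rewrite /k1 -mulrA ler_pM2l // mulrC ler_pdivrMr ?mulr_gt0 //.
  by rewrite mulrA mulVf ?mul1r ?gt_eqF // ler_nat.
have h1 : `|c| * (1 + k1^-1) ^+ p <= n%:R `^ (k / 2) by apply: h0; nlia.
have -> : n%:R `^ k = n%:R `^ (k / 2) * n%:R `^ (k / 2).
  by rewrite -powR_add; [congr (_ `^ _); field|lra].
rewrite mulrA.
apply: ler_pM => //; rewrite ?powR_ge0 //.
by apply: mulr_ge0 => //; rewrite exprn_ge0 // addr_ge0 // invr_ge0 ltW.
Qed.

Lemma exists_nat_near (x : R) : 1 <= x -> exists G : nat, x <= G%:R <= 2 * x.
Proof.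
move=> x1; have x0 : 0 <= x by lra.
have := truncn_itv x0 => /andP[h1 h2]; exists (Num.trunc x).+1.
by rewrite -natr1 in h2 *; lra.
Qed.

(** [phase_prime_bound] with [G] of size [(ln n) ^ 2] and [U] of size
    [n ^ (s / 4)]. The ratio [n / X ^ j0] is at least [n ^ (1 - t * j0)],
    which exceeds every power of [G], and [n] is at most a fixed power of [U];
    the saving [G] beats the factor [logsize ^ 2]. *)
Lemma phase_primes_small j0 J (al : nat -> R) (s t ep : R) : (0 < j0 <= J)%N ->
  al j0 != 0 -> 0 < s -> t * j0%:R < 1 -> 0 < ep ->
  exists n0, forall n X X', (n0 <= n)%N -> n%:R `^ s <= X%:R -> X%:R <= n%:R `^ t ->
    (X <= X' <= 2 * X)%N ->
    cabs (\sum_(X.+1 <= m < X'.+1) (vonM R m)%:C%C * e (phase j0 J (fun j => al j * n%:R) m))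
      <= ep * X%:R.
Proof.
move=> hj al0 s0 tj ep0.
have a0 : 0 < `|al j0| by rewrite normr_gt0.
pose A1 := (\sum_(0 <= j < J.+1) `|al j|) / `|al j0|.
have A10 : 0 <= A1 by rewrite divr_ge0 ?sumr_ge0.
(* [U / 4] is at least [n ^ (s / 8)], so [(U / 4) ^ E] is at least [n ^ 2]. *)
pose E := (Num.trunc (16 / s)).+1.
have hE : 16 / s <= E%:R by exact: ltW (truncnS_gt _).
have [K [B [K1 hK]]] := phase_prime_bound E hj A10.
(* [G] is at least [c1 * lam ^ 2] with [lam = 1 + ln n]; [48] is [12] times
   the square of [2], because [logsize <= 2 * lam]. *)
pose c1 : R := 48 * K / ep + K.
have Ke : 0 <= 48 * K / ep by apply: divr_ge0; [lra|exact: ltW].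
have Kc1 : K <= c1 by rewrite /c1 lerDr.
have c1K : 1 <= c1 by exact: le_trans Kc1.
have s4 : 0 < s / 4 by lra.
have s8 : 0 < s / 8 by lra.
have tj' : 0 < 1 - t * j0%:R by lra.
have [n1 h1] := log_power_le (4 * (2 * c1) ^+ (2 * B)) (4 * B) s4.
have [n2 h2] := log_power_le ((2 * c1) ^+ 2) 4 s4.
have [n3 h3] := nat_powR_large 4 s4.
have [n4 h4] := nat_powR_large 4 s8.
have [n5 h5] := log_power_le (2 * (2 * c1) ^+ (2 * B.+1) / `|al j0|) (4 * B.+1) tj'.
have [n6 h6] := nat_powR_large `|al j0| (@ltr01 R).
exists (n1 + n2 + n3 + n4 + n5 + n6).+1 => n X X' hn sX Xt XX.
have {}h1 := h1 n ltac:(nlia); have {}h2 := h2 n ltac:(nlia).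
have {}h3 := h3 n ltac:(nlia); have {}h4 := h4 n ltac:(nlia).
have {}h5 := h5 n ltac:(nlia); have {}h6 := h6 n ltac:(nlia).
have n0 : (0 < n)%N by nlia.
have nr : 1 <= n%:R :> R by rewrite ler1n.
have np : 0 < n%:R :> R by lra.
have l0 := ln_nat_ge0 R n.
move: h1 h2 h5; set lam := 1 + ln n%:R => h1 h2 h5.
have lam1 : 1 <= lam by rewrite /lam lerDl.
have lam0 : 0 <= lam := le_trans ler01 lam1.
have c10 : 0 <= c1 := le_trans ler01 c1K.
have K0 : 0 < K := lt_le_trans ltr01 K1.
have lp k : 1 <= lam ^+ k by exact: exprn_ege1.
have cl : 1 <= c1 * lam ^+ 2 by exact: mulr_ege1.
have [G /andP[G1 G2]] := exists_nat_near cl.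
have G0 : 0 <= G%:R :> R by [].
have Gp k : (G%:R ^+ 2) ^+ k <= (2 * c1) ^+ (2 * k) * lam ^+ (4 * k).
  rewrite -exprM (_ : 4 * k = 2 * (2 * k))%N; last by nlia.
  rewrite [lam ^+ _]exprM -exprMn lerXn2r ?nnegrE //; last by rewrite -mulrA.
  by rewrite !mulr_ge0 ?exprn_ge0.
set T := n%:R `^ (s / 4) in h1 h2 h3.
have T4 : 4 <= T by [].
have T2 : 2 <= T by apply: le_trans T4; rewrite ler_nat.
have T0 : 0 <= T by exact: powR_ge0.
have TT0 : 0 <= 2 * T by exact: mulr_ge0.
have [U /andP[U1 U2]] : exists U : nat, T <= U%:R <= 2 * T by apply: exists_nat_near; apply: le_trans T2; rewrite ler1n.
have ns : n%:R `^ s = T ^+ 4 by rewrite powR_natM //; congr (_ `^ _); field.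
have X0 : (0 < X)%N.
  by rewrite -(@ltr0n R); apply: lt_le_trans sX; rewrite powR_gt0.
have t1 : t <= 1.
  rewrite leNgt; apply/negP => t1; have : 1 <= j0%:R :> R by rewrite ler1n; case/andP: hj.
  by move=> j1; clear -tj t1 j1; nra.
have Xn : X%:R <= n%:R :> R.
  by apply: (le_trans Xt); rewrite -[leRHS](@powRr1 R) //; exact: powR_le_exp.
have bound := @hK X X' U G (fun j => al j * n%:R) X0 XX.
apply: (le_trans (bound _ _ _ _ _ _ _ _)).
- apply: le_trans G1; rewrite -[leLHS]mulr1; apply: ler_pM => //; exact: ltW.
- rewrite -(@ler_nat R) natrM natrX natrX; apply: le_trans U1; apply: le_trans h1.
  by rewrite -mulrA; apply: lemul2l.
- rewrite -(@ler_nat R) natrX; apply: le_trans U1; apply: le_trans h2.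
  by have := Gp 1%N; rewrite expr1 !muln1.
- rewrite -(@ler_nat R) natrX; apply: le_trans sX; rewrite ns.
  apply: (@le_trans _ _ ((2 * T) ^+ 2)); first by rewrite lerXn2r ?nnegrE.
  rewrite exprMn (exprD T 2 2); apply: lemul2r; first exact: exprn_ge0.
  by rewrite lerXn2r ?nnegrE.
- rewrite -(@ler_nat R) natrM natrX.
  apply: (@le_trans _ _ (4 * T ^+ 4)); last by rewrite -ns; apply: lemul2l.
  apply: (@le_trans _ _ ((2 * T) ^+ 3)); first by rewrite lerXn2r ?nnegrE.
  have T3 : 0 <= T ^+ 3 by exact: exprn_ge0.
  rewrite exprMn (exprS T 3) mulrA; apply: lemul2r => //.
  by rewrite -natrX; clear -T2; lra.
- move=> j hjj; rewrite !normrM mulrA; apply: lemul2r => //.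
  have jin : j \in index_iota 0 J.+1 by rewrite mem_index_iota; nlia.
  rewrite /A1 divfK ?gt_eqF // (bigD1_seq j jin (iota_uniq _ _)) /= lerDl.
  by apply: sumr_ge0.
- rewrite normrM [`|n%:R|]ger0_norm // mulrC.
  apply: (@le_trans _ _ (n%:R `^ (t * j0%:R) * (`|al j0| * n%:R `^ (1 - t * j0%:R)))); last first.
    rewrite mulrCA -powR_add //.
    by rewrite addrC subrK powRr1.
  apply: ler_pM; rewrite ?exprn_ge0 ?mulr_ge0 ?exprn_ge0 //.
    by rewrite -powR_natM // lerXn2r ?nnegrE ?powR_ge0.
  move: h5; rewrite mulrAC ler_pdivrMr // [_ * `|al j0|]mulrC => h5; apply: le_trans h5.
  by rewrite -mulrA; apply: lemul2l.
- rewrite normrM [`|n%:R|]ger0_norm //.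
  apply: (@le_trans _ _ (n%:R `^ 1 * n%:R `^ 1)).
    by rewrite powRr1 //; apply: lemul2r => //; rewrite -[leRHS](@powRr1 R).
  rewrite -powR_add //.
  have e8 : n%:R `^ (s / 8) <= U%:R / 4.
    apply: (@le_trans _ _ (T / 4)); last by clear -U1; lra.
    have -> : T = n%:R `^ (s / 8) * n%:R `^ (s / 8).
      rewrite -powR_add //.
      by rewrite /T; congr (_ `^ _); field.
    by clear -h4; nra.
  apply: (@le_trans _ _ ((n%:R `^ (s / 8)) ^+ E)); last first.
    by rewrite lerXn2r ?nnegrE ?powR_ge0 // divr_ge0.
  rewrite powR_natM //; apply: powR_le_exp => //.
  by move: hE; rewrite ler_pdivrMr // => hE'; clear -hE'; lra.
have LX : logsize R X <= 2 * lam.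
  rewrite /logsize natrM lnM ?posrE ?ltr0n // /lam.
  have := ln2_le1 R; have : ln (X%:R : R) <= ln n%:R by apply: ln_nat_le => //; rewrite -(@ler_nat R).
  by move=> lX l2; clear -lX l2 l0; lra.
have L0 : 0 <= logsize R X := le_trans ler01 (logsize_ge1 R X).
have Gpos : 0 < G%:R :> R := lt_le_trans ltr01 (le_trans cl G1).
have L2 : logsize R X ^+ 2 <= (2 * lam) ^+ 2 by rewrite lerXn2r ?nnegrE // mulr_ge0.
rewrite ler_pdivrMr // [leRHS]mulrAC; apply: lemul2r => //.
apply: (@le_trans _ _ (ep * (c1 * lam ^+ 2))); last by apply: lemul2l => //; exact: ltW.
have -> : ep * (c1 * lam ^+ 2) = (48 * K + ep * K) * lam ^+ 2.
  by rewrite /c1; field; rewrite gt_eqF.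
have lam21 := lp 2%N; have epK : 0 < ep * K by exact: mulr_gt0.
move: L2; rewrite exprMn => L2; clear -lam21 epK L2 K0; nra.
Qed.

End Asymptotics.

(** * Sums over primes with Mertens weights *)

Section WeightedPrimes.
Variable R : realType.
Local Notation C := R[i].

Lemma ln_nat_large (c : R) : exists n0, forall n, (n0 <= n)%N -> c <= ln (n%:R : R).
Proof.
exists (Num.trunc (expR c)).+1 => n hn.
have h : expR c <= n%:R.
  by apply: (le_trans (ltW (truncnS_gt _))); rewrite ler_nat.
by rewrite -[leLHS]expRK ler_ln ?posrE ?expR_gt0 // (lt_le_trans (expR_gt0 c)).
Qed.

(** The prime powers with exponent at least two contribute to the sum of
    [vonM m / m] no more than the convergent sum of [ln p / (p * (p - 1))]. *)
Lemma higher_prime_powers N :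
  \sum_(0 <= m < N.+1) `|vonM R m / m%:R - wp R m| <= 2.
Proof.
case: N => [|N]; first by rewrite big_nat1 /wp invr0 !mulr0 subrr normr0.
have E m : (m <= N.+1)%N -> vonM R m / m%:R - wp R m =
    \sum_(0 <= p < N.+2) \sum_(2 <= k < N.+2)
      (p ^ k == m)%N%:R * ((prime p)%:R * (ln p%:R / m%:R)).
  move=> mN; rewrite (@vonM_widen R m N.+1) // /wp.
  have -> : (prime m)%:R * (ln m%:R / m%:R) =
      \sum_(0 <= p < N.+2) (m == p)%:R * ((prime p)%:R * (ln p%:R / m%:R)) :> R.
    by rewrite sum_eq_ind mN mul1r.
  rewrite big_distrl -sumrB /=; apply: eq_bigr => p _.
  rewrite big_ltn // expn1 mulrDl addrAC big_distrl /= [p == m]eq_sym.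
  have -> : (prime p && (m == p))%:R * ln p%:R / m%:R -
      (m == p)%:R * ((prime p)%:R * (ln p%:R / m%:R)) = 0 :> R.
    by case: prime; case: eqP => _ /=; rewrite ?mul1r ?mul0r ?mulr0 subrr.
  rewrite add0r; apply: eq_bigr => k _.
  by case: prime; case: eqP => _ /=; rewrite ?mul1r ?mul0r ?mulr0 ?mul0r.
have pos m p k : 0 <= (p ^ k == m)%N%:R * ((prime p)%:R * (ln p%:R / m%:R)) :> R.
  do 2 (apply: mulr_ge0 => //); apply: divr_ge0 => //; exact: ln_nat_ge0.
rewrite (@eq_big_nat _ _ _ _ _ _ (fun m => \sum_(0 <= p < N.+2) \sum_(2 <= k < N.+2)
      (p ^ k == m)%N%:R * ((prime p)%:R * (ln p%:R / m%:R)))) => [|m hm]; last first.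
  by rewrite E // ger0_norm //; do 2 (apply: sumr_ge0 => ? _).
rewrite exchange_big /=; apply: le_trans (sum_ln_over_square R N.+1).
apply: ler_sum => p _; rewrite exchange_big /=.
case: (boolP (prime p)) => pp; last first.
  rewrite mul0r big1 // => k _; rewrite big1 // => m _; by rewrite mul0r mulr0.
have p2 : 2 <= p%:R :> R by rewrite ler_nat prime_gt1.
have geo K : \sum_(2 <= k < K.+2) (p%:R ^+ k)^-1 + (p%:R ^+ K.+1 * (p%:R - 1))^-1
   = (p%:R * (p%:R - 1))^-1 :> R.
  elim: K => [|K IH]; first by rewrite big_geq // add0r expr1.
  rewrite -IH big_nat_recr //= [p%:R ^+ K.+2]exprS; field.
  have pn : p%:R != 0 :> R by rewrite gt_eqF //; lra.
  by rewrite expf_neq0 // pn !andbT gt_eqF //; lra.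
apply: (@le_trans _ _ (\sum_(2 <= k < N.+2) ln p%:R * (p%:R ^+ k)^-1)).
  apply: ler_sum => k _.
  rewrite (@sum_eq_ind R (fun m => true%:R * (ln p%:R / m%:R))) mul1r natrX.
  have h : 0 <= ln p%:R / p%:R ^+ k :> R by rewrite divr_ge0 ?ln_nat_ge0 ?exprn_ge0.
  by case: leqP => _; rewrite ?mul1r ?mul0r.
rewrite -big_distrr /= mul1r; apply: lemul2l; first exact: ln_nat_ge0.
rewrite -(geo N) lerDl invr_ge0 mulr_ge0 ?exprn_ge0 //; lra.
Qed.

Definition cutoff (t : R) n := Num.trunc (n%:R `^ t).

Lemma cutoff_le t n : (cutoff t n)%:R <= n%:R `^ t.
Proof. by rewrite truncn_le powR_ge0. Qed.

Lemma cutoff_mono s t n : s <= t -> (0 < n)%N -> (cutoff s n <= cutoff t n)%N.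
Proof. by move=> st n0; apply: le_truncn; apply: powR_le_exp => //; rewrite ler1n. Qed.

(** Partial summation with the weight [1 / m] turns the bound of
    [phase_primes_small] into a bound by a multiple of [ep] on each dyadic
    block, and there are [O (ln n)] blocks. *)
Lemma wp_phase_small j0 J (al : nat -> R) (s t ep : R) : (0 < j0 <= J)%N ->
  al j0 != 0 -> 0 < s -> s <= t -> t * j0%:R < 1 -> 0 < ep ->
  exists n0, forall n, (n0 <= n)%N ->
    cabs (\sum_((cutoff s n).+1 <= p < (cutoff t n).+1)
      (wp R p)%:C%C * e (phase j0 J (fun j => al j * n%:R) p)) <= ep * ln n%:R.
Proof.
move=> hj al0 s0 st tj ep0.
have s20 : 0 < s / 2 by lra.
have ep6 : 0 < ep / 6 by lra.
have [n1 h1] := phase_primes_small hj al0 s20 tj ep6.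
have [n2 h2] := nat_powR_large 2 s20.
have [n3 h3] := ln_nat_large (1 + 4 / ep).
exists (n1 + n2 + n3).+1 => n hn.
have {}h1 := h1 n; have {}h2 := h2 n ltac:(nlia); have {}h3 := h3 n ltac:(nlia).
have n0 : (0 < n)%N by nlia.
have nr : 1 <= n%:R :> R by rewrite ler1n.
have e4 : 0 < 4 / ep by exact: divr_gt0.
set U := cutoff s n; set N := cutoff t n.
set g := fun m => e (phase j0 J (fun j => al j * n%:R) m).
have U1 : n%:R `^ (s / 2) <= U%:R.
  have := truncnS_gt (n%:R `^ s); rewrite -/(cutoff s n) -/U -natr1.
  have -> : n%:R `^ s = n%:R `^ (s / 2) * n%:R `^ (s / 2).
    by rewrite -powR_add; [congr (_ `^ _); field|lra].
  move: (n%:R `^ (s / 2)) h2 => T h2 h; nra.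
have U0 : (0 < U)%N by rewrite -(@ltr0n R); lra.
have Nn : (N <= n)%N.
  have t1 : t <= 1.
    rewrite leNgt; apply/negP => t1; have : 1 <= j0%:R :> R by rewrite ler1n; case/andP: hj.
    by nra.
  rewrite -(@ler_nat R); apply: (le_trans (cutoff_le t n)).
  by rewrite -[leRHS](@powRr1 R) //; exact: powR_le_exp.
pose f m := (vonM R m / m%:R)%:C%C * g m.
have block D b : (U <= D)%N -> (b <= 2 * D)%N -> (b <= N)%N ->
    cabs (\sum_(D.+1 <= k < b.+1) f k) <= ep / 6.
  move=> UD bD bN; case: (leqP D b) => Db; last first.
    by rewrite big_geq ?cabs0 ?ltW //; nlia.
  have D0 : 0 < D%:R :> R by rewrite ltr0n; nlia.
  rewrite (eq_bigr (fun m => (m%:R^-1)%:C%C * ((vonM R m)%:C%C * g m))) => [|m _]; last first.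
    by rewrite /f rmorphM mulrA [_%:C%C * (vonM R m)%:C%C]mulrC.
  apply: (le_trans (@abel_decr R (fun m => m%:R^-1) _ D.+1 b.+1 (ep / 6 * D%:R) _ _ _ _)).
  - by [].
  - by move=> i _; rewrite invr_ge0.
  - move=> i hi; rewrite lef_pV2 ?posrE ?ltr0n ?ler_nat //; nlia.
  - case=> [|X'] hX; first by nlia.
    apply: h1; [nlia| | |nlia].
      by apply: (le_trans U1); rewrite ler_nat.
    apply: le_trans (cutoff_le t n); rewrite ler_nat; exact: leq_trans bN.
  rewrite mulrC ler_pdivrMr ?ltr0n //; apply: lemul2l; first exact: ltW.
  by rewrite ler_nat.
have l1 : 1 <= ln n%:R :> R by lra.
have main : cabs (\sum_(U.+1 <= m < N.+1) f m) <= (1 + 2 * ln n%:R) * (ep / 6).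
  case: (posnP N) => [->|N0].
    by rewrite big_geq // cabs0 mulr_ge0 // ?ltW //; lra.
  apply: (@le_trans _ _ ((trunc_log 2 N).+1%:R * (ep / 6))).
    apply: (dyadic_bound (ltW ep6) block) => //.
    apply: (leq_trans (ltnW (@trunc_log_ltn 2 N isT))).
    by rewrite leq_pmulr.
  apply: lemul2r; first exact: ltW.
  rewrite -natr1 addrC lerD2l; apply: (le_trans (trunc_log_le R N0)).
  by apply: lemul2l => //; apply: ln_nat_le.
have -> : \sum_(U.+1 <= p < N.+1) (wp R p)%:C%C * g p =
    \sum_(U.+1 <= m < N.+1) f m -
    \sum_(U.+1 <= m < N.+1) (vonM R m / m%:R - wp R m)%:C%C * g m.
  rewrite -sumrB; apply: eq_bigr => m _; rewrite /f rmorphB mulrBl.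
  by rewrite opprB addrCA subrr addr0.
apply: (le_trans (cabsB _ _)).
have rest : cabs (\sum_(U.+1 <= m < N.+1) (vonM R m / m%:R - wp R m)%:C%C * g m) <= 2.
  apply: (le_trans (cabs_sum _ _ _)); apply: le_trans (higher_prime_powers N).
  have UN : (U.+1 <= N.+1)%N by rewrite ltnS; exact: cutoff_mono.
  rewrite [leRHS](@big_cat_nat _ _ _ U.+1) // -[leLHS]add0r; apply: lerD.
    by apply: sumr_ge0.
  by apply: ler_sum => m _; rewrite cabsM cabs_real cabs_e mulr1.
apply: (le_trans (lerD main rest)).
have : 4 <= ep * (ln n%:R - 1) by rewrite mulrC -ler_pdivrMr //; lra.
nra.
Qed.

End WeightedPrimes.

(** * Fejer approximation of step functions *)

Section Fejer.
Variable R : realType.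
Local Notation C := R[i].

Definition dirichlet N (x : R) : C := \sum_(k < N) e (x * k%:R).

Definition fejer N (x : R) : R := cabs (dirichlet N x) ^+ 2 / N%:R.

Lemma fejer_ge0 N x : 0 <= fejer N x.
Proof. by rewrite divr_ge0 // exprn_ge0 // cabs_ge0. Qed.

Lemma dirichlet_geometric N (x : R) : (e x - 1) * dirichlet N x = e (x * N%:R) - 1.
Proof.
rewrite /dirichlet; elim: N => [|N IH].
  by rewrite big_ord0 mulr0 mulr0 e0 subrr.
rewrite big_ord_recr /= mulrDr IH -natr1 mulrDr mulr1 eD; ring.
Qed.

Lemma e_shift (x : R) (z : int) : e (x - z%:~R) = e x.
Proof. by rewrite -[LHS]mulr1 -(e_int R z) -eD subrK. Qed.

Lemma dirichlet_far N (x d : R) (z : int) : 0 < d -> d <= x - z%:~R <= 1 - d ->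
  dirichlet N x = (e (x * N%:R) - 1) * invE (x - z%:~R).
Proof.
move=> d0 hx; rewrite -dirichlet_geometric -(e_shift x z) mulrC mulrA.
rewrite [invE _ * _]mulrC invEP ?mul1r //.
by rewrite gt_eqF // (lt_le_trans d0) // sin_pi_far.
Qed.

Lemma fejer_far N (x d : R) (z : int) : 0 < d -> d <= x - z%:~R <= 1 - d ->
  fejer N x <= 4 / (N%:R * d ^+ 2).
Proof.
move=> d0 hx; rewrite /fejer (dirichlet_far N d0 hx).
have -> : 4 / (N%:R * d ^+ 2) = (2 / d) ^+ 2 / N%:R by rewrite expr_div_n invfM; ring.
apply: lemul2r; first by rewrite invr_ge0.
rewrite lerXn2r ?nnegrE ?cabs_ge0 //; first by rewrite divr_ge0 // ltW.
rewrite cabsM -[2 / d]/(2 * d^-1) -[d^-1]mul1r; apply: ler_pM; rewrite ?cabs_ge0 //.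
  by apply: (le_trans (cabsB _ _)); rewrite cabs_e cabs1.
exact: cabs_invE_le.
Qed.

Lemma roots_of_unity_sum N m : (0 < m < N)%N -> dirichlet N (m%:R / N%:R) = 0.
Proof.
move=> /andP[m0 mN]; have N0 : 0 < N%:R :> R by rewrite ltr0n; nlia.
have iN : 0 < N%:R^-1 :> R by rewrite invr_gt0.
rewrite (@dirichlet_far N _ N%:R^-1 0) //; last first.
  rewrite subr0; apply/andP; split; first by rewrite -[leLHS]mul1r ler_pM2r // ler1n.
  have -> : 1 - N%:R^-1 = (N%:R - 1) / N%:R :> R by field; rewrite gt_eqF.
  have mN' : m%:R + 1 <= N%:R :> R by rewrite natr1 ler_nat.
  by rewrite ler_pM2r //; lra.
by rewrite divfK ?gt_eqF // e_nat subrr mul0r.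
Qed.

Lemma e_conj_sum N (x : R) : \sum_(k < N) e (- x * k%:R) = conjc (dirichlet N x).
Proof. by rewrite rmorph_sum; apply: eq_bigr => k _; rewrite mulNr eN. Qed.

Lemma fejer_expand N (x : R) : (fejer N x)%:C%C =
  (N%:R^-1)%:C%C * \sum_(k < N) \sum_(l < N) e ((k%:R - l%:R) * x).
Proof.
rewrite /fejer mulrC rmorphM /= -mul_conj /dirichlet rmorph_sum big_distrlr.
congr (_ * _); apply: eq_bigr => k _; apply: eq_bigr => l _.
change (e (x * k%:R) * conjc (e (x * l%:R)) = e ((k%:R - l%:R) * x)).
by rewrite -eN -eD; congr e; ring.
Qed.

Lemma sum_e_root N (k l : 'I_N) :
  \sum_(r < N) e (- ((k%:R - l%:R) * (r%:R / N%:R)) : R) = (k == l)%:R * (N%:R)%:C%C.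
Proof.
have N0 : 0 < N%:R :> R by rewrite ltr0n; have := ltn_ord k; nlia.
case: eqP => [->|kl].
  rewrite (eq_bigr (fun=> 1)) => [|r _]; last by rewrite subrr mul0r oppr0 e0.
  by rewrite sumr_const card_ord mul1r rmorph_nat.
rewrite mul0r; case: (ltngtP k l) => h; last by exfalso; apply: kl; exact: val_inj.
  rewrite -[RHS](@roots_of_unity_sum N (l - k)); last by have := ltn_ord l; nlia.
  apply: eq_bigr => r _; congr e; rewrite natrB ?(ltnW h) //; field; by rewrite gt_eqF.
have kN : (0 < k - l < N)%N by have := ltn_ord k; nlia.
have := congr1 (@conjc R) (roots_of_unity_sum kN).
rewrite conjc0 -e_conj_sum => E; rewrite -[RHS]E.
apply: eq_bigr => r _; congr e; rewrite natrB ?(ltnW h) //.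
by field; rewrite gt_eqF.
Qed.

(** Over the translates of a point by the multiples of [1 / N] the Fejer kernel
    has mean value [1], by orthogonality of the additive characters. *)
Lemma sum_fejer N (x : R) : (0 < N)%N ->
  \sum_(r < N) fejer N (x - r%:R / N%:R) = N%:R.
Proof.
move=> N0; have Np : N%:R != 0 :> R by rewrite pnatr_eq0 -lt0n.
suff E : (\sum_(r < N) fejer N (x - r%:R / N%:R))%:C%C = (N%:R)%:C%C :> C.
  by move: E => [].
rewrite rmorph_sum /=.
rewrite (eq_bigr (fun r : 'I_N => (N%:R^-1)%:C%C * \sum_(k < N) \sum_(l < N)
   e ((k%:R - l%:R) * x) * e (- ((k%:R - l%:R) * (r%:R / N%:R))))) => [|r _]; last first.
  rewrite fejer_expand; congr (_ * _); apply: eq_bigr => k _; apply: eq_bigr => l _.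
  by rewrite -eD; congr e; ring.
rewrite -big_distrr /= exchange_big /=.
rewrite (eq_bigr (fun=> (N%:R)%:C%C)) => [|k _]; last first.
  rewrite exchange_big (bigD1 k) //= -big_distrr /= sum_e_root eqxx subrr mul0r e0 !mul1r.
  rewrite big1 ?addr0 // => l lk; rewrite -big_distrr /= sum_e_root eq_sym (negbTE lk).
  by rewrite mul0r mulr0.
have E : N%:R = (N%:R)%:C%C :> C by rewrite rmorph_nat.
rewrite sumr_const card_ord -[X in _ * X]mulr_natl E mulrA -rmorphM mulVf //.
by rewrite rmorph1 mul1r.
Qed.

Lemma sum_divn (V : nmodType) (f : nat -> V) h M :
  \sum_(0 <= r < h * M) f (r %/ M)%N = (\sum_(0 <= i < h) f i) *+ M.
Proof.
case: (posnP M) => [->|M0]; first by rewrite muln0 big_geq.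
elim: h => [|h IH]; first by rewrite mul0n !big_geq // mul0rn.
rewrite big_nat_recr //= mulrnDl -IH (@big_cat_nat _ _ _ (h * M)) //=; last by nlia.
congr (_ + _); rewrite (@eq_big_nat _ _ _ _ _ _ (fun=> f h)) => [|r hr].
  by rewrite sumr_const_nat mulSn addnK.
congr f; have -> : r = (h * M + (r - h * M))%N by nlia.
by rewrite divnMDl // divn_small ?addn0 //; rewrite mulSn in hr; nlia.
Qed.

(** Fejer approximation of the step function [y |-> w ^ (floor y)], of period
    [h]. The step function is averaged against a Fejer kernel over the points
    [r / N], where [N = h * M], so that [r %/ M] is the step of [r]; the
    kernel is concentrated near the integers, so only the neighbourhoods of
    the jumps are spoiled. The coefficients on the diagonal, that is the mean
    value, vanish because [w] is a nontrivial [h]-th root of unity. *)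
Lemma step_approx h a (d ep : R) : (0 < a < h)%N -> 0 < d <= 1 / 2 -> 0 < ep ->
  exists N (c : 'I_N -> 'I_N -> C), [/\ forall k l, cabs (c k l) <= 1,
    forall k, c k k = 0 &
    forall y : R,
      cabs (\sum_(k < N) \sum_(l < N) c k l * e ((k%:R - l%:R) * (y / h%:R))) <= 1 /\
      forall q : nat, q%:R + d <= y <= q%:R + 1 - d ->
      cabs (e (a%:R / h%:R) ^+ q -
        \sum_(k < N) \sum_(l < N) c k l * e ((k%:R - l%:R) * (y / h%:R))) <= ep].
Proof.
move=> ah /andP[d0 d2] ep0; have h0 : (0 < h)%N by nlia.
have hR : 0 < h%:R :> R by rewrite ltr0n.
set w := e (a%:R / h%:R) : C.
have w1 k : cabs (w ^+ k) = 1 by rewrite cabsX cabs_e expr1n.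
have wh : w ^+ h = 1 by rewrite -eMn -[X in e X]mulr_natr divfK ?gt_eqF // e_nat.
pose M := (Num.trunc (8 * h%:R ^+ 2 / (d ^+ 2 * ep))).+1.
have hM : 8 * h%:R ^+ 2 / (d ^+ 2 * ep) <= M%:R by exact: ltW (truncnS_gt _).
have M0 : (0 < M)%N by [].
move: M hM M0 => M hM M0; set N := (h * M)%N.
have N0 : (0 < N)%N by rewrite muln_gt0 h0.
have NR : 0 < N%:R :> R by rewrite ltr0n.
have NE : N%:R = h%:R * M%:R :> R by rewrite natrM.
have MR : 0 < M%:R :> R by rewrite ltr0n.
pose c (k l : 'I_N) : C := ((N%:R^-1) ^+ 2)%:C%C *
  \sum_(r < N) w ^+ (r %/ M) * e (- ((k%:R - l%:R) * (r%:R / N%:R))).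
have TE y : \sum_(k < N) \sum_(l < N) c k l * e ((k%:R - l%:R) * (y / h%:R)) =
   (N%:R^-1)%:C%C * \sum_(r < N) w ^+ (r %/ M) * (fejer N (y / h%:R - r%:R / N%:R))%:C%C.
  rewrite big_distrr /=.
  rewrite [RHS](eq_bigr (fun r : 'I_N => \sum_(k < N) \sum_(l < N)
     ((N%:R^-1) ^+ 2)%:C%C * (w ^+ (r %/ M) * e (- ((k%:R - l%:R) * (r%:R / N%:R)))) *
      e ((k%:R - l%:R) * (y / h%:R)))) => [|r _]; last first.
    rewrite fejer_expand !big_distrr /=; apply: eq_bigr => k _.
    rewrite !big_distrr /=; apply: eq_bigr => l _.
    rewrite mulrBr addrC eD rmorphXn; ring.
  rewrite [RHS]exchange_big /=; apply: eq_bigr => k _.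
  rewrite [RHS]exchange_big /=; apply: eq_bigr => l _.
  by rewrite /c big_distrr big_distrl.
have N2 : cabs ((N%:R^-1)%:C%C : C) = N%:R^-1 by rewrite cabs_real ger0_norm // invr_ge0 ltW.
exists N, c; split.
- move=> k l; rewrite /c cabsM cabs_real ger0_norm ?sqr_ge0 //.
  apply: (@le_trans _ _ ((N%:R^-1) ^+ 2 * N%:R)).
    apply: lemul2l; first exact: sqr_ge0.
    apply: (le_trans (cabs_sum _ _ _)).
    rewrite (eq_bigr (fun=> 1)) => [|r _]; last by rewrite cabsM w1 cabs_e mulr1.
    by rewrite sumr_const card_ord.
  by rewrite expr2 -mulrA mulVf ?gt_eqF // mulr1 invf_le1 // ler1n.
- move=> k; rewrite /c (eq_bigr (fun r : 'I_N => w ^+ (r %/ M))) => [|r _]; last first.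
    by rewrite subrr mul0r oppr0 e0 mulr1.
  rewrite -(big_mkord predT (fun r => w ^+ (r %/ M))) /N sum_divn.
  rewrite big_mkord (_ : \sum_(i < h) w ^+ i = 0) ?mul0rn ?mulr0 //.
  rewrite -[RHS](roots_of_unity_sum ah); apply: eq_bigr => i _.
  by rewrite /w -eMn; congr e; rewrite mulr_natr.
move=> y; rewrite TE; split.
  rewrite cabsM N2 mulrC ler_pdivrMr // mul1r.
  apply: (le_trans (cabs_sum _ _ _)).
  apply: (@le_trans _ _ (\sum_(r < N) fejer N (y / h%:R - r%:R / N%:R))); last first.
    by rewrite sum_fejer.
  by apply: ler_sum => r _; rewrite cabsM w1 mul1r cabs_real ger0_norm ?fejer_ge0.
move=> q hq.
have -> : w ^+ q - (N%:R^-1)%:C%C * \sum_(r < N) w ^+ (r %/ M) * (fejer N (y / h%:R - r%:R / N%:R))%:C%C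
  = (N%:R^-1)%:C%C * \sum_(r < N) (w ^+ q - w ^+ (r %/ M)) * (fejer N (y / h%:R - r%:R / N%:R))%:C%C.
  have E : w ^+ q = (N%:R^-1)%:C%C * \sum_(r < N) w ^+ q * (fejer N (y / h%:R - r%:R / N%:R))%:C%C.
    rewrite -big_distrr -rmorph_sum /= sum_fejer // mulrCA -rmorphM.
    by rewrite mulVf ?gt_eqF // rmorph1 mulr1.
  by rewrite {1}E -mulrBr -sumrB; congr (_ * _); apply: eq_bigr => r _; rewrite mulrBl.
rewrite cabsM N2; pose dd := d / h%:R; have dd0 : 0 < dd by exact: divr_gt0.
apply: (@le_trans _ _ (N%:R^-1 * \sum_(r < N) 2 * (4 / (N%:R * dd ^+ 2)))); last first.
  rewrite sumr_const card_ord -[X in _ * X]mulr_natl mulrA mulVf ?gt_eqF // mul1r.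
  rewrite /dd NE.
  have -> : 2 * (4 / (h%:R * M%:R * (d / h%:R) ^+ 2)) = (8 * h%:R / d ^+ 2) / M%:R.
    by field; rewrite !gt_eqF.
  rewrite ler_pdivrMr //; move: hM; rewrite ler_pdivrMr ?mulr_gt0 ?exprn_gt0 // => hM.
  rewrite ler_pdivrMr ?exprn_gt0 //.
  have -> : ep * M%:R * d ^+ 2 = M%:R * (d ^+ 2 * ep) by ring.
  apply: le_trans hM; apply: lemul2l => //.
  by rewrite -[leLHS]expr1 ler_weXn2l // ler1n.
apply: lemul2l; first by rewrite invr_ge0 ltW.
apply: (le_trans (cabs_sum _ _ _)); apply: ler_sum => r _.
rewrite cabsM cabs_real ger0_norm ?fejer_ge0 //.
have rh : (r %/ M < h)%N by rewrite ltn_divLR // -/N ltn_ord.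
(* The number of steps, modulo [h], from the step of [r] to that of [y]. When
   it is zero the step function takes the same value at both; otherwise the
   kernel is small. *)
set i := ((q + (h - r %/ M)) %% h)%N.
case: (posnP i) => i0.
  have -> : w ^+ q = w ^+ (r %/ M).
    rewrite -(expr_mod q wh) -(expr_mod (r %/ M) wh); congr (_ ^+ _).
    apply/eqP; rewrite -(eqn_modDr (h - r %/ M)) subnKC ?(ltnW rh) // modnn.
    by rewrite -/i i0.
  by rewrite subrr cabs0 mul0r mulr_ge0 // divr_ge0 // mulr_ge0 // exprn_ge0 // ltW.
apply: ler_pM; rewrite ?cabs_ge0 ?fejer_ge0 //.
  by apply: (le_trans (cabsB _ _)); rewrite !w1.
have ih : (i < h)%N by rewrite ltn_mod.
pose Q := ((q + (h - r %/ M)) %/ h)%N.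
have QE : (Q * h + i)%N%:R = (q + (h - r %/ M))%N%:R :> R by rewrite -divn_eq.
apply: (@fejer_far N _ dd (Q%:Z - 1)) => //.
have rE : (r %/ M * M + r %% M)%N%:R = r%:R :> R by rewrite -divn_eq.
have mM : (r %% M)%N%:R + 1 <= M%:R :> R by rewrite natr1 ler_nat ltn_mod.
have m0 : 0 <= (r %% M)%N%:R :> R by [].
rewrite !natrD !natrM natrB ?(ltnW rh) // in QE rE.
have -> : y / h%:R - r%:R / N%:R - (Q%:Z - 1)%:~R =
    (y - r%:R / M%:R - (Q%:R - 1) * h%:R) / h%:R.
  rewrite intrB -pmulrn NE; field; by rewrite !gt_eqF.
have -> : 1 - dd = (h%:R - d) / h%:R by rewrite /dd; field; rewrite gt_eqF.
have rM : r%:R / M%:R = (r %/ M)%N%:R + (r %% M)%N%:R / M%:R :> R.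
  by rewrite -rE; field; rewrite gt_eqF.
have f0 : 0 <= (r %% M)%N%:R / M%:R :> R by rewrite divr_ge0.
have f1 : (r %% M)%N%:R / M%:R <= 1 :> R by rewrite ler_pdivrMr //; lra.
have i1 : 1 <= i%:R :> R by rewrite ler1n.
have ihr : i%:R + 1 <= h%:R :> R by rewrite natr1 ler_nat.
rewrite /dd !ler_pM2r ?invr_gt0 // rM.
clear -QE hq f0 f1 i1 ihr; apply/andP; split; lra.
Qed.

(** So close to an integer, every term of the Dirichlet sum has real part at
    least [1 / 2]. The Fejer kernel thus majorizes the indicator function of
    these points, and its mean value bounds their frequency. *)
Lemma near_majorant N (y : R) (q : int) : (0 < N)%N -> `|y - q%:~R| <= 1 / (8 * N%:R) ->
  1 <= 4 / N%:R * fejer N y.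
Proof.
move=> N0 hy; have NR : 0 < N%:R :> R by rewrite ltr0n.
suff h : N%:R / 2 <= cabs (dirichlet N y).
  have h2 : (N%:R / 2) ^+ 2 <= cabs (dirichlet N y) ^+ 2.
    by rewrite lerXn2r ?nnegrE ?cabs_ge0 // divr_ge0.
  apply: (@le_trans _ _ (4 / N%:R * ((N%:R / 2) ^+ 2 / N%:R))).
    by rewrite le_eqVlt; apply/orP; left; apply/eqP; field; rewrite gt_eqF.
  apply: lemul2l; first by rewrite divr_ge0.
  by apply: lemul2r => //; rewrite invr_ge0 ltW.
apply: le_trans (Re_le_cabs _); rewrite /dirichlet raddf_sum /=.
have -> : N%:R / 2 = \sum_(k < N) (1 / 2) :> R.
  by rewrite sumr_const card_ord -mulr_natr; ring.
apply: ler_sum => k _.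
have -> : cos (2 * pi * (y * k%:R)) = cos (2 * pi * ((y - q%:~R) * k%:R)).
  have := e_shift (y * k%:R) (q * k%:Z); rewrite /e => -[<- _].
  by congr cos; rewrite intrM -pmulrn; ring.
have p0 := @pi_gt0 R.
rewrite -cos_norm; apply: (le_trans (cos_pi4_ge R)).
have small : `|2 * pi * ((y - q%:~R) * k%:R)| <= pi / 4.
  rewrite normrM [`|2 * pi|]ger0_norm; last by rewrite mulr_ge0 // ltW.
  rewrite normrM [`|k%:R|]ger0_norm //.
  have kN : k%:R <= N%:R :> R by rewrite ler_nat ltnW.
  have : `|y - q%:~R| * k%:R <= 1 / (8 * N%:R) * N%:R by apply: ler_pM.
  have -> : 1 / (8 * N%:R) * N%:R = 1 / 8 :> R by field; rewrite gt_eqF.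
  by move=> h; nra.
have n0 := normr_ge0 (2 * pi * ((y - q%:~R) * k%:R)).
move: small n0; set z := `|_| => small n0.
rewrite le_eqVlt; case: (eqVneq z (pi / 4)) => [->|nz]; first by rewrite eqxx.
apply/orP; right; rewrite ltr_cos ?in_itv /=; last 2 first.
- by lra.
- by lra.
by rewrite lt_neqAle nz.
Qed.

End Fejer.

(** * Ranges of primes between powers of n *)

Section Equidistribution.
Variable R : realType.
Local Notation C := R[i].

Lemma eventually_fin (I : finType) (P : I -> nat -> Prop) :
  (forall i, exists n0, forall n, (n0 <= n)%N -> P i n) ->
  exists n0, forall n, (n0 <= n)%N -> forall i, P i n.
Proof.
move=> /boolp.choice[f hf]; exists (\sum_i f i)%N => n hn i.
by apply: hf; apply: leq_trans hn; rewrite (bigD1 i) //= leq_addr.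
Qed.

Lemma prod_diff_le I (r : seq I) (a b : I -> C) :
  (forall i, cabs (a i) <= 1) -> (forall i, cabs (b i) <= 1) ->
  cabs (\prod_(i <- r) a i - \prod_(i <- r) b i) <= \sum_(i <- r) cabs (a i - b i).
Proof.
move=> ha hb; elim: r => [|x r IH]; first by rewrite !big_nil subrr cabs0.
rewrite !big_cons.
have -> : a x * \prod_(j <- r) a j - b x * \prod_(j <- r) b j =
  (a x - b x) * \prod_(j <- r) a j + b x * (\prod_(j <- r) a j - \prod_(j <- r) b j) by ring.
apply: (le_trans (cabsD _ _)); rewrite !cabsM; apply: lerD.
  rewrite -[leRHS]mulr1; apply: lemul2l; first exact: cabs_ge0.
  have : 0 <= \prod_(i <- r) cabs (a i) <= 1; last by rewrite cabs_prod => /andP[].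
  elim/big_ind: _ => [|u v /andP[u0 u1] /andP[v0 v1]|i _]; first by rewrite ler01 lexx.
    by rewrite mulr_ge0 // mulr_ile1.
  by rewrite cabs_ge0 ha.
apply: (le_trans _ IH); rewrite -[leRHS]mul1r; apply: lemul2r => //; exact: cabs_ge0.
Qed.

(** The difference of two instances of Mertens' theorem; rounding the powers
    of [n] changes their logarithms by at most [ln 2]. *)
Lemma mertens_range (s t : R) n : 0 <= s -> s <= t -> (0 < n)%N ->
  `|\sum_((cutoff s n).+1 <= p < (cutoff t n).+1) wp R p - (t - s) * ln n%:R| <= 14.
Proof.
move=> s0 st n0; have nr : 1 <= n%:R :> R by rewrite ler1n.
have cutE u : 0 <= u -> (0 < cutoff u n)%N /\ `|ln (cutoff u n)%:R - u * ln n%:R| <= 1 :> R.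
  move=> u0; have p1 : 1 <= n%:R `^ u by have := powR_le_exp nr u0; rewrite powRr0.
  have c0 : (0 < cutoff u n)%N by rewrite truncn_gt0.
  have c1 : 1 <= (cutoff u n)%:R :> R by rewrite ler1n.
  have h1 := cutoff_le u n; have h2 := truncnS_gt (n%:R `^ u).
  rewrite -/(cutoff u n) -natr1 in h2.
  split=> //; rewrite -ln_powR -ln_div ?posrE //; [|by lra|by rewrite powR_gt0 //; lra].
  have pp : 0 < n%:R `^ u by lra.
  rewrite -normrN -lnV ?posrE ?divr_gt0 //; last by lra.
  rewrite invf_div ger0_norm; last by rewrite ln_ge0 // ler_pdivlMr ?mul1r //; lra.
  apply: le_trans (ln2_le1 R); rewrite ler_ln ?posrE ?divr_gt0 //; last by lra.
  by rewrite ler_pdivrMr; lra.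
have t0 : 0 <= t by lra.
have [cs hs] := cutE s s0; have [ct ht] := cutE t t0.
have ms := mertens R cs; have mt := mertens R ct.
have cc : (cutoff s n <= cutoff t n)%N by exact: cutoff_mono.
have -> : \sum_((cutoff s n).+1 <= p < (cutoff t n).+1) wp R p =
   \sum_(0 <= p < (cutoff t n).+1) wp R p - \sum_(0 <= p < (cutoff s n).+1) wp R p.
  by rewrite [X in _ = X - _](@big_cat_nat _ _ _ (cutoff s n).+1) // addrAC subrr add0r.
move: hs ht ms mt; rewrite !ler_norml.
move: (\sum_(0 <= _ < _) _) (\sum_(0 <= _ < _) _) => A B; lra.
Qed.

Lemma logn_fact_short p n J : prime p -> (J <= n)%N -> (n < p ^ J.+1)%N ->
  logn p n`! = (\sum_(i < J) n %/ p ^ i.+1)%N.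
Proof.
move=> pp Jn nJ; rewrite logn_fact //.
rewrite (@big_cat_nat _ _ _ J.+1) //= big_add1 big_mkord.
rewrite [X in (_ + X)%N]big_nat_cond [X in (_ + X)%N]big1 ?addn0 // => k hk.
rewrite divn_small // (leq_trans nJ) // leq_exp2l ?prime_gt1 //; nlia.
Qed.

(** Only the diagonal of the Fejer kernel contributes, by Mertens' theorem;
    the other frequencies are covered by [wp_phase_small]. *)
Lemma fejer_average_small N0 j J (s t : R) : (0 < N0)%N -> (0 < j <= J)%N ->
  0 < s -> s <= t -> t * J%:R < 1 ->
  exists n0, forall n, (n0 <= n)%N ->
    \sum_((cutoff s n).+1 <= p < (cutoff t n).+1) wp R p * fejer N0 (n%:R / p%:R ^+ j) <=
    3 * ln n%:R.
Proof.
move=> N00 /andP[j0 jJ] s0 st tJ; have NR : 0 < N0%:R :> R by rewrite ltr0n.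
have tj : t * j%:R < 1.
  apply: le_lt_trans tJ; apply: lemul2l; first by lra.
  by rewrite ler_nat.
have jj : (0 < j <= j)%N by rewrite j0 leqnn.
have ep0 : 0 < N0%:R^-1 :> R by rewrite invr_gt0.
have [n1 h1] : exists n0, forall n, (n0 <= n)%N -> forall kl : 'I_N0 * 'I_N0,
    kl.1 != kl.2 -> cabs (\sum_((cutoff s n).+1 <= p < (cutoff t n).+1)
      (wp R p)%:C%C * e (phase j j (fun=> (kl.1%:R - kl.2%:R) * n%:R) p)) <=
      N0%:R^-1 * ln n%:R.
  apply: (@eventually_fin ('I_N0 * 'I_N0)%type (fun kl n => kl.1 != kl.2 ->
    cabs (\sum_((cutoff s n).+1 <= p < (cutoff t n).+1)
      (wp R p)%:C%C * e (phase j j (fun=> (kl.1%:R - kl.2%:R) * n%:R) p)) <=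
      N0%:R^-1 * ln n%:R)) => -[k l] /=.
  case: (eqVneq k l) => kl; first by exists 0%N.
  have kl' : (k%:R - l%:R : R) != 0 by rewrite subr_eq0 eqr_nat.
  have [n0 hn0] := @wp_phase_small R j j (fun=> k%:R - l%:R) s t N0%:R^-1 jj kl' s0 st tj ep0.
  by exists n0 => n hn _; exact: hn0.
have [n2 h2] := ln_nat_large (14 : R).
exists (n1 + n2).+1 => n hn; have {}h1 := h1 n ltac:(nlia).
have {}h2 := h2 n ltac:(nlia); have n0 : (0 < n)%N by nlia.
have := mertens_range (ltW s0) st n0; set S := \sum_(_ <= _ < _) wp R _ => mer.
have t1 : t <= 1.
  rewrite leNgt; apply/negP => t1; have : 1 <= j%:R :> R by rewrite ler1n.
  by nra.
have S2 : S <= 2 * ln n%:R.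
  move: mer; rewrite ler_norml => /andP[_ mer].
  have : (t - s) * ln n%:R <= 1 * ln n%:R by apply: lemul2r; lra.
  by lra.
have S0 : 0 <= S by apply: sumr_ge0 => p _; exact: wp_ge0.
set T := \sum_(_ <= _ < _) _.
have T0 : 0 <= T by apply: sumr_ge0 => p _; rewrite mulr_ge0 ?wp_ge0 ?fejer_ge0.
suff : cabs (T%:C%C) <= 3 * ln n%:R by rewrite cabs_real ger0_norm.
have -> : T%:C%C = (N0%:R^-1)%:C%C * \sum_(k < N0) \sum_(l < N0)
    \sum_((cutoff s n).+1 <= p < (cutoff t n).+1)
      (wp R p)%:C%C * e (phase j j (fun=> (k%:R - l%:R) * n%:R) p).
  rewrite [in RHS](eq_bigr (fun k : 'I_N0 => \sum_((cutoff s n).+1 <= p < (cutoff t n).+1)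
     \sum_(l < N0) (wp R p)%:C%C * e (phase j j (fun=> (k%:R - l%:R) * n%:R) p))) => [|k _]; last exact: exchange_big.
  rewrite exchange_big big_distrr /T rmorph_sum; apply: eq_bigr => p _.
  rewrite [LHS](_ : _ = (wp R p)%:C%C * (fejer N0 (n%:R / p%:R ^+ j))%:C%C);
    last exact: rmorphM.
  rewrite fejer_expand mulrCA; congr (_ * _).
  rewrite big_distrr /=; apply: eq_bigr => k _; rewrite big_distrr /=.
  apply: eq_bigr => l _; rewrite /phase big_nat1; congr (_ * e _); ring.
rewrite cabsM cabs_real ger0_norm; last by rewrite invr_ge0 ltW.
rewrite mulrC ler_pdivrMr //.
apply: (le_trans (cabs_sum _ _ _)).
apply: (@le_trans _ _ (\sum_(k < N0) 3 * ln n%:R)); last first.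
  by rewrite sumr_const card_ord -[leLHS]mulr_natr.
apply: ler_sum => k _; apply: (le_trans (cabs_sum _ _ _)).
rewrite (bigD1 k) //=.
have diag : cabs (\sum_((cutoff s n).+1 <= p < (cutoff t n).+1)
      (wp R p)%:C%C * e (phase j j (fun=> (k%:R - k%:R) * n%:R) p)) <= 2 * ln n%:R.
  apply: le_trans S2; apply: (le_trans (cabs_sum _ _ _)); apply: ler_sum => p _.
  by rewrite cabsM cabs_real cabs_e mulr1 ger0_norm // wp_ge0.
have off : \sum_(l < N0 | l != k) cabs (\sum_((cutoff s n).+1 <= p < (cutoff t n).+1)
      (wp R p)%:C%C * e (phase j j (fun=> (k%:R - l%:R) * n%:R) p)) <= ln n%:R.
  apply: (@le_trans _ _ (\sum_(l < N0 | l != k) N0%:R^-1 * ln n%:R)).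
    by apply: ler_sum => l lk; apply: (h1 (k, l)); rewrite eq_sym.
  have l0 : 0 <= N0%:R^-1 * ln n%:R :> R by rewrite mulr_ge0 ?ln_nat_ge0 // invr_ge0 ltW.
  apply: (@le_trans _ _ (\sum_(l < N0) N0%:R^-1 * ln n%:R)).
    rewrite [leRHS](bigD1 k) //= lerDr //.
  by rewrite sumr_const card_ord -[leLHS]mulr_natr mulrC mulrA mulfV ?mul1r // gt_eqF.
apply: (le_trans (lerD diag off)); lra.
Qed.

Variables (h a : nat).
Hypothesis ah : (0 < a < h)%N.

Let w : C := e (a%:R / h%:R).

Definition twisted (s t : R) n : C :=
  \sum_((cutoff s n).+1 <= p < (cutoff t n).+1) (wp R p)%:C%C * w ^+ logn p n`!.

(** Negligible in comparison with Mertens' sum, which has size [ln n]. *)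
Definition small (s t : R) := forall ep, 0 < ep ->
  exists n0, forall n, (n0 <= n)%N -> cabs (twisted s t n) <= ep * ln n%:R.

End Equidistribution.

(** * Ranges avoiding the exponents 1/j *)

Section GenericRange.
Variable R : realType.
Local Notation C := R[i].
Variables (h a : nat).
Hypothesis ah : (0 < a < h)%N.

Let w : C := e (a%:R / h%:R).

(** Far from the integers the approximation is good; the close points are paid
    for by the Fejer majorant. *)
Lemma step_error N0 N (c : 'I_N -> 'I_N -> C) (ep : R) (n m : nat) :
  (0 < N0)%N -> (0 < m)%N -> 0 <= ep ->
  (forall y : R,
      cabs (\sum_(k < N) \sum_(l < N) c k l * e ((k%:R - l%:R) * (y / h%:R))) <= 1 /\
      forall q : nat, q%:R + 1 / (8 * N0%:R) <= y <= q%:R + 1 - 1 / (8 * N0%:R) ->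
      cabs (w ^+ q -
        \sum_(k < N) \sum_(l < N) c k l * e ((k%:R - l%:R) * (y / h%:R))) <= ep) ->
  cabs (w ^+ (n %/ m) -
     \sum_(k < N) \sum_(l < N) c k l * e ((k%:R - l%:R) * (n%:R / m%:R / h%:R))) <=
  ep + 8 / N0%:R * fejer N0 (n%:R / m%:R).
Proof.
move=> N00 m0 ep0 hT; set y : R := n%:R / m%:R; set q := (n %/ m)%N.
have [T1 T2] := hT y.
have mR : 0 < m%:R :> R by rewrite ltr0n.
have NR : 0 < N0%:R :> R by rewrite ltr0n.
have q1 : q%:R <= y by rewrite ler_pdivlMr // -natrM ler_nat leq_trunc_div.
have q2 : y < q%:R + 1 by rewrite ltr_pdivrMr // natr1 -natrM ltr_nat ltn_ceil.
set d := 1 / (8 * N0%:R) in T2.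
have fj : 0 <= 8 / N0%:R * fejer N0 y.
  by apply: mulr_ge0; [rewrite divr_ge0|exact: fejer_ge0].
case: (boolP (q%:R + d <= y <= q%:R + 1 - d)) => [hq|far].
  by apply: (le_trans (T2 q hq)); rewrite lerDl.
have near : 1 <= 4 / N0%:R * fejer N0 y.
  move: far; rewrite negb_and -!ltNge => /orP[far|far].
    apply: (@near_majorant R N0 y q) => //.
    by rewrite -pmulrn ger0_norm ?subr_ge0 // -/d; lra.
  apply: (@near_majorant R N0 y (q%:Z + 1)) => //.
  by rewrite intrD -pmulrn distrC ger0_norm -/d; lra.
apply: (@le_trans _ _ 2).
  apply: (le_trans (cabsB _ _)); rewrite cabsX cabs_e expr1n; lra.
have -> : 8 / N0%:R * fejer N0 y = 2 * (4 / N0%:R * fejer N0 y) by ring.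
lra.
Qed.

(** On this range [logn p n`!] is the sum of [n %/ p ^ j] over
    [1 <= j <= J + 1], so the twist is a product of [J + 1] step functions.
    Expanding their Fejer approximations gives phases that are polynomials in
    [1 / p]; the step function of [n / p] has mean value zero, so the
    coefficient of degree one is never zero and [wp_phase_small] applies to
    all of them. *)
Lemma generic_range_small J (s t : R) : 1 < s * J.+2%:R -> s <= t -> t * J.+1%:R < 1 ->
  small h a s t.
Proof.
move=> sJ st tJ ep ep0.
have h0 : (0 < h)%N by nlia.
have s0 : 0 < s.
  rewrite ltNge; apply/negP => s0; have : 0 <= J.+2%:R :> R by [].
  by nra.
have JR : 0 < J.+1%:R :> R by rewrite ltr0n.
(* [N0] and [ep1] are such that the points close to a jump and the error of
   approximation each cost [ep / 4]. *)
pose N0 := (Num.trunc (96 * J.+1%:R / ep)).+1.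
have hN0 : 96 * J.+1%:R / ep <= N0%:R by exact: ltW (truncnS_gt _).
have N00 : (0 < N0)%N by [].
move: N0 hN0 N00 => N0 hN0 N00.
have NR : 1 <= N0%:R :> R by rewrite ler1n.
pose d : R := 1 / (8 * N0%:R).
have d0 : 0 < d <= 1 / 2.
  have NP : 0 < 8 * N0%:R :> R by lra.
  by rewrite divr_gt0 //= ler_pdivrMr //; lra.
pose ep1 := ep / (8 * J.+1%:R).
have ep10 : 0 < ep1 by rewrite divr_gt0 // mulr_gt0.
have [N [c [c1 c0 cT]]] := @step_approx R h a d ep1 ah d0 ep10.
pose T (y : R) : C := \sum_(k < N) \sum_(l < N) c k l * e ((k%:R - l%:R) * (y / h%:R)).
(* [f : FT] chooses one frequency in each factor, and [al f i] is the
   resulting coefficient of [n / p ^ i]; the factors are numbered from [0]. *)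
pose FT : finType := {ffun 'I_J.+1 -> 'I_N * 'I_N}%type.
pose al (f : FT) (i : nat) : R := ((f (inord i.-1)).1%:R - (f (inord i.-1)).2%:R) / h%:R.
pose ep3 := ep / (2 * (#|FT|.+1)%:R).
have cardp : 0 < (#|FT|.+1)%:R :> R by rewrite ltr0n.
have ep30 : 0 < ep3 by rewrite divr_gt0 // mulr_gt0.
have [n1 h1] : exists n0, forall n, (n0 <= n)%N -> forall f : FT,
    (f ord0).1 != (f ord0).2 ->
    cabs (\sum_((cutoff s n).+1 <= p < (cutoff t n).+1)
      (wp R p)%:C%C * e (phase 1 J.+1 (fun j => al f j * n%:R) p)) <= ep3 * ln n%:R.
  apply: (@eventually_fin FT (fun f n => (f ord0).1 != (f ord0).2 ->
    cabs (\sum_((cutoff s n).+1 <= p < (cutoff t n).+1)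
      (wp R p)%:C%C * e (phase 1 J.+1 (fun j => al f j * n%:R) p)) <= ep3 * ln n%:R)) => f.
  case: (eqVneq (f ord0).1 (f ord0).2) => hf; first by exists 0%N.
  have al0 : al f 1%N != 0.
    rewrite /al /= (_ : inord 0 = ord0); last by apply: val_inj; rewrite /= inordK.
    rewrite mulf_neq0 ?invr_eq0 ?pnatr_eq0 -?lt0n //.
    by rewrite subr_eq0 eqr_nat.
  have t1 : t * 1%:R < 1.
    apply: le_lt_trans tJ; apply: lemul2l; first by lra.
    by rewrite ler1n.
  have [n0 hn0] := @wp_phase_small R 1 J.+1 (al f) s t ep3 isT al0 s0 st t1 ep30.
  by exists n0 => n hn _; exact: hn0.
have [n2 h2] : exists n0, forall n, (n0 <= n)%N -> forall j : 'I_J.+1,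
    \sum_((cutoff s n).+1 <= p < (cutoff t n).+1) wp R p * fejer N0 (n%:R / p%:R ^+ j.+1) <=
    3 * ln n%:R.
  apply: (@eventually_fin 'I_J.+1 (fun j n =>
    \sum_((cutoff s n).+1 <= p < (cutoff t n).+1)
      wp R p * fejer N0 (n%:R / p%:R ^+ j.+1) <= 3 * ln n%:R)) => j.
  have jJ : (0 < j.+1 <= J.+1)%N by have := ltn_ord j; nlia.
  exact: (fejer_average_small N00 jJ s0 st tJ).
have [n3 h3] := ln_nat_large (14 : R).
exists (n1 + n2 + n3 + J).+2 => n hn.
have {}h1 := h1 n ltac:(nlia); have {}h2 := h2 n ltac:(nlia).
have {}h3 := h3 n ltac:(nlia); have n0 : (0 < n)%N by nlia.
have nr : 1 <= n%:R :> R by rewrite ler1n.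
have t1 : t <= 1.
  rewrite leNgt; apply/negP => t1; have : 1 <= J.+1%:R :> R by rewrite ler1n.
  by nra.
have := mertens_range (ltW s0) st n0; set S := \sum_(_ <= _ < _) wp R _ => mer.
have S2 : S <= 2 * ln n%:R.
  move: mer; rewrite ler_norml => /andP[_ mer].
  have : (t - s) * ln n%:R <= 1 * ln n%:R by apply: lemul2r; lra.
  by lra.
pose U p : C := \prod_(j < J.+1) w ^+ (n %/ p ^ j.+1).
pose V p : C := \prod_(j < J.+1) T (n%:R / p%:R ^+ j.+1).
have -> : twisted h a s t n =
    \sum_((cutoff s n).+1 <= p < (cutoff t n).+1) (wp R p)%:C%C * U p.
  apply: eq_big_nat => p hp; case: (boolP (prime p)) => pp; last first.
    have wp0 : (wp R p)%:C%C = 0 :> C by rewrite /wp (negbTE pp) mul0r.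
    by rewrite wp0 !mul0r.
  congr (_ * _); rewrite (@logn_fact_short p n J.+1) //; first by rewrite /U expr_sum.
    by nlia.
  have ps : n%:R `^ s < p%:R :> R.
    apply: (lt_le_trans (truncnS_gt _)); rewrite ler_nat; case/andP: hp => //.
  rewrite -(@ltr_nat R) natrX.
  apply: (@le_lt_trans _ _ ((n%:R `^ s) ^+ J.+2)).
    rewrite powR_natM // -[leLHS](@powRr1 R) //; apply: powR_le_exp => //; exact: ltW.
  by rewrite ltrXn2r ?nnegrE ?powR_ge0.
have main : cabs (\sum_((cutoff s n).+1 <= p < (cutoff t n).+1) (wp R p)%:C%C * V p)
    <= ep / 2 * ln n%:R.
  have VE p : (wp R p)%:C%C * V p = \sum_(f : FT) (\prod_(j < J.+1) c (f j).1 (f j).2) *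
      ((wp R p)%:C%C * e (phase 1 J.+1 (fun j => al f j * n%:R) p)).
    rewrite /V /T.
    rewrite (eq_bigr (fun j : 'I_J.+1 => \sum_(kl : 'I_N * 'I_N) c kl.1 kl.2 *
       e ((kl.1%:R - kl.2%:R) * (n%:R / p%:R ^+ j.+1 / h%:R)))) => [|j _]; last first.
      by rewrite pair_big.
    rewrite bigA_distr_bigA big_distrr; apply: eq_bigr => f _.
    rewrite big_split mulrCA; congr (_ * (_ * _)).
    rewrite -e_sum /phase big_add1 big_mkord; congr e; apply: eq_bigr => j _.
    by rewrite /al succnK inord_val; ring.
  rewrite (eq_bigr _ (fun p _ => VE p)) exchange_big; apply: (le_trans (cabs_sum _ _ _)).
  apply: (@le_trans _ _ (\sum_(f : FT) ep3 * ln n%:R)); last first.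
    rewrite sumr_const -[leLHS]mulr_natr mulrAC; apply: lemul2r; first by lra.
    rewrite /ep3; have -> : ep / (2 * (#|FT|.+1)%:R) * #|FT|%:R = ep / 2 * (#|FT|%:R / (#|FT|.+1)%:R).
      by field; rewrite gt_eqF.
    rewrite -[leRHS]mulr1; apply: lemul2l; first by rewrite divr_ge0 // ltW.
    by rewrite ler_pdivrMr // mul1r ler_nat.
  apply: ler_sum => f _; rewrite -big_distrr cabsM.
  case: (eqVneq (f ord0).1 (f ord0).2) => hf.
    have -> : \prod_(j < J.+1) c (f j).1 (f j).2 = 0.
      by rewrite (bigD1 ord0) //= hf c0 mul0r.
    rewrite cabs0 mul0r mulr_ge0 //; [exact: ltW|lra].
  apply: le_trans (h1 f hf); rewrite -[leRHS]mul1r.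
  apply: lemul2r; first exact: cabs_ge0.
  rewrite cabs_prod; have : 0 <= \prod_(j < J.+1) cabs (c (f j).1 (f j).2) <= 1; last by case/andP.
  elim/big_ind: _ => [|u v /andP[u0 u1] /andP[v0 v1]|i _]; first by rewrite ler01 lexx.
    by rewrite mulr_ge0 // mulr_ile1.
  by rewrite cabs_ge0 c1.
have -> : \sum_((cutoff s n).+1 <= p < (cutoff t n).+1) (wp R p)%:C%C * U p =
   \sum_((cutoff s n).+1 <= p < (cutoff t n).+1) (wp R p)%:C%C * V p +
   \sum_((cutoff s n).+1 <= p < (cutoff t n).+1) (wp R p)%:C%C * (U p - V p).
  have -> : \sum_((cutoff s n).+1 <= p < (cutoff t n).+1) (wp R p)%:C%C * (U p - V p) =
     \sum_((cutoff s n).+1 <= p < (cutoff t n).+1) (wp R p)%:C%C * U p -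
     \sum_((cutoff s n).+1 <= p < (cutoff t n).+1) (wp R p)%:C%C * V p.
    by rewrite -sumrB; apply: eq_bigr => p _; rewrite mulrBr.
  by rewrite addrC subrK.
apply: (le_trans (cabsD _ _)).
suff err : cabs (\sum_((cutoff s n).+1 <= p < (cutoff t n).+1)
    (wp R p)%:C%C * (U p - V p)) <= ep / 2 * ln n%:R.
  by apply: (le_trans (lerD main err)); lra.
apply: (le_trans (cabs_sum _ _ _)).
apply: (@le_trans _ _ (\sum_((cutoff s n).+1 <= p < (cutoff t n).+1) \sum_(j < J.+1)
    (ep1 * wp R p + 8 / N0%:R * (wp R p * fejer N0 (n%:R / p%:R ^+ j.+1))))).
  apply: ler_sum_nat => p hp; rewrite cabsM cabs_real ger0_norm ?wp_ge0 //.
  have p0 : (0 < p)%N by case/andP: hp => hp _; exact: leq_ltn_trans hp.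
  have hU : cabs (U p - V p) <= \sum_(j < J.+1) (ep1 + 8 / N0%:R * fejer N0 (n%:R / p%:R ^+ j.+1)).
    apply: (le_trans (prod_diff_le _ _ _)).
    - by move=> j; rewrite cabsX cabs_e expr1n.
    - by move=> j; have [] := cT (n%:R / p%:R ^+ j.+1).
    apply: ler_sum => j _.
    have pj : (0 < p ^ j.+1)%N by rewrite expn_gt0 p0.
    have := @step_error N0 N c ep1 n (p ^ j.+1)%N N00 pj (ltW ep10) cT.
    by rewrite natrX.
  apply: (@le_trans _ _ (wp R p * \sum_(j < J.+1) (ep1 + 8 / N0%:R * fejer N0 (n%:R / p%:R ^+ j.+1)))).
    by apply: lemul2l => //; exact: wp_ge0.
  rewrite big_distrr le_eqVlt; apply/orP; left; apply/eqP; apply: eq_bigr => j _ /=.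
  ring.
rewrite exchange_big /=.
apply: (@le_trans _ _ (\sum_(j < J.+1) (ep1 * (2 * ln n%:R) + 8 / N0%:R * (3 * ln n%:R)))).
  apply: ler_sum => j _; rewrite big_split /= -!big_distrr /=; apply: lerD.
    by apply: lemul2l => //; exact: ltW.
  apply: lemul2l; first by rewrite divr_ge0.
  exact: h2.
rewrite sumr_const card_ord -[leLHS]mulr_natr.
have -> : (ep1 * (2 * ln n%:R) + 8 / N0%:R * (3 * ln n%:R)) * J.+1%:R =
   (ep / 4 + 24 * J.+1%:R / N0%:R) * ln n%:R.
  by rewrite /ep1; field; rewrite !gt_eqF //; lra.
apply: lemul2r; first by lra.
have : 24 * J.+1%:R / N0%:R <= ep / 4.
  rewrite ler_pdivrMr; last by lra.
  move: hN0; rewrite ler_pdivrMr //; lra.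
lra.
Qed.

End GenericRange.

(** * All ranges, and the theorem *)

Section AllRanges.
Variable R : realType.
Variables (h a : nat).
Hypothesis ah : (0 < a < h)%N.

Local Notation twisted := (@twisted R h a).
Local Notation small := (@small R h a).

Lemma twisted_cat s u t n : s <= u -> u <= t -> (0 < n)%N ->
  twisted s t n = twisted s u n + twisted u t n.
Proof.
move=> su ut n0; rewrite /twisted (@big_cat_nat _ _ _ (cutoff u n).+1) //.
  by rewrite ltnS cutoff_mono.
by rewrite ltnS cutoff_mono.
Qed.

Lemma twisted_le s t n : 0 <= s -> s <= t -> (0 < n)%N ->
  cabs (twisted s t n) <= (t - s) * ln n%:R + 14.
Proof.
move=> s0 st n0; have := mertens_range s0 st n0; rewrite ler_norml => /andP[_ mer].
apply: (@le_trans _ _ (\sum_((cutoff s n).+1 <= p < (cutoff t n).+1) wp R p)); last by lra.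
apply: (le_trans (cabs_sum _ _ _)); apply: ler_sum => p _.
by rewrite cabsM cabs_real cabsX cabs_e expr1n mulr1 ger0_norm ?wp_ge0.
Qed.

Lemma small_refl s : small s s.
Proof.
move=> ep ep0; exists 0%N => n _; rewrite /twisted big_geq // cabs0.
by rewrite mulr_ge0 ?ln_nat_ge0 // ltW.
Qed.

Lemma small_cat s u t : s <= u -> u <= t -> small s u -> small u t -> small s t.
Proof.
move=> su ut h1 h2 ep ep0; have ep2 : 0 < ep / 2 by lra.
have [n1 {}h1] := h1 _ ep2; have [n2 {}h2] := h2 _ ep2.
exists (n1 + n2).+1 => n hn; have {}h1 := h1 n ltac:(nlia); have {}h2 := h2 n ltac:(nlia).
rewrite (@twisted_cat s u t) //; last by nlia.
by apply: (le_trans (cabsD _ _)); apply: (le_trans (lerD h1 h2)); lra.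
Qed.

(** By Mertens' theorem, short ranges of exponents at either end do not
    matter. *)
Lemma small_inner s t : 0 <= s ->
  (forall d, 0 < d -> exists s' t', [/\ s <= s', s' <= t', t' <= t,
     (s' - s <= d) && (t - t' <= d) & small s' t']) -> small s t.
Proof.
move=> s0 hin ep ep0; have ep4 : 0 < ep / 4 by lra.
have [s' [t' [ss st tt /andP[ds dt] sm]]] := hin _ ep4.
have [n1 {}sm] := sm _ ep4; have [n2 h2] := ln_nat_large (112 / ep).
exists (n1 + n2).+1 => n hn; have {}sm := sm n ltac:(nlia); have {}h2 := h2 n ltac:(nlia).
have n0 : (0 < n)%N by nlia.
have l0 := ln_nat_ge0 R n.
have st' : s' <= t by lra.
rewrite (twisted_cat ss st' n0) (twisted_cat st tt n0).
have b1 := twisted_le s0 ss n0.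
have s'0 : 0 <= t' by lra.
have b2 := twisted_le s'0 tt n0.
apply: (le_trans (cabsD _ _)); have := cabsD (twisted s' t' n) (twisted t' t n).
have c1 : (s' - s) * ln n%:R <= ep / 4 * ln n%:R by apply: lemul2r.
have c2 : (t - t') * ln n%:R <= ep / 4 * ln n%:R by apply: lemul2r.
move: h2; rewrite ler_pdivrMr // => h2; lra.
Qed.

(** The generic ranges exhaust this one up to arbitrarily short ranges at its
    ends. *)
Lemma small_between J s t : 1 <= s * J.+2%:R -> s <= t -> t * J.+1%:R <= 1 -> small s t.
Proof.
move=> sJ st tJ.
have J1 : 0 < J.+1%:R :> R by rewrite ltr0n.
have J2 : 0 < J.+2%:R :> R by rewrite ltr0n.
have s0 : 0 <= s.
  by rewrite leNgt; apply/negP => s0; nra.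
apply: small_inner => // d d0; case: (leP (t - s) (2 * d)) => hd.
  exists ((s + t) / 2), ((s + t) / 2); split; try lra.
  exact: small_refl.
exists (s + d), (t - d); split; try lra.
apply: (generic_range_small ah (J := J)).
- by rewrite mulrDl; have := mulr_gt0 d0 J2; lra.
- by lra.
- by rewrite mulrBl; have := mulr_gt0 d0 J1; lra.
Qed.

(** The range is cut at the exponents [1 / j]. *)
Lemma small_above J s t : 1 <= s * J.+1%:R -> s <= t -> t <= 1 -> small s t.
Proof.
elim: J s t => [|J IH] s t sJ st t1.
  have -> : s = t by lra.
  exact: small_refl.
have J1 : 0 < J.+1%:R :> R by rewrite ltr0n.
case: (leP (t * J.+1%:R) 1) => tJ; first exact: (small_between sJ).
case: (leP 1 (s * J.+1%:R)) => sJ1; first exact: IH.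
have uJ : J.+1%:R^-1 * J.+1%:R = 1 :> R by rewrite mulVf // gt_eqF.
have su : s <= J.+1%:R^-1 by rewrite -[leRHS]mul1r ler_pdivlMr // ltW.
have ut : J.+1%:R^-1 <= t by rewrite -[leLHS]mul1r ler_pdivrMr // ltW.
apply: (small_cat su ut); first by apply: (small_between sJ) => //; rewrite uJ.
by apply: IH => //; rewrite uJ.
Qed.

(** The exponents below [d] contribute little, and the others are above some
    [1 / J]. *)
Theorem small_all s t : 0 <= s -> s <= t -> t <= 1 -> small s t.
Proof.
move=> s0 st t1; apply: small_inner => // d d0.
case: (leP t d) => td.
  exists t, t; split=> //; first by apply/andP; split; lra.
  exact: small_refl.
have hmax : d <= Num.max s d by rewrite le_max lexx orbT.
exists (Num.max s d), t; split=> //.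
- by rewrite le_max lexx.
- by rewrite ge_max st ltW.
- apply/andP; split; last by lra.
  by rewrite maxEle; case: ifP => _; lra.
apply: (@small_above (Num.trunc d^-1)) => //; last by rewrite ge_max st ltW.
apply: (@le_trans _ _ (d * (Num.trunc d^-1).+1%:R)); last exact: lemul2r.
by rewrite mulrC -ler_pdivrMr // mul1r ltW // truncnS_gt.
Qed.

End AllRanges.

Section Final.
Variable R : realType.
Local Notation C := R[i].

(** Orthogonality of the characters of the integers modulo [h]. *)
Lemma residue_indicator h v c : (c < h)%N ->
  \sum_(k < h) e (- (k%:R * c%:R / h%:R) : R) * e (k%:R / h%:R) ^+ v =
  ((v %% h == c)%N%:R * h%:R)%:C%C.
Proof.
move=> ch; have h0 : 0 < h%:R :> R by rewrite ltr0n; nlia.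
set i := ((v + (h - c)) %% h)%N; set Q := ((v + (h - c)) %/ h)%N.
have E : (v%:R + h%:R - c%:R) / h%:R = Q%:R + i%:R / h%:R :> R.
  have : (v + (h - c))%N%:R = (Q * h + i)%N%:R :> R by rewrite -divn_eq.
  rewrite !natrD natrB ?(ltnW ch) // natrM => hE.
  by rewrite -addrA hE; field; rewrite gt_eqF.
have -> : \sum_(k < h) e (- (k%:R * c%:R / h%:R) : R) * e (k%:R / h%:R) ^+ v =
    dirichlet h (i%:R / h%:R).
  apply: eq_bigr => k _; rewrite -eMn -eD.
  rewrite -[RHS](e_shift _ (- (k%:Z * (Q%:Z - 1)))); congr e.
  rewrite mulrNz intrM intrB -!pmulrn -[_ *+ v]mulr_natr.
  have E2 : i%:R / h%:R = (v%:R + h%:R - c%:R) / h%:R - Q%:R :> R by rewrite E addrAC subrr add0r.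
  by rewrite E2; field; rewrite gt_eqF.
have cE : (c + (h - c) = h)%N by nlia.
case: eqP => hv.
  have i0 : i = 0%N by rewrite /i -modnDml hv cE modnn.
  rewrite i0 mul0r mul1r /dirichlet (eq_bigr (fun=> 1)) => [|k _]; last by rewrite mul0r e0.
  by rewrite sumr_const card_ord rmorph_nat.
rewrite mul0r; apply: roots_of_unity_sum; rewrite ltn_mod andbC; apply/andP; split; first by nlia.
rewrite lt0n; apply/eqP => i0; apply: hv.
have : (v + (h - c) == c + (h - c) %[mod h])%N by rewrite cE modnn -/i i0.
by rewrite eqn_modDr (modn_small ch) => /eqP.
Qed.

(** Rounding [n / p] costs at most [theta N], and the higher powers of [p] at
    most [n] times the convergent sum of [ln p / (p * (p - 1))]. *)
Lemma logn_weight_error n N : (N <= n)%N ->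
  \sum_(0 <= p < N.+1) `|(prime p)%:R * ((logn p n`!)%:R * ln p%:R) - n%:R * wp R p| <=
  8 * n%:R.
Proof.
move=> Nn.
apply: (@le_trans _ _ (\sum_(0 <= p < N.+1) ((prime p)%:R * ln p%:R +
   n%:R * ((prime p)%:R * (ln p%:R / (p%:R * (p%:R - 1))))))).
  apply: ler_sum => p _; rewrite /wp; case: (boolP (prime p)) => pp; last first.
    by rewrite !mul0r !mulr0 subrr normr0 addr0.
  have l0 := ln_nat_ge0 R p.
  have p2 : 2 <= p%:R :> R by rewrite ler_nat prime_gt1.
  have hi := logn_fact_le R n pp; have lo := logn_fact_ge R n pp.
  rewrite !mul1r ler_norml; apply/andP; split.
    have q0 : 0 <= n%:R * (ln p%:R / (p%:R * (p%:R - 1))) :> R.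
      by rewrite mulr_ge0 // divr_ge0 // mulr_ge0 //; lra.
    have : (n%:R / p%:R - 1) * ln p%:R <= (logn p n`!)%:R * ln p%:R :> R by exact: lemul2r.
    by rewrite mulrBl mul1r mulrAC -mulrA; lra.
  have := lemul2r l0 hi; rewrite mulrDl.
  have -> : n%:R / p%:R * ln p%:R = n%:R * (ln p%:R / p%:R) :> R by ring.
  have -> : n%:R / (p%:R * (p%:R - 1)) * ln p%:R = n%:R * (ln p%:R / (p%:R * (p%:R - 1))) :> R by ring.
  by lra.
rewrite big_split /= -big_distrr /=.
have t1 := theta_le R N; have t2 := sum_ln_over_square R N.
have NR : N%:R <= n%:R :> R by rewrite ler_nat.
have t3 : n%:R * \sum_(0 <= p < N.+1) (prime p)%:R * (ln p%:R / (p%:R * (p%:R - 1))) <= n%:R * 2 :> R.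
  exact: lemul2l.
apply: (le_trans (lerD t1 t3)); lra.
Qed.

Lemma vp_log_sumE h (c : 'Z_h) (a b : R) n : (1 < h)%N -> 0 <= a -> b <= 1 -> (0 < n)%N ->
  vp_log_sum c a b n =
  \sum_((cutoff a n).+1 <= p < (cutoff b n).+1)
    (logn p n`! %% h == c)%N%:R * ((prime p)%:R * ((logn p n`!)%:R * ln p%:R)).
Proof.
move=> h1 a0 b1 n0; rewrite /vp_log_sum big_mkcond /=.
have nr : 1 <= n%:R :> R by rewrite ler1n.
have bn : (cutoff b n <= n)%N.
  rewrite -(@ler_nat R); apply: (le_trans (cutoff_le b n)).
  by rewrite -[leRHS](@powRr1 R) //; exact: powR_le_exp.
have rangeE p : (n%:R `^ a < p%:R) && (p%:R <= n%:R `^ b) =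
    ((cutoff a n).+1 <= p < (cutoff b n).+1)%N.
  by rewrite ltnS truncn_lt_nat ?powR_ge0 // truncn_ge_nat ?powR_ge0.
rewrite (@sum_restrict R _ (cutoff a n).+1 (cutoff b n).+1).
- apply: eq_big_nat => p; rewrite -rangeE => /andP[pa pb]; rewrite pa pb /=.
  have -> : ((logn p n`!)%:R == c) = (logn p n`! %% h == c)%N.
    by rewrite -val_eqE /= val_Zp_nat.
  by case: prime; case: eqP => _ /=; rewrite ?mul1r ?mul0r ?mulr0.
- by rewrite ltnS.
by move=> p; rewrite -rangeE negb_and => /orP[] /negbTE ->; rewrite ?andbF.
Qed.

(** The residue class is detected by the characters of the integers modulo
    [h]. The trivial one gives the main term, by Mertens' theorem; the others
    give twisted sums, which are negligible by [small_all]. *)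
Lemma vp_log_sum_asymptotic h (c : 'Z_h) (a b ep : R) : (1 < h)%N ->
  0 <= a -> a <= b -> b <= 1 -> 0 < ep ->
  exists n0, forall n, (n0 <= n)%N ->
    `|vp_log_sum c a b n - (b - a) / h%:R * (n%:R * ln n%:R)| <= ep * (n%:R * ln n%:R).
Proof.
move=> h1 a0 ab b1 ep0; have h0 : 0 < h%:R :> R by rewrite ltr0n; nlia.
have ep2 : 0 < ep / 2 by lra.
have [n1 hs] : exists n0, forall n, (n0 <= n)%N -> forall k : 'I_h, (0 < k)%N ->
    cabs (@twisted R h k a b n) <= ep / 2 * ln n%:R.
  apply: (@eventually_fin 'I_h (fun k n => (0 < k)%N ->
    cabs (@twisted R h k a b n) <= ep / 2 * ln n%:R)) => k.
  case: (posnP k) => k0; first by exists 0%N.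
  have kh : (0 < k < h)%N by rewrite k0 ltn_ord.
  have [n0 hn0] := small_all kh a0 ab b1 ep2.
  by exists n0 => n hn _; exact: hn0.
have [n2 hl] := ln_nat_large (44 / ep).
exists (n1 + n2).+1 => n hn; have {}hs := hs n ltac:(nlia); have {}hl := hl n ltac:(nlia).
have n0 : (0 < n)%N by nlia.
have nr : 1 <= n%:R :> R by rewrite ler1n.
have np : 0 <= n%:R :> R by [].
have l0 := ln_nat_ge0 R n.
rewrite (vp_log_sumE c h1 a0 b1 n0).
set lo := (cutoff a n).+1; set hi := (cutoff b n).+1.
pose v p := logn p n`!.
pose u p : R := (prime p)%:R * ((v p)%:R * ln p%:R).
set S := \sum_(lo <= p < hi) _.
pose A (k : nat) : C := \sum_(lo <= p < hi) (u p)%:C%C * e (k%:R / h%:R) ^+ v p.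
have ch : (c < h)%N by have := ltn_ord c; rewrite [in X in (_ < X)%N](Zp_cast h1).
have SE : (S * h%:R)%:C%C = \sum_(k < h) e (- (k%:R * c%:R / h%:R)) * A k.
  rewrite (eq_bigr (fun k : 'I_h => \sum_(lo <= p < hi) (u p)%:C%C *
     (e (- (k%:R * c%:R / h%:R)) * e (k%:R / h%:R) ^+ v p))) => [|k _]; last first.
    by rewrite /A big_distrr; apply: eq_bigr => p _; rewrite mulrCA.
  rewrite exchange_big /S big_distrl rmorph_sum; apply: eq_bigr => p _.
  rewrite -big_distrr residue_indicator //.
  rewrite -[RHS](rmorphM (real_complex R)); congr (_ %:C)%C.
  by rewrite /u /v /=; ring.
have bn : (cutoff b n <= n)%N.
  rewrite -(@ler_nat R); apply: (le_trans (cutoff_le b n)).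
  by rewrite -[leRHS](@powRr1 R) //; exact: powR_le_exp.
have err : \sum_(lo <= p < hi) `|u p - n%:R * wp R p| <= 8 * n%:R.
  apply: le_trans (logn_weight_error bn).
  have lohi : (lo <= hi)%N by rewrite ltnS cutoff_mono.
  rewrite [leRHS](@big_cat_nat _ _ _ lo) // -[leLHS]add0r; apply: lerD => //.
  by apply: sumr_ge0.
have AE k : cabs (A k - n%:R%:C%C * @twisted R h k a b n) <= 8 * n%:R.
  apply: le_trans err; rewrite /A /twisted big_distrr -sumrB.
  apply: (le_trans (cabs_sum _ _ _)); apply: ler_sum => p _.
  apply: (@le_trans _ _ (cabs ((u p - n%:R * wp R p)%:C%C * e (k%:R / h%:R) ^+ v p))).
    have hz (U W M : R) (z : C) :
        (U - M * W)%:C%C * z = U%:C%C * z - M%:C%C * (W%:C%C * z).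
      by rewrite rmorphB rmorphM mulrBl mulrA.
    by rewrite hz.
  by rewrite cabsM cabs_real cabsX cabs_e expr1n mulr1.
have A0 : cabs (A 0%N - (n%:R * ((b - a) * ln n%:R))%:C%C) <= 22 * n%:R.
  have -> : A 0%N - (n%:R * ((b - a) * ln n%:R))%:C%C =
      (A 0%N - n%:R%:C%C * @twisted R h 0 a b n) +
      (n%:R * (\sum_(lo <= p < hi) wp R p - (b - a) * ln n%:R))%:C%C.
    have -> : @twisted R h 0 a b n = (\sum_(lo <= p < hi) wp R p)%:C%C.
      rewrite rmorph_sum; apply: eq_bigr => p _.
      by rewrite mul0r e0 expr1n mulr1.
    rewrite -[n%:R%:C%C * _](rmorphM (real_complex R)) mulrBr.
    rewrite [in RHS]rmorphB /=; ring.
  apply: (le_trans (cabsD _ _)).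
  have -> : 22 * n%:R = 8 * n%:R + n%:R * 14 :> R by ring.
  apply: lerD; first exact: AE.
  rewrite cabs_real normrM [`|n%:R|]ger0_norm //; apply: lemul2l => //.
  exact: mertens_range.
have Ak (k : 'I_h) : (0 < k)%N -> cabs (A k) <= 8 * n%:R + n%:R * (ep / 2 * ln n%:R).
  move=> k0; rewrite -[A k](subrK (n%:R%:C%C * @twisted R h k a b n)).
  apply: (le_trans (cabsD _ _)); apply: lerD; first exact: AE.
  by rewrite cabsM cabs_real ger0_norm //; apply: lemul2l => //; exact: hs.
pose bd0 : R := 22 * n%:R + n%:R * (ep / 2 * ln n%:R).
have bound : `|S * h%:R - n%:R * ((b - a) * ln n%:R)| <= h%:R * bd0.
  rewrite -cabs_real rmorphB [X in X - _]SE.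
  have h00 : (0 < h)%N by nlia.
  rewrite (bigD1 (Ordinal h00)) //= mul0r mul0r oppr0 e0 mul1r addrAC.
  apply: (le_trans (cabsD _ _)).
  have -> : h%:R * bd0 = \sum_(k < h) bd0 by rewrite sumr_const card_ord mulr_natl.
  rewrite [leRHS](bigD1 (Ordinal h00)) //=; apply: lerD.
    apply: (le_trans A0); rewrite lerDl !mulr_ge0 //; exact: ltW.
  apply: (le_trans (cabs_sum _ _ _)); apply: ler_sum => k kn0.
  rewrite cabsM cabs_e mul1r; apply: (le_trans (Ak k _)).
    by rewrite lt0n; apply: contra kn0 => /eqP k0; apply/eqP/val_inj.
  by rewrite lerD2r; apply: lemul2r => //; lra.
have -> : S - (b - a) / h%:R * (n%:R * ln n%:R) =
    (S * h%:R - n%:R * ((b - a) * ln n%:R)) / h%:R by field; rewrite gt_eqF.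
rewrite normrM normfV [`|h%:R|]ger0_norm // ler_pdivrMr //.
apply: (le_trans bound); rewrite mulrC; apply: lemul2r => //.
rewrite /bd0; have -> : 22 * n%:R + n%:R * (ep / 2 * ln n%:R) =
   n%:R * (22 + ep / 2 * ln n%:R) by ring.
have -> : ep * (n%:R * ln n%:R) = n%:R * (ep * ln n%:R) by ring.
apply: lemul2l => //; move: hl; rewrite ler_pdivrMr //; lra.
Qed.

End Final.

Theorem theorem1p1 (R : realType) (h : nat) (hh : (2 <= h)%N) (c : 'Z_h)
    (a b : R) (ha : 0 <= a) (hab : a < b) (hb : b <= 1) :
  exists e : nat -> R,
    (e n @[n --> \oo] --> (0 : R)) /\
    forall n : nat, (0 < n)%N ->
      vp_log_sum c a b n = ((b - a) / h%:R + e n) * ln ((n`!)%:R : R).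
Proof.
pose k := (b - a) / h%:R.
have h0 : 1 <= h%:R :> R by rewrite ler1n; nlia.
have k01 : 0 <= k <= 1.
  apply/andP; split; first by apply: divr_ge0; lra.
  by rewrite ler_pdivrMr; lra.
exists (fun n => vp_log_sum c a b n / ln (n`!)%:R - k); split; last first.
  move=> n n0; rewrite addrC subrK.
  case: (leqP 2 n) => n2.
    rewrite divfK // gt_eqF // ln_gt0 // ltr1n.
    by apply: leq_trans n2 (fact_geq n).
  (* At [n = 1] both sides vanish: there is no prime up to [1], and
     [ln 1 = 0]. *)
  have -> : n = 1%N by nlia.
  rewrite factS fact0 muln1 ln1 mulr0 /vp_log_sum big1_seq // => p /andP[/and4P[pp _ _ _]].
  by rewrite mem_index_iota; have := prime_gt1 pp; nlia.
apply/cvgrPdist_le => ep ep0.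
have ep4 : 0 < ep / 4 by lra.
have [n1 h1] := vp_log_sum_asymptotic c hh ha (ltW hab) hb ep4.
have [n2 h2] := ln_nat_large (2 + 4 / ep).
exists (n1 + n2).+1 => // n /= hn.
have {}h1 := h1 n ltac:(nlia); have {}h2 := h2 n ltac:(nlia).
have n0 : (0 < n)%N by nlia.
have nr : 0 < n%:R :> R by rewrite ltr0n.
have e4 : 0 < 4 / ep by exact: divr_gt0.
have lo := ln_fact_ge R n0; have up := ln_fact_le R n.
have l2 : 2 <= ln n%:R :> R by lra.
have F0 : n%:R * ln n%:R <= 2 * ln (n`!)%:R :> R by nra.
have Fp : 0 < ln (n`!)%:R :> R by nra.
rewrite sub0r normrN.
have -> : vp_log_sum c a b n / ln (n`!)%:R - k =
   (vp_log_sum c a b n - k * ln (n`!)%:R) / ln (n`!)%:R by field; rewrite gt_eqF.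
rewrite normrM normfV [`|ln _|]gtr0_norm // ler_pdivrMr //.
have -> : vp_log_sum c a b n - k * ln (n`!)%:R =
  (vp_log_sum c a b n - k * (n%:R * ln n%:R)) + k * (n%:R * ln n%:R - ln (n`!)%:R) by ring.
apply: (le_trans (ler_normD _ _)).
have d0 : 0 <= n%:R * ln n%:R - ln (n`!)%:R :> R by rewrite subr_ge0.
have b2 : `|k * (n%:R * ln n%:R - ln (n`!)%:R)| <= n%:R.
  rewrite ger0_norm; last by apply: mulr_ge0 => //; lra.
  apply: (@le_trans _ _ (1 * (n%:R * ln n%:R - ln (n`!)%:R))); last by lra.
  by apply: lemul2r => //; lra.
apply: (le_trans (lerD h1 b2)).
have hn4 : n%:R <= ep / 4 * (n%:R * ln n%:R).
  have : 4 <= ep * ln n%:R by rewrite mulrC -ler_pdivrMr //; lra.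
  by move=> h4; nra.
have : ep / 4 * (n%:R * ln n%:R) <= ep / 4 * (2 * ln (n`!)%:R).
  by apply: lemul2l => //; exact: ltW.
lra.
Qed.
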